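(* Let $f(z)=\lambda z+bz^2+z^3$ with $|\lambda|\le1$ have connected filled Julia set $K$, and suppose there are Jordan domains $U^*\Subset V^*$ with $0\in U^*$ such that $f:U^*\to V^*$ is proper holomorphic of degree $2$; let $K^*=\{z\in U^*: f^n(z)\in U^*\ \forall n\ge0\}$. Let $\mathfrak{U}$ be the invariant quadratic gap associated with $f$ (described in the context) and $M_{\mathfrak{U}}$ its major. If $\alpha\in\mathfrak{U}\cap\mathbb{S}^1$ is a (pre)periodic angle under $\sigma_3$ such that $\sigma_3^n(\alpha)$ is never an endpoint of $M_{\mathfrak{U}}$ for $n\ge 0$, then the external ray $R(\alpha)$ of $f$ lands at a point of $K^*$.
   Context: Identify $\mathbb{R}/\mathbb{Z}$ with the unit circle $\mathbb{S}^1$ and let $\sigma_k(\theta)=k\theta \bmod 1$. For a closed set $A\subset\mathbb{S}^1$ with at least three points, its convex hull $G$ is a gap; edges are chords in $\partial G$, holes are components of $\mathbb{S}^1\setminus G$. $G$ is $\sigma_3$-invariant if every edge (mapped via its endpoints) is mapped to an edge of $G$ or to a point of $G\cap\mathbb{S}^1$; it is quadratic if, after collapsing holes, $\sigma_3$ on $\partial G$ induces a locally strictly monotone orientation-preserving two-to-one covering of the circle. For such $G$ with $G\cap\mathbb{S}^1$ without isolated points, there is a unique hole (the major hole) of length at least $1/3$, and the major $M_G$ is the chord joining its endpoints; $G$ is of regular critical type if the endpoints of $M_G$ have the same $\sigma_3$-image and of periodic type if the endpoints of $M_G$ are $\sigma_3$-periodic. Let $\widetilde U^*$ be the component of $f^{-1}(V^*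 )$ other than $U^*$ and $\widetilde K^*=\widetilde U^*\cap f^{-1}(K^* )$. The gap $\mathfrak{U}$ is the unique $\sigma_3$-invariant quadratic gap (of regular critical or periodic type) such that: whenever a (pre)periodic external ray $R(\alpha)$ of $f$ lands in $K^*$, $\alpha\in\mathfrak{U}$; and whenever a (pre)periodic external ray $R(\beta)$ lands in $\widetilde K^*$, $\beta$ lies in the closure of the major hole of $\mathfrak{U}$. *)

(* Defs.v *)
From Stdlib Require Import Reals List.
From Coquelicot Require Import Coquelicot.
Open Scope R_scope.

Definition eqmod1 (x y : R) : Prop := exists k : Z, x - y = IZR k.

Definition sig3n (n : nat) (x : R) : R := 3 ^ n * x.

Definition periodic_angle (x : R) : Prop :=
  exists n : nat, (1 <= n)%nat /\ eqmod1 (sig3n n x) x.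

Definition preperiodic_angle (x : R) : Prop :=
  exists m n : nat, (1 <= n)%nat /\ eqmod1 (sig3n (m + n) x) (sig3n m x).

(* A : R -> Prop is the 1-periodic lift of G ∩ S^1 *)
Definition gap_set (A : R -> Prop) : Prop :=
  (forall x, A x <-> A (x + 1)) /\
  (forall x, (forall eps, 0 < eps -> exists y, A y /\ Rabs (y - x) < eps) -> A x) /\
  (exists x y z, A x /\ A y /\ A z /\
     ~ eqmod1 x y /\ ~ eqmod1 y z /\ ~ eqmod1 x z).

(* the open arc (a,b) (a < b < a+1) is a hole, i.e. a component of S^1 \ G;
   its edge is the chord joining a and b; its length is b - a *)
Definition hole (A : R -> Prop) (a b : R) : Prop :=
  a < b < a + 1 /\ A a /\ A b /\ (forall t, a < t < b -> ~ A t).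

Definition s3_invariant (A : R -> Prop) : Prop :=
  forall a b, hole A a b ->
    (eqmod1 (3 * a) (3 * b) /\ A (3 * a)) \/
    (exists c d, hole A c d /\
       ((eqmod1 (3 * a) c /\ eqmod1 (3 * b) d) \/
        (eqmod1 (3 * a) d /\ eqmod1 (3 * b) c))).

(* quadratic: psi (lift of a monotone degree-one circle map) collapses exactly the
   closures of holes; the map induced by sigma_3 on the quotient circle is an
   orientation preserving, locally strictly monotone two-to-one covering g
   (lift with g(x+1) = g(x) + 2). *)
Definition quadratic_gap (A : R -> Prop) : Prop :=
  exists psi g : R -> R,
    continuity psi /\
    (forall x y, x <= y -> psi x <= psi y) /\
    (forall x, psi (x + 1) = psi x + 1) /\
    (forall x y, x < y < x + 1 ->
       (psi x = psi y <-> (forall t, x < t < y -> ~ A t))) /\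
    continuity g /\
    (forall x y, x < y -> g x < g y) /\
    (forall x, g (x + 1) = g x + 2) /\
    (forall x, A x -> eqmod1 (psi (3 * x)) (g (psi x))).

Open Scope C_scope.

Definition cubic (lam b : C) (z : C) : C := lam * z + b * z ^ 2 + z ^ 3.
Definition cubic' (lam b : C) (z : C) : C := lam + RtoC 2 * b * z + RtoC 3 * z ^ 2.
Definition cubic'' (b : C) (z : C) : C := RtoC 2 * b + RtoC 6 * z.

Definition iterate (f : C -> C) (n : nat) (z : C) : C := Nat.iter n f z.

Close Scope C_scope.

Definition subsetC (S T : C -> Prop) : Prop := forall z, S z -> T z.

Definition openC (S : C -> Prop) : Prop :=
  forall z, S z -> exists eps, 0 < eps /\
    forall w, Cmod (Cminus w z) < eps -> S w.

Definition boundedC (S : C -> Prop) : Prop :=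
  exists M, forall z, S z -> Cmod z <= M.

Definition closureC (S : C -> Prop) (z : C) : Prop :=
  forall eps, 0 < eps -> exists w, S w /\ Cmod (Cminus w z) < eps.

Definition compactC (S : C -> Prop) : Prop :=
  forall (I : Type) (O : I -> C -> Prop),
    (forall i, openC (O i)) ->
    (forall z, S z -> exists i, O i z) ->
    exists l : list I, forall z, S z -> exists i, In i l /\ O i z.

Definition connectedC (S : C -> Prop) : Prop :=
  ~ exists O1 O2 : C -> Prop,
      openC O1 /\ openC O2 /\
      (forall z, S z -> O1 z \/ O2 z) /\
      (exists z, S z /\ O1 z) /\ (exists z, S z /\ O2 z) /\
      (forall z, S z -> O1 z -> O2 z -> False).

Definition componentC (S D : C -> Prop) : Prop :=
  subsetC D S /\ (exists z, D z) /\ connectedC D /\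
  forall E, subsetC E S -> connectedC E -> (exists z, E z /\ D z) -> subsetC E D.

Definition jordan_curve (gam : R -> C) : Prop :=
  (forall t eps, 0 < eps -> exists del, 0 < del /\
     forall s, Rabs (s - t) < del -> Cmod (Cminus (gam s) (gam t)) < eps) /\
  (forall t, gam (t + 1) = gam t) /\
  (forall s t, 0 <= s < 1 -> 0 <= t < 1 -> gam s = gam t -> s = t).

Definition jordan_domain (D : C -> Prop) : Prop :=
  exists gam, jordan_curve gam /\
    componentC (fun z => forall t, z <> gam t) D /\ boundedC D.

Definition compactly_contained (U V : C -> Prop) : Prop :=
  compactC (closureC U) /\ subsetC (closureC U) V.

Definition cubic_mult (lam b : C) (z : C) : nat :=
  if Req_EM_T (Cmod (cubic' lam b z)) 0 then
    (if Req_EM_T (Cmod (cubic'' b z)) 0 then 3%nat else 2%nat)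
  else 1%nat.

Definition proper_degree2 (lam b : C) (U V : C -> Prop) : Prop :=
  (forall z, U z -> V (cubic lam b z)) /\
  (forall Kc, compactC Kc -> subsetC Kc V ->
     compactC (fun z => U z /\ Kc (cubic lam b z))) /\
  (forall w, V w -> exists l : list C, NoDup l /\
     (forall z, In z l <-> (U z /\ cubic lam b z = w)) /\
     fold_right (fun z s => (cubic_mult lam b z + s)%nat) 0%nat l = 2%nat).

Definition filled_julia (lam b : C) (z : C) : Prop :=
  exists M, forall n, Cmod (iterate (cubic lam b) n z) <= M.

Definition Kstar (lam b : C) (U : C -> Prop) (z : C) : Prop :=
  forall n, U (iterate (cubic lam b) n z).

Definition holomorphic_on (Om : C -> Prop) (g : C -> C) : Prop :=
  forall z, Om z -> exists l : C, forall eps, 0 < eps -> exists del, 0 < del /\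
    forall w, Om w -> 0 < Cmod (Cminus w z) < del ->
      Cmod (Cminus (Cdiv (Cminus (g w) (g z)) (Cminus w z)) l) < eps.

Definition bottcher (lam b : C) (phi : C -> C) : Prop :=
  let K := filled_julia lam b in
  holomorphic_on (fun z => ~ K z) phi /\
  (forall z w, ~ K z -> ~ K w -> phi z = phi w -> z = w) /\
  (forall z, ~ K z -> 1 < Cmod (phi z)) /\
  (forall w, 1 < Cmod w -> exists z, ~ K z /\ phi z = w) /\
  (forall z, ~ K z -> phi (cubic lam b z) = Cpow (phi z) 3) /\
  (forall eps, 0 < eps -> exists M, forall z, M < Cmod z ->
     Cmod (Cminus (Cdiv (phi z) z) 1) < eps).

Definition polar (r alpha : R) : C := (r * cos (2 * PI * alpha), r * sin (2 * PI * alpha)).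

Definition ray_lands (lam b : C) (phi : C -> C) (alpha : R) (z0 : C) : Prop :=
  forall eps, 0 < eps -> exists del, 0 < del /\
    forall r z, 1 < r < 1 + del -> ~ filled_julia lam b z ->
      phi z = polar r alpha -> Cmod (Cminus z z0) < eps.

(* Main.v *)
(** Write [Psi rho th] for the point of potential [rho] and angle [th] outside the filled
    Julia set [K]. Ahlfors' lemma, applied to the inverse branches of the iterates and to the plane
    punctured at a point of [K], shows that points whose coordinates differ by [O(rho)] become
    uniformly close as [rho -> 0] ([Psi_shrink]). Hence (pre)periodic rays land, and the ray of a
    periodic angle [alpha] lands in [K^*] as soon as some angle near [alpha] whose ray lands in [K^*]
    can be pulled back along the orbit of [alpha] with all rays still landing in [K^*]. An angle that
    avoids the closed major hole inherits this property from its image. One ray landing in [K^*]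
    exists because points of [U] outside [K] can be pulled back inside [U] forever; since
    [f : U -> V] has degree 2, at least two of the three preimages of an angle whose ray lands in
    [K^*] have the same property, and a periodic orbit in the gap that avoids the closed major hole
    is then approached by such angles. *)
Require Import Defs.
From Stdlib Require Import Reals List.
From Coquelicot Require Import Coquelicot.
From Stdlib Require Import ZArith Lra Lia ClassicalEpsilon Classical.
Open Scope R_scope.

(** The model metric is that of the punctured disc of radius [M] about [kappa] in [K], with density
    1 / (|w - kappa| ln (M / |w - kappa|)). It gives bounds for the inverse branches that do not
    depend on the iterate, and its singularity at [kappa] turns bounded distance into Euclidean
    smallness near [K]. The gap is tied to the dynamics through (pre)periodic angles, and these form
    no closed set; the combinatorial argument therefore works with suprema whose ends are only
    limits of good angles. The excluded endpoints of the major make pulling back robust: an orbit in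
    the gap then misses the closed arc [[a0, b0]] and, being finite mod 1, keeps a positive distance
    from it. Angles within that distance of a periodic orbit can be pulled back along it forever,
    their displacement shrinking by 3 each time. The length 1/3 of the major hole enters twice: it
    leaves a nonempty free interval after tripling a free interval around the hole, and it puts the
    two branches of the return map in the right order. *)

(** * Elementary estimates, cluster points and connectedness of an interval *)

Lemma Rlt_min_l a x y : a < Rmin x y -> a < x.
Proof. generalize (Rmin_l x y). lra. Qed.

Lemma Rlt_min_r a x y : a < Rmin x y -> a < y.
Proof. generalize (Rmin_r x y). lra. Qed.

Lemma functional_choice (A B : Type) (P : A -> B -> Prop) :
  (forall x, exists y, P x y) -> exists f : A -> B, forall x, P x (f x).
Proof.
  intro H. exists (fun x => proj1_sig (constructive_indefinite_description _ (H x))).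
  intro x. exact (proj2_sig (constructive_indefinite_description _ (H x))).
Qed.

Lemma Cdist_sym (z w : C) : Cmod (z - w) = Cmod (w - z).
Proof. rewrite <- Cmod_opp. f_equal. ring. Qed.

Lemma Cdist_tri (y x z : C) :
  Cmod (x - z) <= Cmod (x - y) + Cmod (y - z).
Proof.
  replace (x - z)%C with (x - y + (y - z))%C by ring.
  apply Cmod_triangle.
Qed.

Lemma Cmod_diff_le (z w : C) : Rabs (Cmod z - Cmod w) <= Cmod (z - w).
Proof.
  apply Rabs_le. split.
  - generalize (Cmod_triangle z (w - z)%C).
    replace (z + (w - z))%C with w by ring.
    rewrite (Cdist_sym w z). lra.
  - generalize (Cmod_triangle w (z - w)%C).
    replace (w + (z - w))%C with z by ring. lra.
Qed.

Lemma Cmod_le_ReIm (z : C) : Cmod z <= Rabs (Re z) + Rabs (Im z).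
Proof.
  destruct z as [x y]; simpl.
  replace (x, y) with (RtoC x + Ci * RtoC y)%C.
  - eapply Rle_trans. apply Cmod_triangle.
    rewrite Cmod_mult, Cmod_Ci, !Cmod_R. lra.
  - unfold Cplus, Cmult, Ci, RtoC; simpl. f_equal; ring.
Qed.

Lemma Im_le_Cmod (z : C) : Rabs (Im z) <= Cmod z.
Proof.
  generalize (Rmax_Cmod z). unfold Im. generalize (Rmax_r (Rabs (fst z)) (Rabs (snd z))). lra.
Qed.

Lemma Cminus_eq0 (z w : C) : (z - w)%C = RtoC 0 -> z = w.
Proof. intro H. replace z with (z - w + w)%C by ring. rewrite H. ring. Qed.

Lemma Cdist_eq0 (z w : C) : Cmod (z - w) = 0 -> z = w.
Proof. intro H. apply Cminus_eq0, Cmod_eq_0, H. Qed.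

Lemma Cdist_pos (z w : C) : z <> w -> 0 < Cmod (z - w).
Proof.
  intro H. destruct (Cmod_ge_0 (z - w)%C) as [h|h]; auto.
  elim H. now apply Cdist_eq0.
Qed.

Lemma Cdist_refl (z : C) : Cmod (z - z) = 0.
Proof. replace (z - z)%C with (RtoC 0) by ring. apply Cmod_0. Qed.

Lemma Cmult_eq0 (z w : C) : (z * w)%C = RtoC 0 -> z = RtoC 0 \/ w = RtoC 0.
Proof.
  intro H. assert (E : Cmod z * Cmod w = 0) by (rewrite <- Cmod_mult, H; apply Cmod_0).
  destruct (Rmult_integral _ _ E); [left|right]; now apply Cmod_eq_0.
Qed.

Lemma eq_limC (z w : C) : (forall eps, 0 < eps -> Cmod (z - w) <= eps) -> z = w.
Proof.
  intro H. apply Cdist_eq0. apply Rle_antisym; [|apply Cmod_ge_0].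
  apply le_epsilon. intros e He. rewrite Rplus_0_l. auto.
Qed.

Lemma inv_INR_pos n : 0 < / (INR n + 1).
Proof. apply Rinv_0_lt_compat. generalize (pos_INR n). lra. Qed.

Lemma ln_pos x : 1 < x -> 0 < ln x.
Proof. intro H. rewrite <- ln_1. apply ln_increasing; lra. Qed.

Lemma least_nat (P : nat -> Prop) : (exists n, P n) -> exists n, P n /\ forall m, P m -> (n <= m)%nat.
Proof.
  intro H. destruct (dec_inh_nat_subset_has_unique_least_element P (fun n => classic _) H) as [n [Hn _]].
  exists n. exact Hn.
Qed.

Lemma inv_INR_small (eps : R) : 0 < eps -> exists N, forall n, (N <= n)%nat -> / (INR n + 1) < eps.
Proof.
  intro He. destruct (archimed_cor1 eps He) as [N [HN H0]].
  exists N. intros n Hn. apply Rle_lt_trans with (/ INR N); auto.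
  apply Rinv_le_contravar. now apply lt_0_INR.
  apply le_INR in Hn. lra.
Qed.

Lemma cluster_R (u : nat -> R) (M : R) : (forall n, Rabs (u n) <= M) ->
  exists l, forall eps N, 0 < eps -> exists n, (N <= n)%nat /\ Rabs (u n - l) < eps.
Proof.
  intro H.
  destruct (Bolzano_Weierstrass u (fun c => - M <= c <= M) (compact_P3 _ _)) as [l Hl].
  { intro n. specialize (H n). apply Rabs_le_between in H. auto. }
  exists l. intros eps N He.
  destruct (Hl (disc l (mkposreal eps He)) N) as [p [Hp Hd]].
  { exists (mkposreal eps He). intros x Hx; exact Hx. }
  exists p. split; auto.
Qed.

Lemma cluster_C (u : nat -> C) (M : R) : (forall n, Cmod (u n) <= M) ->
  exists l, forall eps N, 0 < eps -> exists n, (N <= n)%nat /\ Cmod (u n - l) < eps.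
Proof.
  intro H.
  destruct (cluster_R (fun n => Re (u n)) M) as [a Ha].
  { intro n. eapply Rle_trans; [apply re_le_Cmod | apply H]. }
  assert (E : forall n, exists m, (n <= m)%nat /\ Rabs (Re (u m) - a) < / (INR n + 1)).
  { intro n. apply Ha, inv_INR_pos. }
  apply (functional_choice) in E. destruct E as [s Hs].
  destruct (cluster_R (fun n => Im (u (s n))) M) as [b Hb].
  { intro n. eapply Rle_trans; [apply Im_le_Cmod | apply H]. }
  exists (a, b). intros eps N He.
  destruct (inv_INR_small (eps/2) ltac:(lra)) as [N1 HN1].
  destruct (Hb (eps/2) (max N N1) ltac:(lra)) as [n [Hn Hd]].
  destruct (Hs n) as [Hs1 Hs2].
  exists (s n). split. lia.
  eapply Rle_lt_trans. apply Cmod_le_ReIm.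
  specialize (HN1 n ltac:(lia)).
  change (Re (u (s n) - (a, b))%C) with (Re (u (s n)) - a).
  change (Im (u (s n) - (a, b))%C) with (Im (u (s n)) - b).
  lra.
Qed.

Definition cont_on (D : C -> Prop) (g : C -> C) : Prop :=
  forall z, D z -> forall eps, 0 < eps -> exists del, 0 < del /\
    forall w, D w -> Cmod (w - z) < del -> Cmod (g w - g z) < eps.

Definition contR_on (D : C -> Prop) (g : C -> R) : Prop :=
  forall z, D z -> forall eps, 0 < eps -> exists del, 0 < del /\
    forall w, D w -> Cmod (w - z) < del -> Rabs (g w - g z) < eps.

Definition closed_bounded (D : C -> Prop) : Prop :=
  boundedC D /\ forall z, closureC D z -> D z.

Lemma max_attained (D : C -> Prop) (g : C -> R) :
  closed_bounded D -> (exists z, D z) -> contR_on D g ->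
  exists z, D z /\ forall w, D w -> g w <= g z.
Proof.
  intros [[M HM] Hcl] [z0 Hz0] Hg.
  assert (clus : forall u : nat -> C, (forall n, D (u n)) -> exists l, D l /\
    forall eps N, 0 < eps -> exists n, (N <= n)%nat /\ Cmod (u n - l) < eps).
  { intros u Hu. destruct (cluster_C u M) as [l Hl]; [auto|].
    exists l. split; auto. apply Hcl. intros e He. destruct (Hl e 0%nat He) as [n [_ Hn]].
    exists (u n); auto. }
  assert (bd : exists B, forall w, D w -> g w <= B).
  { apply NNPP. intro Hn.
    assert (E : forall n : nat, exists w, D w /\ INR n < g w).
    { intro n. apply NNPP. intro H'. apply Hn. exists (INR n). intros w Hw.
      destruct (Rle_dec (g w) (INR n)); auto. elim H'. exists w; split; auto. lra. }
    apply functional_choice in E. destruct E as [u Hu].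
    destruct (clus u) as [l [Dl Hl]]. intro n; apply Hu.
    destruct (Hg l Dl 1 Rlt_0_1) as [d [Hd Hc]].
    destruct (INR_archimed 1 (g l + 1)) as [N HN]; [lra|].
    destruct (Hl d N Hd) as [n [Hn1 Hn2]].
    specialize (Hc (u n) (proj1 (Hu n)) Hn2). apply Rabs_def2 in Hc.
    apply le_INR in Hn1. generalize (proj2 (Hu n)). lra. }
  destruct (completeness (fun x => exists w, D w /\ g w = x)) as [S [HS1 HS2]].
  { destruct bd as [B HB]. exists B. intros x [w [Hw <-]]. auto. }
  { exists (g z0), z0. auto. }
  assert (E : forall n : nat, exists w, D w /\ S - / (INR n + 1) < g w).
  { intro n. apply NNPP. intro H'.
    assert (S <= S - / (INR n + 1)).
    { apply HS2. intros x [w [Hw <-]]. destruct (Rle_dec (g w) (S - / (INR n + 1))); auto.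
      elim H'. exists w; split; auto; lra. }
    generalize (inv_INR_pos n). lra. }
  apply functional_choice in E. destruct E as [u Hu].
  destruct (clus u) as [l [Dl Hl]]. intro n; apply Hu.
  exists l. split; auto. intros w Hw.
  apply Rle_trans with S. apply HS1. exists w; auto.
  apply le_epsilon. intros e He.
  destruct (Hg l Dl (e/2)) as [d [Hd Hc]]; [lra|].
  destruct (inv_INR_small (e/2)) as [N HN]; [lra|].
  destruct (Hl d N Hd) as [n [Hn1 Hn2]].
  specialize (Hc (u n) (proj1 (Hu n)) Hn2). apply Rabs_def2 in Hc.
  specialize (HN n Hn1). generalize (proj2 (Hu n)). lra.
Qed.

Lemma closed_disc_closed_bounded (y : C) (s : R) :
  closed_bounded (fun z => Cmod (z - y) <= s).
Proof.
  split.
  - exists (s + Cmod y). intros z Hz. generalize (Cmod_triangle (z - y)%C y).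
    replace (z - y + y)%C with z by ring. lra.
  - intros z Hz. apply le_epsilon. intros e He. destruct (Hz e He) as [w [H1 H2]].
    generalize (Cdist_tri w z y). rewrite (Cdist_sym z w). lra.
Qed.

(** A mean value inequality without derivatives: the radius [eta] may depend on [t], and the
    supremum of the parameters up to which the bound holds must be 1. *)
Lemma loc_lip_glob (h : R -> C) (L : R) :
  (forall t, 0 <= t <= 1 -> exists eta, 0 < eta /\
     forall u, 0 <= u <= 1 -> Rabs (u - t) < eta -> Cmod (h u - h t) <= L * Rabs (u - t)) ->
  Cmod (h 1 - h 0) <= L.
Proof.
  intro H.
  set (P := fun t => 0 <= t <= 1 /\ Cmod (h t - h 0) <= L * t).
  assert (P0 : P 0).
  { split. lra. rewrite Cdist_refl. lra. }
  destruct (completeness P) as [S [HS1 HS2]].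
  { exists 1. intros x [Hx _]. lra. }
  { exists 0; auto. }
  assert (S01 : 0 <= S <= 1).
  { split. apply HS1; auto. apply HS2. intros x [Hx _]; lra. }
  destruct (H S S01) as [eta [He Hl]].
  assert (PS : P S).
  { assert (exists t, P t /\ S - eta < t) as [t [[Ht1 Ht2] Ht3]].
    { apply NNPP. intro Hn. assert (S <= S - eta); [|lra]. apply HS2. intros x Hx.
      destruct (Rle_dec x (S - eta)); auto. elim Hn. exists x; split; auto; lra. }
    assert (t <= S) by (apply HS1; split; auto).
    split; auto. generalize (Hl t Ht1).
    assert (E : Rabs (t - S) = S - t) by (rewrite Rabs_left1; lra). rewrite E. intro Hl'.
    specialize (Hl' ltac:(lra)).
    generalize (Cdist_tri (h t) (h S) (h 0)). rewrite (Cdist_sym (h S) (h t)). lra. }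
  destruct (Req_dec S 1) as [E1|N1].
  - destruct PS as [_ PS]. rewrite E1, Rmult_1_r in PS. exact PS.
  - set (u := Rmin 1 (S + eta / 2)).
    assert (Hu : S < u <= 1 /\ u <= S + eta/2).
    { unfold u. split; [split|]. apply Rmin_glb_lt; lra. apply Rmin_l. apply Rmin_r. }
    assert (P u).
    { split. lra. specialize (Hl u ltac:(lra)).
      assert (E : Rabs (u - S) = u - S) by (apply Rabs_right; lra). rewrite E in Hl.
      specialize (Hl ltac:(lra)). destruct PS as [_ PS].
      generalize (Cdist_tri (h S) (h u) (h 0)). lra. }
    generalize (HS1 u H0). lra.
Qed.

Lemma loc_lip_glob_R (h : R -> R) (L : R) :
  (forall t, 0 <= t <= 1 -> exists eta, 0 < eta /\
     forall u, 0 <= u <= 1 -> Rabs (u - t) < eta -> Rabs (h u - h t) <= L * Rabs (u - t)) ->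
  Rabs (h 1 - h 0) <= L.
Proof.
  intro H. rewrite <- Cmod_R, RtoC_minus.
  apply (loc_lip_glob (fun t => RtoC (h t))). intros t Ht. destruct (H t Ht) as [eta [He Hl]].
  exists eta. split; auto. intros u Hu Hd. change (Cmod (RtoC (h u) - RtoC (h t)) <= L * Rabs (u - t)). rewrite <- RtoC_minus, Cmod_R. auto.
Qed.

(** The indicator of a locally constant property has local Lipschitz constant 0, so it takes equal
    values at 0 and 1. *)
Lemma interval_connected (P : R -> Prop) :
  (forall t, 0 <= t <= 1 -> exists eta, 0 < eta /\
     forall u, 0 <= u <= 1 -> Rabs (u - t) < eta -> (P u <-> P t)) ->
  P 0 -> P 1.
Proof.
  intros H H0.
  set (h := fun t => if excluded_middle_informative (P t) then 0 else 1).
  assert (X : Rabs (h 1 - h 0) <= 0).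
  { apply loc_lip_glob_R. intros t Ht. destruct (H t Ht) as [eta [He Y]]. exists eta. split; auto.
    intros u Hu Hut. specialize (Y u Hu Hut). unfold h.
    destruct (excluded_middle_informative (P u)), (excluded_middle_informative (P t)); try tauto;
      rewrite Rminus_diag, Rabs_R0; lra. }
  unfold h in X. destruct (excluded_middle_informative (P 1)), (excluded_middle_informative (P 0)); try tauto.
  rewrite Rabs_right in X; lra.
Qed.

Lemma pow3_pos n : 0 < 3 ^ n.
Proof. apply pow_lt; lra. Qed.

Lemma pow3_ge1 n : 1 <= 3 ^ n.
Proof. apply pow_R1_Rle; lra. Qed.

Lemma pow_unbounded q x B : 1 < q -> 0 < x -> exists N, forall n, (N <= n)%nat -> B <= q ^ n * x.
Proof.
  intros Hq Hx. destruct (Pow_x_infinity q ltac:(rewrite Rabs_right; lra) (B / x)) as [N HN].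
  exists N. intros n Hn. specialize (HN n Hn). rewrite Rabs_right in HN by (left; apply pow_lt; lra).
  apply Rge_le in HN. apply (Rmult_le_compat_r x) in HN; [|lra].
  unfold Rdiv in HN. rewrite Rmult_assoc, Rinv_l in HN by lra. lra.
Qed.

Lemma div_pow3_le x n : 0 <= x -> x / 3 ^ n <= x.
Proof.
  intro H. generalize (pow3_ge1 n). intro. apply Rle_div_l; [lra|]. nra.
Qed.

Lemma div_pow3_small r eps : 0 < r -> 0 < eps -> exists N, forall n, (N <= n)%nat -> 0 < r / 3 ^ n <= eps.
Proof.
  intros Hr He. destruct (pow_unbounded 3 eps r ltac:(lra) He) as [N HN].
  exists N. intros n Hn. specialize (HN n Hn). assert (P := pow3_pos n). split.
  - now apply Rdiv_lt_0_compat.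
  - apply Rle_div_l; lra.
Qed.

Lemma pow3_normalize r rho : 0 < rho <= r -> exists n, r <= 3 ^ n * rho < 3 * r.
Proof.
  intros [H0 H1]. destruct (pow_unbounded 3 rho r ltac:(lra) H0) as [N HN].
  destruct (least_nat (fun n => r <= 3 ^ n * rho) (ex_intro _ N (HN N (le_n N)))) as [n [Hn Hmin]].
  exists n. split; auto. destruct n as [|n]. simpl. lra.
  apply Rnot_le_lt. intro H. assert (S n <= n)%nat by (apply Hmin; simpl in H; lra). lia.
Qed.

Lemma exists_below r1 r2 : 0 < r1 -> 0 < r2 -> exists r, 0 < r /\ r < r1 /\ r < r2.
Proof.
  intros H1 H2. exists (Rmin r1 r2 / 2). unfold Rmin. destruct Rle_dec; lra.
Qed.

Ltac rmin := unfold Rmin; repeat destruct Rle_dec; lra.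

(** * Second derivative test along lines *)

(** Polynomials by closure rather than by coefficients, so that iterates of the cubic and
    derivatives are polynomials by construction. *)
Inductive Pol : (C -> C) -> Prop :=
| Pol_const c : Pol (fun _ => c)
| Pol_id : Pol (fun z => z)
| Pol_plus p q : Pol p -> Pol q -> Pol (fun z => (p z + q z)%C)
| Pol_mult p q : Pol p -> Pol q -> Pol (fun z => (p z * q z)%C).

(** Complex differentiability with a quadratic remainder whose constant depends on [z]; it passes
    through sums and products and yields continuity, local Lipschitz bounds and derivatives along
    lines. *)
Definition der (p p1 : C -> C) : Prop :=
  forall z, exists B, 0 <= B /\ forall h, Cmod h <= 1 ->
    Cmod (p (z + h)%C - p z - p1 z * h) <= B * Cmod h ^ 2.

Lemma der_const c : der (fun _ => c) (fun _ => RtoC 0).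
Proof.
  intro z. exists 0. split; [lra|]. intros h _.
  replace (c - c - RtoC 0 * h)%C with (RtoC 0) by ring. rewrite Cmod_0. lra.
Qed.

Lemma der_id : der (fun z => z) (fun _ => RtoC 1).
Proof.
  intro z. exists 0. split; [lra|]. intros h _.
  replace (z + h - z - RtoC 1 * h)%C with (RtoC 0) by ring. rewrite Cmod_0. lra.
Qed.

Lemma der_plus p p1 q q1 : der p p1 -> der q q1 ->
  der (fun z => (p z + q z)%C) (fun z => (p1 z + q1 z)%C).
Proof.
  intros H1 H2 z. destruct (H1 z) as [B [HB H]], (H2 z) as [B' [HB' H']].
  exists (B + B'). split; [lra|]. intros h Hh. specialize (H h Hh). specialize (H' h Hh).
  match goal with |- Cmod ?x <= _ => replace x with
    (p (z + h)%C - p z - p1 z * h + (q (z + h)%C - q z - q1 z * h))%C by ring end.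
  eapply Rle_trans; [apply Cmod_triangle|]. lra.
Qed.

Lemma Cmod_plus_le (a b : C) (x y : R) : Cmod a <= x -> Cmod b <= y -> Cmod (a + b) <= x + y.
Proof. intros. eapply Rle_trans; [apply Cmod_triangle|]. lra. Qed.

Lemma der_mult p p1 q q1 : der p p1 -> der q q1 ->
  der (fun z => (p z * q z)%C) (fun z => (p1 z * q z + p z * q1 z)%C).
Proof.
  intros H1 H2 z. destruct (H1 z) as [B [HB H]], (H2 z) as [B' [HB' H']].
  exists (Cmod (p1 z) * Cmod (q1 z) + Cmod (p1 z) * B' + B * Cmod (q1 z)
     + Cmod (p z) * B' + B * Cmod (q z) + B * B').
  generalize (Cmod_ge_0 (p z)) (Cmod_ge_0 (p1 z)) (Cmod_ge_0 (q z)) (Cmod_ge_0 (q1 z)).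
  intros Q1 Q2 Q3 Q4. split.
  { repeat apply Rplus_le_le_0_compat; apply Rmult_le_pos; assumption. }
  intros h Hh. specialize (H h Hh). specialize (H' h Hh).
  set (a := (p (z + h)%C - p z - p1 z * h)%C) in *.
  set (b := (q (z + h)%C - q z - q1 z * h)%C) in *.
  (* With [a] and [b] the remainders of the two factors, this is the expanded product minus its part
     of order at most one. Every term is at least quadratic in [h], and |h| <= 1 absorbs higher
     powers. *)
  match goal with |- Cmod ?x <= _ => replace x with
    (p1 z * q1 z * (h * h) + p1 z * h * b + a * q1 z * h + p z * b + a * q z + a * b)%C by (unfold a, b; ring) end.
  rewrite !Rmult_plus_distr_r.
  apply Cmod_plus_le; [apply Cmod_plus_le; [apply Cmod_plus_le; [apply Cmod_plus_le;
    [apply Cmod_plus_le|]|]|]|].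
  all: rewrite !Cmod_mult.
  all: generalize (Cmod_ge_0 h) (Cmod_ge_0 a) (Cmod_ge_0 b); intros G1 G2 G3.
  all: assert (G4 : 0 <= Cmod h ^ 2 <= 1) by (split; nra).
  - nra.
  - assert (Cmod (p1 z) * Cmod h <= Cmod (p1 z)) by nra.
    rewrite (Rmult_assoc (Cmod (p1 z)) B'). apply Rmult_le_compat; auto. apply Rmult_le_pos; auto.
  - replace (B * Cmod (q1 z) * Cmod h ^ 2) with (B * Cmod h ^ 2 * Cmod (q1 z) * 1) by ring.
    apply Rmult_le_compat; auto; [apply Rmult_le_pos; auto|]. apply Rmult_le_compat_r; auto.
  - rewrite Rmult_assoc. apply Rmult_le_compat_l; auto.
  - replace (B * Cmod (q z) * Cmod h ^ 2) with (B * Cmod h ^ 2 * Cmod (q z)) by ring.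
    apply Rmult_le_compat_r; auto.
  - apply Rle_trans with (B * Cmod h ^ 2 * (B' * Cmod h ^ 2)).
    apply Rmult_le_compat; auto.
    assert (0 <= B * B') by (apply Rmult_le_pos; auto). 
    assert (0 <= (B * B') * Cmod h ^ 2) by (apply Rmult_le_pos; lra). nra.
Qed.

Lemma Pol_der p : Pol p -> exists p1, Pol p1 /\ der p p1.
Proof.
  induction 1 as [c| |p q Hp [p1 [IHp1 IHp2]] Hq [q1 [IHq1 IHq2]]|p q Hp [p1 [IHp1 IHp2]] Hq [q1 [IHq1 IHq2]]].
  - eexists; split; [|apply der_const]. constructor.
  - eexists; split; [|apply der_id]. constructor.
  - eexists; split; [|apply der_plus; eassumption]. now constructor.
  - eexists; split; [|apply der_mult; eassumption]. now repeat constructor.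
Qed.

Lemma der_lip p p1 z : der p p1 -> exists L, 0 < L /\ forall w, Cmod (w - z) <= 1 ->
  Cmod (p w - p z) <= L * Cmod (w - z).
Proof.
  intro H. destruct (H z) as [B [HB Hd]].
  exists (B + Cmod (p1 z) + 1). generalize (Cmod_ge_0 (p1 z)). intro G. split; [lra|].
  intros w Hw. specialize (Hd _ Hw). replace (z + (w - z))%C with w in Hd by ring.
  set (h := (w - z)%C) in *.
  replace (p w - p z)%C with
    (p w - p z - p1 z * h + p1 z * h)%C by ring.
  eapply Rle_trans; [apply Cmod_triangle|]. rewrite Cmod_mult.
  generalize (Cmod_ge_0 h). intro. 
  assert (B * Cmod h ^ 2 <= B * Cmod h) by (apply Rmult_le_compat_l; auto; nra).
  lra.
Qed.

Lemma der_cont p p1 z : der p p1 -> forall eps, 0 < eps -> exists del, 0 < del /\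
  forall w, Cmod (w - z) < del -> Cmod (p w - p z) < eps.
Proof.
  intros H eps He. destruct (der_lip p p1 z H) as [L [HL Hl]].
  exists (Rmin 1 (eps / L)). split.
  { apply Rmin_pos; [lra|]. now apply Rdiv_lt_0_compat. }
  intros w Hw. eapply Rle_lt_trans. apply Hl.
  - left; eapply Rlt_min_l, Hw.
  - apply Rlt_le_trans with (L * (eps / L)).
    apply Rmult_lt_compat_l; auto. eapply Rlt_min_r, Hw.
    right. field. lra.
Qed.

Lemma Pol_cont p z : Pol p -> forall eps, 0 < eps -> exists del, 0 < del /\
  forall w, Cmod (w - z) < del -> Cmod (p w - p z) < eps.
Proof. intro H. destruct (Pol_der p H) as [p1 [_ Hd]]. eapply der_cont, Hd. Qed.

Lemma is_derive_quad (g : R -> R) (t l B d : R) : 0 < d -> 0 <= B ->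
  (forall u, Rabs (u - t) <= d -> Rabs (g u - g t - l * (u - t)) <= B * (u - t) ^ 2) ->
  is_derive g t l.
Proof.
  intros Hd HB H. apply is_derive_Reals. intros eps He.
  set (del := Rmin d (eps / (B + 1))).
  assert (Hp : 0 < del).
  { apply Rmin_pos; auto. apply Rdiv_lt_0_compat; lra. }
  exists (mkposreal del Hp). simpl. intros h Hh Hhd.
  assert (H12 : Rabs h <= d /\ Rabs h < eps / (B + 1)) by (revert Hhd; unfold del; rmin).
  destruct H12 as [H1 H2].
  specialize (H (t + h)). replace (t + h - t) with h in H by ring. specialize (H H1).
  replace ((g (t + h) - g t) / h - l) with ((g (t + h) - g t - l * h) / h) by (field; auto).
  unfold Rdiv. rewrite Rabs_mult, Rabs_inv.
  assert (P : 0 < Rabs h) by (apply Rabs_pos_lt; auto).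
  apply Rmult_lt_reg_r with (Rabs h); auto. rewrite Rmult_assoc, Rinv_l by lra. rewrite Rmult_1_r.
  eapply Rle_lt_trans; [apply H|]. rewrite <- (pow2_abs h).
  apply Rlt_div_r in H2; [|lra].
  simpl. rewrite Rmult_1_r, <- Rmult_assoc. apply Rmult_lt_compat_r; auto. lra.
Qed.

Definition line (z e : C) (t : R) : C := (z + RtoC t * e)%C.

Lemma der_line p p1 (z e : C) (t : R) : der p p1 -> Cmod e <= 1 ->
  is_derive (fun u => Re (p (line z e u))) t (Re (e * p1 (line z e t))%C) /\
  is_derive (fun u => Im (p (line z e u))) t (Im (e * p1 (line z e t))%C).
Proof.
  intros H He. destruct (H (line z e t)) as [B [HB Hd]].
  assert (K : forall u, Rabs (u - t) <= 1 ->
    Cmod (p (line z e u) - p (line z e t) - RtoC (u - t) * (e * p1 (line z e t))) <= B * (u - t) ^ 2).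
  { intros u Hu. specialize (Hd (RtoC (u - t) * e)%C).
    rewrite Cmod_mult, Cmod_R in Hd.
    generalize (Cmod_ge_0 e) (Rabs_pos (u - t)). intros G1 G2.
    replace (line z e t + RtoC (u - t) * e)%C with (line z e u) in Hd
      by (unfold line; rewrite RtoC_minus; ring).
    replace (p1 (line z e t) * (RtoC (u - t) * e))%C with
      (RtoC (u - t) * (e * p1 (line z e t)))%C in Hd by ring.
    eapply Rle_trans; [apply Hd; nra|]. apply Rmult_le_compat_l; auto.
    rewrite <- (pow2_abs (u - t)).
    assert (Rabs (u - t) * Cmod e <= Rabs (u - t)) by nra. 
    apply pow_incr. split; auto. apply Rmult_le_pos; auto. }
  split; apply (is_derive_quad _ t _ B 1); auto; try lra; intros u Hu; specialize (K u Hu).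
  - eapply Rle_trans; [|apply K]. eapply Rle_trans; [|apply re_le_Cmod].
    right. f_equal. destruct (p (line z e u)), (p (line z e t)), (e * p1 (line z e t))%C. simpl. ring.
  - eapply Rle_trans; [|apply K]. eapply Rle_trans; [|apply Im_le_Cmod].
    right. f_equal. destruct (p (line z e u)), (p (line z e t)), (e * p1 (line z e t))%C. simpl. ring.
Qed.

(** The first and second derivatives at 0 are [b] and [c]; the first derivative is required on a
    neighbourhood so that it can be differentiated again. *)
Definition D2 (g : R -> R) (b c : R) : Prop :=
  exists g1 : R -> R, locally 0 (fun t => is_derive g t (g1 t)) /\ g1 0 = b /\ is_derive g1 0 c.

Lemma D2_const a : D2 (fun _ => a) 0 0.
Proof.
  exists (fun _ => 0). split; [|split]; auto.
  - apply filter_forall. intro t. apply @is_derive_const.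
  - apply @is_derive_const.
Qed.

Lemma D2_plus g h b c b' c' : D2 g b c -> D2 h b' c' -> D2 (fun t => g t + h t) (b + b') (c + c').
Proof.
  intros [g1 [H1 [H2 H3]]] [h1 [K1 [K2 K3]]]. exists (fun t => g1 t + h1 t).
  split; [|split].
  - generalize (filter_and _ _ H1 K1). apply filter_imp. intros t [A B]. now apply @is_derive_plus.
  - now rewrite H2, K2.
  - now apply @is_derive_plus.
Qed.

Lemma D2_scal k g b c : D2 g b c -> D2 (fun t => k * g t) (k * b) (k * c).
Proof.
  intros [g1 [H1 [H2 H3]]]. exists (fun t => k * g1 t). split; [|split].
  - revert H1. apply filter_imp. intros t A. now apply is_derive_scal.
  - now rewrite H2.
  - now apply is_derive_scal.
Qed.

Lemma D2_mult g h b c b' c' : D2 g b c -> D2 h b' c' ->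
  D2 (fun t => g t * h t) (b * h 0 + g 0 * b') (c * h 0 + 2 * b * b' + g 0 * c').
Proof.
  intros [g1 [H1 [H2 H3]]] [h1 [K1 [K2 K3]]]. exists (fun t => g1 t * h t + g t * h1 t).
  assert (M : forall (u v : R -> R) t u' v', is_derive u t u' -> is_derive v t v' ->
    is_derive (fun t => u t * v t) t (u' * v t + u t * v')).
  { intros u v t u' v' Hu Hv. apply (is_derive_mult u v t u' v' Hu Hv). intros; apply Rmult_comm. }
  split; [|split].
  - generalize (filter_and _ _ H1 K1). apply filter_imp. intros t [A B]. now apply M.
  - now rewrite H2, K2.
  - apply locally_singleton in H1. apply locally_singleton in K1.
    replace (c * h 0 + 2 * b * b' + g 0 * c') with
      ((c * h 0 + g1 0 * h1 0) + (g1 0 * h1 0 + g 0 * c')) by (rewrite H2, K2; ring).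
    apply @is_derive_plus; now apply M.
Qed.

Lemma D2_ln g b c : D2 g b c -> 0 < g 0 ->
  D2 (fun t => ln (g t)) (b / g 0) (c / g 0 - (b / g 0) ^ 2).
Proof.
  intros [g1 [H1 [H2 H3]]] Hg. exists (fun t => g1 t / g t).
  assert (Hl : locally 0 (fun t => 0 < g t)).
  { apply locally_singleton in H1.
    assert (Hc : @continuous R_UniformSpace R_UniformSpace g 0).
    { apply (ex_derive_continuous g). exists (g1 0). exact H1. }
    refine (Hc (fun x => 0 < x) _). apply open_gt. exact Hg. }
  split; [|split].
  - generalize (filter_and _ _ H1 Hl). apply filter_imp. intros t [A B].
    replace (g1 t / g t) with (g1 t * / g t) by reflexivity.
    apply (is_derive_comp ln g t). now apply is_derive_ln. auto.
  - now rewrite H2.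
  - apply locally_singleton in H1.
    replace (c / g 0 - (b / g 0) ^ 2) with ((c * g 0 - g1 0 * g1 0) / (g 0) ^ 2)
      by (rewrite H2; field; lra).
    apply is_derive_div; auto. lra.
Qed.

(** The derivative vanishes at the maximum; if [c] were positive it would be positive just to the
    right of 0, and the mean value theorem would make [g] exceed its maximum. *)
Lemma D2_max g b c : D2 g b c -> locally 0 (fun t => g t <= g 0) -> c <= 0.
Proof.
  intros [g1 [H1 [H2 H3]]] Hm. apply Rnot_lt_le. intro Hc.
  assert (Z : g1 0 = 0).
  { destruct Hm as [d Hd].
    assert (D := locally_singleton _ _ H1). simpl in D.
    apply is_derive_Reals in D.
    assert (pr : derivable_pt g 0) by (exists (g1 0); exact D).
    assert (E := derive_pt_eq_0 _ _ _ pr D). rewrite <- E.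
    apply (deriv_maximum g (-d) d 0 pr); try (generalize (cond_pos d); lra).
    intros x Hx1 Hx2. apply Hd. unfold ball; simpl; unfold AbsRing_ball, abs, minus, plus, opp; simpl.
    rewrite Ropp_0, Rplus_0_r. apply Rabs_def1; lra. }
  apply is_derive_Reals in H3. destruct (H3 (c/2) ltac:(lra)) as [del Hdel].
  destruct H1 as [d1 Hd1], Hm as [d2 Hd2].
  set (x := Rmin (del / 2) (Rmin (d1/2) (d2/2))).
  assert (Px : 0 < x /\ x < del /\ x < d1 /\ x < d2).
  { generalize (cond_pos del) (cond_pos d1) (cond_pos d2). intros. unfold x. rmin. }
  assert (Ball : forall (d : posreal) y, 0 <= y < d -> ball 0 d y).
  { intros d y Hy. unfold ball; simpl; unfold AbsRing_ball, abs, minus, plus, opp; simpl.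
    rewrite Ropp_0, Rplus_0_r. apply Rabs_def1; lra. }
  destruct (MVT_cor2 g g1 0 x) as [y [E Y]]; [lra| |].
  { intros y Hy. apply is_derive_Reals. apply Hd1, Ball. lra. }
  assert (Le : g x <= g 0) by (apply Hd2, Ball; lra).
  specialize (Hdel y ltac:(lra)). rewrite Rabs_right in Hdel by lra. specialize (Hdel ltac:(lra)).
  rewrite Rplus_0_l, Z, Rminus_0_r in Hdel. apply Rabs_def2 in Hdel.
  assert (0 < g1 y) by (replace (g1 y) with (g1 y / y * y) by (field; lra); apply Rmult_lt_0_compat; lra).
  nra.
Qed.

(** [l] is the Laplacian of [E] at [z]. The gradient [(gx, gy)] is carried along because the
    Laplacian of a logarithm involves it. *)
Definition lap (E : C -> R) (z : C) (gx gy l : R) : Prop :=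
  exists cx cy, D2 (fun t => E (line z (RtoC 1) t)) gx cx /\ D2 (fun t => E (line z Ci t)) gy cy /\ cx + cy = l.

Lemma line0 z e : line z e 0 = z.
Proof. unfold line. ring. Qed.

Lemma lap_const a z : lap (fun _ => a) z 0 0 0.
Proof. exists 0, 0. split; [|split]; try apply D2_const. ring. Qed.

Lemma lap_plus E F z gx gy l gx' gy' l' : lap E z gx gy l -> lap F z gx' gy' l' ->
  lap (fun w => E w + F w) z (gx + gx') (gy + gy') (l + l').
Proof.
  intros [cx [cy [H1 [H2 H3]]]] [cx' [cy' [K1 [K2 K3]]]]. exists (cx + cx'), (cy + cy').
  split; [|split]; [now apply D2_plus..|]. lra.
Qed.

Lemma lap_scal k E z gx gy l : lap E z gx gy l -> lap (fun w => k * E w) z (k * gx) (k * gy) (k * l).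
Proof.
  intros [cx [cy [H1 [H2 H3]]]]. exists (k * cx), (k * cy).
  split; [|split]; [now apply D2_scal..|]. rewrite <- H3; ring.
Qed.

Lemma lap_ln E z gx gy l : lap E z gx gy l -> 0 < E z ->
  lap (fun w => ln (E w)) z (gx / E z) (gy / E z) (l / E z - (gx ^ 2 + gy ^ 2) / (E z) ^ 2).
Proof.
  intros [cx [cy [H1 [H2 H3]]]] HE.
  exists (cx / E z - (gx / E z) ^ 2), (cy / E z - (gy / E z) ^ 2).
  split; [|split].
  - apply D2_ln in H1; rewrite ?line0 in *; auto.
  - apply D2_ln in H2; rewrite ?line0 in *; auto.
  - rewrite <- H3. field. lra.
Qed.

Lemma lap_max E z gx gy l : lap E z gx gy l ->
  (exists eta, 0 < eta /\ forall w, Cmod (w - z) < eta -> E w <= E z) -> l <= 0.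
Proof.
  intros [cx [cy [H1 [H2 H3]]]] [eta [He Hm]].
  assert (K : forall e, Cmod e = 1 -> locally 0 (fun t => E (line z e t) <= E (line z e 0))).
  { intros e He1. exists (mkposreal eta He). intros t Ht. rewrite line0. apply Hm.
    replace (line z e t - z)%C with (RtoC t * e)%C by (unfold line; ring).
    rewrite Cmod_mult, He1, Cmod_R, Rmult_1_r.
    unfold ball in Ht; simpl in Ht; unfold AbsRing_ball, abs, minus, plus, opp in Ht; simpl in Ht.
    rewrite Ropp_0, Rplus_0_r in Ht. exact Ht. }
  apply D2_max in H1; [|apply (K (RtoC 1)); apply Cmod_1].
  apply D2_max in H2; [|apply (K Ci); apply Cmod_Ci]. lra.
Qed.

Lemma D2_line k k1 k2 z e : der k k1 -> der k1 k2 -> Cmod e <= 1 ->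
  D2 (fun t => Re (k (line z e t))) (Re (e * k1 z)%C) (Re (e * (e * k2 z))%C) /\
  D2 (fun t => Im (k (line z e t))) (Im (e * k1 z)%C) (Im (e * (e * k2 z))%C).
Proof.
  intros H1 H2 He.
  assert (H3 : der (fun w => (e * k1 w)%C) (fun w => (e * k2 w)%C)).
  { intro w. destruct (der_mult _ _ _ _ (der_const e) H2 w) as [B [HB Hd]]. exists B. split; auto.
    intros h Hh. specialize (Hd h Hh). eapply Rle_trans; [|apply Hd]. right. f_equal. ring. }
  split.
  - exists (fun t => Re (e * k1 (line z e t))%C). split; [|split].
    + apply filter_forall. intro t. apply (der_line k k1 z e t H1 He).
    + now rewrite line0.
    + generalize (proj1 (der_line _ _ z e 0 H3 He)). now rewrite !line0.
  - exists (fun t => Im (e * k1 (line z e t))%C). split; [|split].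
    + apply filter_forall. intro t. apply (der_line k k1 z e t H1 He).
    + now rewrite line0.
    + generalize (proj2 (der_line _ _ z e 0 H3 He)). now rewrite !line0.
Qed.

Lemma lap_norm2 k k1 k2 z : der k k1 -> der k1 k2 -> exists gx gy,
  lap (fun w => Cmod (k w) ^ 2) z gx gy (4 * Cmod (k1 z) ^ 2) /\
  gx ^ 2 + gy ^ 2 = 4 * Cmod (k z) ^ 2 * Cmod (k1 z) ^ 2.
Proof.
  intros H1 H2.
  assert (K : forall e, Cmod e <= 1 -> D2 (fun t => Cmod (k (line z e t)) ^ 2)
    (2 * (Re (k z) * Re (e * k1 z)%C + Im (k z) * Im (e * k1 z)%C))
    (2 * (Re (e * k1 z)%C ^ 2 + Im (e * k1 z)%C ^ 2
       + Re (k z) * Re (e * (e * k2 z))%C + Im (k z) * Im (e * (e * k2 z))%C))).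
  { intros e He. destruct (D2_line k k1 k2 z e H1 H2 He) as [A B].
    assert (T := D2_plus _ _ _ _ _ _ (D2_mult _ _ _ _ _ _ A A) (D2_mult _ _ _ _ _ _ B B)).
    cbv beta in T. rewrite !line0 in T.
    destruct T as [g1 [T1 [T2 T3]]]. exists g1. split; [|split].
    - revert T1. apply filter_imp. intros t. apply is_derive_ext.
      intro u. generalize (k (line z e u)). intro v. rewrite Cmod2_alt. simpl. change (@eq R (Re v * Re v + Im v * Im v) (Re v * (Re v * 1) + Im v * (Im v * 1))). ring.
    - rewrite T2. ring.
    - match type of T3 with is_derive _ _ ?x => match goal with |- is_derive _ _ ?y =>
        replace y with x by ring end end. exact T3. }
  generalize (K (RtoC 1) ltac:(rewrite Cmod_1; lra)) (K Ci ltac:(rewrite Cmod_Ci; lra)).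
  intros KX KY. do 2 eexists. split.
  - do 2 eexists. split; [exact KX|split; [exact KY|]].
    rewrite Cmod2_alt. destruct (k z), (k1 z), (k2 z). simpl. ring.
  - rewrite !Cmod2_alt. destruct (k z), (k1 z), (k2 z). simpl. ring.
Qed.

(** Harmonicity of ln |k|^2 away from the zeros of [k]: by the gradient identity of [lap_norm2] the
    two terms of [lap_ln] cancel. *)
Lemma lap_ln_norm2 k k1 k2 z : der k k1 -> der k1 k2 -> k z <> RtoC 0 -> exists gx gy,
  lap (fun w => ln (Cmod (k w) ^ 2)) z gx gy 0 /\
  gx ^ 2 + gy ^ 2 = 4 * Cmod (k1 z) ^ 2 / Cmod (k z) ^ 2.
Proof.
  intros H1 H2 H3. destruct (lap_norm2 k k1 k2 z H1 H2) as [gx [gy [L G]]].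
  apply Cmod_gt_0 in H3. assert (P : 0 < Cmod (k z) ^ 2) by (apply pow_lt; auto).
  apply lap_ln in L; auto. do 2 eexists. split.
  - rewrite G in L. match type of L with lap _ _ _ _ ?x => replace x with 0 in L by (field; lra) end.
    exact L.
  - unfold Rdiv. rewrite !Rpow_mult_distr, <- Rmult_plus_distr_r, G. field. lra.
Qed.

(** Up to sign the value is the square of 2 s |k1| / (s^2 - |k|^2), the pullback by [k] of the
    density of the disc of radius [s]. Since ln |k1| is harmonic where [k1] does not vanish, this is
    the equation of curvature -1. *)
Lemma lap_ln_disc k k1 k2 z (s : R) : der k k1 -> der k1 k2 -> Cmod (k z) < s -> exists gx gy,
  lap (fun w => ln (s ^ 2 - Cmod (k w) ^ 2)) z gx gy
    (- 4 * s ^ 2 * Cmod (k1 z) ^ 2 / (s ^ 2 - Cmod (k z) ^ 2) ^ 2).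
Proof.
  intros H1 H2 H3. destruct (lap_norm2 k k1 k2 z H1 H2) as [gx [gy [L G]]].
  assert (P : 0 < s ^ 2 - Cmod (k z) ^ 2) by (generalize (Cmod_ge_0 (k z)); nra).
  assert (L' := lap_plus _ _ _ _ _ _ _ _ _ (lap_const (s ^ 2) z) (lap_scal (-1) _ _ _ _ _ L)).
  cbv beta in L'.
  assert (P' : 0 < s ^ 2 + -1 * Cmod (k z) ^ 2) by lra.
  assert (L2 := lap_ln _ _ _ _ _ L' P'). cbv beta in L2.
  match type of L2 with lap _ _ ?x ?y _ => exists x, y end.
  match type of L2 with lap _ _ _ _ ?x => match goal with |- lap _ _ _ _ ?y =>
    replace y with x end end.
  - assert (Q : forall x : R, ln (s ^ 2 + -1 * x) = ln (s ^ 2 - x)) by (intro; f_equal; ring).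
    destruct L2 as [cx [cy [A [B D]]]]. exists cx, cy. split; [|split]; auto.
    + destruct A as [g1 [A1 A2]]. exists g1. split; auto. revert A1. apply filter_imp. intros t.
      apply is_derive_ext. intro u. apply Q.
    + destruct B as [g1 [A1 A2]]. exists g1. split; auto. revert A1. apply filter_imp. intros t.
      apply is_derive_ext. intro u. apply Q.
  - replace ((0 + -1 * gx) ^ 2 + (0 + -1 * gy) ^ 2) with (gx ^ 2 + gy ^ 2) by ring.
    rewrite G. field. lra.
Qed.

(** * Comparison of metrics *)

Lemma contR_on_plus D g h : contR_on D g -> contR_on D h -> contR_on D (fun z => g z + h z).
Proof.
  intros H1 H2 z Dz eps He.
  destruct (H1 z Dz (eps/2) ltac:(lra)) as [d1 [P1 K1]], (H2 z Dz (eps/2) ltac:(lra)) as [d2 [P2 K2]].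
  exists (Rmin d1 d2). split. now apply Rmin_pos. intros w Dw Hw.
  specialize (K1 w Dw (Rlt_min_l _ _ _ Hw)).
  specialize (K2 w Dw (Rlt_min_r _ _ _ Hw)).
  apply Rabs_def2 in K1. apply Rabs_def2 in K2. apply Rabs_def1; lra.
Qed.

Lemma contR_on_comp D g (h : R -> R) : contR_on D g ->
  (forall z, D z -> continuity_pt h (g z)) -> contR_on D (fun z => h (g z)).
Proof.
  intros H1 H2 z Dz eps He.
  destruct (H2 z Dz eps He) as [a [Ha K]].
  destruct (H1 z Dz a Ha) as [d [P1 K1]].
  exists d. split; auto. intros w Dw Hw. specialize (K1 w Dw Hw).
  destruct (Req_dec (g w) (g z)) as [->|N].
  - rewrite Rminus_diag, Rabs_R0. auto.
  - apply (K (g w)). split; [split; auto; exact I|exact K1].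
Qed.

(** Polarization writes the product as half of (g + h)^2 - g^2 - h^2, and squares are compositions
    with a continuous real function. *)
Lemma contR_on_mult D g h : contR_on D g -> contR_on D h -> contR_on D (fun z => g z * h z).
Proof.
  intros H1 H2.
  assert (S : forall k, contR_on D k -> contR_on D (fun z => (k z) ^ 2)).
  { intros k Hk. apply (contR_on_comp D k (fun x => x ^ 2)); auto.
    intros z _. apply derivable_continuous_pt, derivable_pt_pow. }
  assert (O : forall c k, contR_on D k -> contR_on D (fun z => c * k z)).
  { intros c k Hk. apply (contR_on_comp D k (fun x => c * x)); auto.
    intros z _. apply derivable_continuous_pt. reg. }
  assert (T : contR_on D (fun z => / 2 * (g z + h z) ^ 2 + (- / 2 * (g z) ^ 2 + - / 2 * (h z) ^ 2))).
  { apply contR_on_plus; [|apply contR_on_plus]; apply O, S; auto. now apply contR_on_plus. }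
  intros z Dz eps He. destruct (T z Dz eps He) as [d [P K]]. exists d; split; auto.
  intros w Dw Hw. specialize (K w Dw Hw).
  match type of K with Rabs ?x < _ => match goal with |- Rabs ?y < _ => replace y with x by field end end.
  exact K.
Qed.

Lemma contR_on_Cmod D (g : C -> C) : cont_on D g -> contR_on D (fun z => Cmod (g z)).
Proof.
  intros H z Dz eps He. destruct (H z Dz eps He) as [d [P K]]. exists d; split; auto.
  intros w Dw Hw. eapply Rle_lt_trans; [apply Cmod_diff_le|auto].
Qed.

Lemma cont_on_der D (p p1 g : C -> C) : der p p1 -> cont_on D g -> cont_on D (fun z => p (g z)).
Proof.
  intros Hp H z Dz eps He. destruct (der_cont p p1 (g z) Hp eps He) as [e [He' K]].
  destruct (H z Dz e He') as [d [P K']]. exists d; split; auto.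
Qed.

Lemma cont_on_id D : cont_on D (fun z => z).
Proof. intros z Dz eps He. exists eps. split; auto. Qed.

Lemma contR_on_const D c : contR_on D (fun _ => c).
Proof. intros z Dz eps He. exists 1. split; [lra|]. intros. rewrite Rminus_diag, Rabs_R0; auto. Qed.

Lemma der_shift k : der (fun z => (z - k)%C) (fun _ => RtoC 1).
Proof.
  intro z. exists 0. split; [lra|]. intros h _.
  match goal with |- Cmod ?x <= _ => replace x with (RtoC 0) by ring end. rewrite Cmod_0. lra.
Qed.

Lemma der_sub p p1 k : der p p1 -> der (fun z => (p z - k)%C) p1.
Proof.
  intros H z. destruct (H z) as [B [HB K]]. exists B; split; auto. intros h Hh.
  specialize (K h Hh). eapply Rle_trans; [|apply K]. right; f_equal. ring.
Qed.

Lemma contR_on_sub_sq D c g : contR_on D g -> contR_on D (fun z => c ^ 2 + -1 * g z ^ 2).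
Proof.
  intro Hg. apply contR_on_plus; [apply contR_on_const|]. apply contR_on_mult; [apply contR_on_const|].
  apply (contR_on_comp _ g (fun x => x ^ 2)); auto.
  intros z _. apply derivable_continuous_pt, derivable_pt_pow.
Qed.

Lemma contR_on_Cmod_der D p p1 g : der p p1 -> cont_on D g -> contR_on D (fun z => Cmod (p (g z))).
Proof. intros Hp Hg. apply contR_on_Cmod. now apply (cont_on_der D p p1). Qed.

Lemma ln_sqr x : 0 < x -> ln (x ^ 2) = 2 * ln x.
Proof. intro Hx. simpl. rewrite Rmult_1_r, ln_mult by auto. ring. Qed.

Lemma continuity_pt_ln x : 0 < x -> continuity_pt ln x.
Proof. intro H. apply derivable_continuous_pt. exists (/ x). now apply derivable_pt_lim_ln. Qed.

Lemma continuity_pt_inv x : x <> 0 -> continuity_pt Rinv x.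
Proof.
  intro H. apply continuity_pt_filterlim. apply (continuous_Rinv x H).
Qed.

(* Ahlfors' lemma for the inverse branch [F] of [q] and the punctured disc around [kappa]: at an
   interior maximum of [P], the second derivative test applied to [ln P^2] compares the two
   metrics of curvature -1. *)
Lemma inverse_branch_metric_bound (q q1 q2 q3 F : C -> C) (y kappa : C) (s M : R) :
  der q q1 -> der q1 q2 -> der q2 q3 -> 0 < s ->
  (forall z, Cmod (z - y) <= s ->
     q (F z) = z /\ q1 (F z) <> RtoC 0 /\ F z <> kappa /\ Cmod (F z - kappa) < M) ->
  cont_on (fun z => Cmod (z - y) <= s) F ->
  (forall z, Cmod (z - y) < s -> exists eta, 0 < eta /\
     forall w, Cmod (w - F z) < eta -> Cmod (q w - y) < s /\ F (q w) = w) ->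
  forall z, Cmod (z - y) <= s ->
    s ^ 2 - Cmod (z - y) ^ 2 <=
      2 * s * (Cmod (q1 (F z)) * Cmod (F z - kappa) * (ln M - ln (Cmod (F z - kappa)))).
Proof.
  intros Dq Dq1 Dq2 Hs HF Fc Fi.
  set (Disc := fun z => Cmod (z - y) <= s) in *.
  (* [1 / Den z] is the density of the punctured disc pulled back by [F], and the disc of radius [s]
     has density 2 s / (s^2 - |z - y|^2). Their quotient is [P / (2 * s)], so the goal is
     [P <= 2 * s]. *)
  set (Den := fun z => Cmod (q1 (F z)) * Cmod (F z - kappa) * (ln M - ln (Cmod (F z - kappa)))).
  set (P := fun z => (s ^ 2 + -1 * Cmod (z - y) ^ 2) * / Den z).
  assert (pos1 : forall z, Disc z -> 0 < Cmod (q1 (F z)) /\ 0 < Cmod (F z - kappa) /\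
     0 < ln M - ln (Cmod (F z - kappa))).
  { intros z Dz. destruct (HF z Dz) as [_ [A [B E]]].
    apply Cmod_gt_0 in A. apply Cdist_pos in B. repeat split; auto.
    generalize (ln_increasing _ _ B E). lra. }
  assert (Dpos : forall z, Disc z -> 0 < Den z).
  { intros z Dz. destruct (pos1 z Dz) as [A [B E]]. repeat apply Rmult_lt_0_compat; auto. }
  assert (cK : contR_on Disc (fun z => Cmod (F z - kappa))).
  { apply (contR_on_Cmod_der _ (fun z => (z - kappa)%C) _ F (der_shift kappa) Fc). }
  assert (cP : contR_on Disc P).
  { apply contR_on_mult.
    - apply (contR_on_sub_sq _ s (fun z => Cmod (z - y))).
      apply (contR_on_Cmod_der _ (fun z => (z - y)%C) _ _ (der_shift y)), cont_on_id.
    - apply (contR_on_comp _ Den Rinv).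
      + apply contR_on_mult. apply contR_on_mult; auto.
        apply (contR_on_Cmod_der _ q1 q2 F); auto.
        apply contR_on_plus; [apply contR_on_const|].
        apply (contR_on_comp _ (fun z => Cmod (F z - kappa)) (fun x => - ln x)); auto.
        intros z Dz. apply continuity_pt_opp. apply continuity_pt_ln. apply pos1; auto.
      + intros z Dz. apply continuity_pt_inv. apply Rgt_not_eq. apply Dpos; auto. }
  assert (Dy : Disc y) by (unfold Disc; rewrite Cdist_refl; lra).
  destruct (max_attained Disc P) as [w1 [Dw1 Hmax]]; auto.
  { apply closed_disc_closed_bounded. }
  { exists y; auto. }
  assert (Py : 0 < P y).
  { unfold P. rewrite Cdist_refl. apply Rmult_lt_0_compat. nra. apply Rinv_0_lt_compat; auto. }
  (* The maximum is interior because [P] is positive at the centre and vanishes on the boundary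
     circle. *)
  assert (Hw1 : Cmod (w1 - y) < s).
  { assert (0 < P w1) by (generalize (Hmax y Dy); lra). unfold P in H.
    assert (0 < s ^ 2 + -1 * Cmod (w1 - y) ^ 2).
    { replace (s ^ 2 + -1 * Cmod (w1 - y) ^ 2) with
       ((s ^ 2 + -1 * Cmod (w1 - y) ^ 2) * / Den w1 * Den w1) by (field; apply Rgt_not_eq, Dpos; auto).
      apply Rmult_lt_0_compat; auto. }
    generalize (Cmod_ge_0 (w1 - y)%C). intro. nra. }
  destruct (pos1 w1 Dw1) as [A1 [A2 A3]].
  destruct (HF w1 Dw1) as [Q1 [Q2 [Q3 Q4]]].
  set (z1 := F w1) in *.
  set (a := Cmod (q1 z1)) in *. set (b := Cmod (z1 - kappa)) in *. set (L := ln M - ln b) in *.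
  assert (LE : forall z, z <> kappa -> ln M + - / 2 * ln (Cmod (z - kappa) ^ 2) = ln M - ln (Cmod (z - kappa))).
  { intros z Hz. apply Cdist_pos in Hz. simpl. rewrite Rmult_1_r, ln_mult by auto. field. }
  (* [E] is 2 ln [P] carried to the image side, where [q] takes the place of the inverse of [F]:
     only derivatives of polynomials enter. As [F] is locally inverse to [q], the maximum of [P] at
     [w1] becomes a local maximum of [E] at [z1]. *)
  set (E := fun z => 2 * ln (s ^ 2 - Cmod (q z - y) ^ 2) +
     (-1 * ln (Cmod (q1 z) ^ 2) + (-1 * ln (Cmod (z - kappa) ^ 2) +
       -2 * ln (ln M + - / 2 * ln (Cmod (z - kappa) ^ 2))))).
  assert (EP : forall w, Cmod (w - y) < s -> E (F w) = 2 * ln (P w)).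
  { intros w Hw. assert (Dw : Disc w) by (unfold Disc; lra).
    destruct (pos1 w Dw) as [B1 [B2 B3]]. destruct (HF w Dw) as [R1 [R2 [R3 R4]]].
    assert (0 < s ^ 2 + - 1 * Cmod (w - y) ^ 2) by (generalize (Cmod_ge_0 (w - y)%C); intro; nra).
    unfold E, P. rewrite LE by auto. rewrite R1, !ln_sqr by auto.
    rewrite ln_mult, ln_Rinv; auto.
    2: apply Rinv_0_lt_compat; auto.
    unfold Den. rewrite !ln_mult; auto. 2: apply Rmult_lt_0_compat; auto.
    replace (s ^ 2 - Cmod (w - y) ^ 2) with (s ^ 2 + -1 * Cmod (w - y) ^ 2) by ring.
    ring. }
  assert (Emax : exists eta, 0 < eta /\ forall w, Cmod (w - z1) < eta -> E w <= E z1).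
  { destruct (Fi w1 Hw1) as [eta [He Hl]]. exists eta; split; auto. intros w Hw.
    destruct (Hl w Hw) as [G1 G2]. rewrite <- G2. unfold z1. rewrite !EP by auto.
    assert (Pp : 0 < P (q w)).
    { unfold P. apply Rmult_lt_0_compat. generalize (Cmod_ge_0 (q w - y)%C); intro; nra.
      apply Rinv_0_lt_compat, Dpos. unfold Disc; lra. }
    apply Rmult_le_compat_l; [lra|].
    destruct (Hmax (q w)) as [lt|eq]; [unfold Disc; lra| |].
    left; apply ln_increasing; auto. rewrite eq; right; auto. }
  assert (bound : 0 < s ^ 2 - Cmod (w1 - y) ^ 2 -> s ^ 2 - Cmod (w1 - y) ^ 2 <= 2 * s * (a * b * L)).
  { intro HN.
    destruct (lap_ln_disc (fun z => (q z - y)%C) q1 q2 z1 s (der_sub _ _ _ Dq) Dq1) as [x1 [x2 X]].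
    { now rewrite Q1. }
    destruct (lap_ln_norm2 q1 q2 q3 z1 Dq1 Dq2 Q2) as [u1 [u2 [U _]]].
    destruct (lap_ln_norm2 _ _ _ z1 (der_shift kappa) (der_const (RtoC 1))) as [v1 [v2 [V GV]]].
    { intro H. apply Q3. now apply Cminus_eq0. }
    assert (T := lap_plus _ _ _ _ _ _ _ _ _ (lap_const (ln M) z1) (lap_scal (- / 2) _ _ _ _ _ V)).
    cbv beta in T. apply lap_ln in T; [|rewrite LE by auto; exact A3].
    cbv beta in T.
    assert (Sm := lap_plus _ _ _ _ _ _ _ _ _ (lap_scal 2 _ _ _ _ _ X)
       (lap_plus _ _ _ _ _ _ _ _ _ (lap_scal (-1) _ _ _ _ _ U)
         (lap_plus _ _ _ _ _ _ _ _ _ (lap_scal (-1) _ _ _ _ _ V) (lap_scal (-2) _ _ _ _ _ T)))).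
    apply lap_max in Sm; [|exact Emax].
    rewrite LE in Sm by auto.
    replace ((0 + - / 2 * v1) ^ 2 + (0 + - / 2 * v2) ^ 2) with ((v1 ^ 2 + v2 ^ 2) / 4) in Sm by field.
    rewrite GV, Q1, Cmod_1 in Sm. fold a b L in Sm.
    set (N := s ^ 2 - Cmod (w1 - y) ^ 2) in *.
    (* The harmonic terms ln |q1|^2 and ln |z - kappa|^2 contribute nothing; what remains of the
       Laplacian is twice the difference of the two squared densities at [z1]. *)
    assert (Sm' : / (b * L) ^ 2 <= (2 * s * a / N) ^ 2).
    { match type of Sm with ?x <= 0 => replace x with (2 * (/ (b * L) ^ 2 - (2 * s * a / N) ^ 2)) in Sm by (field; lra) end.
      lra. }
    assert (PbL : 0 < b * L) by (apply Rmult_lt_0_compat; auto).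
    assert (Psa : 0 < 2 * s * a / N).
    { apply Rdiv_lt_0_compat; auto. apply Rmult_lt_0_compat; auto. lra. }
    rewrite <- pow_inv in Sm'.
    assert (Sm2 : / (b * L) <= 2 * s * a / N).
    { apply Rnot_lt_le. intro Hlt. assert (0 < / (b * L)) by (now apply Rinv_0_lt_compat). nra. }
    apply Rmult_le_reg_r with (/ (b * L) * / N * N).
    { rewrite Rmult_assoc, Rinv_l, Rmult_1_r by lra. now apply Rinv_0_lt_compat. }
    apply (Rmult_le_compat_l N) in Sm2; [|lra].
    match goal with |- ?l <= ?r => replace l with (N * / (b * L)) by (field; lra); 
      replace r with (N * (2 * s * a / N)) by (field; lra) end. exact Sm2. }
  intros z Dz.
  assert (PW : P w1 <= 2 * s).
  { unfold P. apply Rmult_le_reg_r with (Den w1); [auto|].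
    rewrite Rmult_assoc, Rinv_l, Rmult_1_r by (apply Rgt_not_eq, Dpos; auto).
    replace (s ^ 2 + -1 * Cmod (w1 - y) ^ 2) with (s ^ 2 - Cmod (w1 - y) ^ 2) by ring.
    apply bound. generalize (Cmod_ge_0 (w1 - y)%C); intro; nra. }
  assert (H := Hmax z Dz).
  assert (H' : P z <= 2 * s) by lra. unfold P in H'.
  apply (Rmult_le_compat_r (Den z)) in H'; [|left; auto].
  rewrite Rmult_assoc, Rinv_l, Rmult_1_r in H' by (apply Rgt_not_eq, Dpos; auto).
  unfold Den in H'. lra.
Qed.

Lemma ln_le_sub1 x : 0 < x -> ln x <= x - 1.
Proof.
  intro H. generalize (exp_ineq1_le (ln x)). rewrite exp_ln by auto. lra.
Qed.

Lemma ln_diff_le x x' : 0 < x -> Rabs (x' - x) <= x / 2 -> Rabs (ln x' - ln x) <= 2 * Rabs (x' - x) / x.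
Proof.
  intros Hx Hd. assert (Hx' : x / 2 <= x') by (apply Rabs_le_between in Hd; lra).
  assert (P : 0 < x') by lra.
  apply Rabs_le. split.
  - assert (H := ln_le_sub1 (x / x') (Rdiv_lt_0_compat _ _ Hx P)).
    rewrite ln_div in H by auto.
    assert (x / x' - 1 <= 2 * Rabs (x' - x) / x); [|lra].
    replace (x / x' - 1) with ((x - x') / x') by (field; lra).
    apply Rle_trans with (Rabs (x' - x) / x').
    + apply Rmult_le_compat_r. left; now apply Rinv_0_lt_compat. rewrite Rabs_minus_sym. apply Rle_abs.
    + unfold Rdiv. rewrite (Rmult_comm 2), Rmult_assoc. apply Rmult_le_compat_l. apply Rabs_pos.
      replace (2 * / x) with (/ (x / 2)) by (field; lra). apply Rinv_le_contravar; lra.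
  - assert (H := ln_le_sub1 (x' / x) (Rdiv_lt_0_compat _ _ P Hx)).
    rewrite ln_div in H by auto.
    assert (x' / x - 1 <= 2 * Rabs (x' - x) / x); [|lra].
    replace (x' / x - 1) with ((x' - x) / x) by (field; lra).
    apply Rmult_le_compat_r. left; now apply Rinv_0_lt_compat.
    generalize (Rle_abs (x' - x)) (Rabs_pos (x' - x)). lra.
Qed.

(** The metric bound is integrated along the segment from [y] to [z]: the logarithm of ln M - ln |F
    - kappa| changes at a rate controlled by the punctured disc density. On the half disc
    [Q * a * l] is at least 3 s / 8, and the local estimates below give the rate 4 s / (3 s / 8) =
    32/3, which 11 bounds. *)
Lemma inverse_branch_harnack (q q1 q2 q3 F : C -> C) (y kappa : C) (s M : R) :
  der q q1 -> der q1 q2 -> der q2 q3 -> 0 < s ->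
  (forall z, Cmod (z - y) <= s ->
     q (F z) = z /\ q1 (F z) <> RtoC 0 /\ F z <> kappa /\ Cmod (F z - kappa) < M) ->
  cont_on (fun z => Cmod (z - y) <= s) F ->
  (forall z, Cmod (z - y) < s -> exists eta, 0 < eta /\
     forall w, Cmod (w - F z) < eta -> Cmod (q w - y) < s /\ F (q w) = w) ->
  forall z, Cmod (z - y) <= s / 2 ->
    exp (-11) * (ln M - ln (Cmod (F y - kappa))) <= ln M - ln (Cmod (F z - kappa)).
Proof.
  intros Dq Dq1 Dq2 Hs HF Fc Fi z Hz.
  assert (MB := inverse_branch_metric_bound q q1 q2 q3 F y kappa s M Dq Dq1 Dq2 Hs HF Fc Fi).
  set (e := (z - y)%C) in *.
  set (L := fun w => ln M - ln (Cmod (F w - kappa))).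
  assert (Lpos : forall w, Cmod (w - y) <= s -> 0 < L w).
  { intros w Hw. destruct (HF w Hw) as [_ [_ [A B]]]. apply Cdist_pos in A.
    generalize (ln_increasing _ _ A B). unfold L. lra. }
  assert (Hin : forall t, 0 <= t <= 1 -> Cmod (line y e t - y) <= s / 2).
  { intros t Ht. replace (line y e t - y)%C with (RtoC t * e)%C by (unfold line; ring).
    rewrite Cmod_mult, Cmod_R, Rabs_right by lra. generalize (Cmod_ge_0 e). nra. }
  assert (K : Rabs (ln (L (line y e 1)) - ln (L (line y e 0))) <= 11).
  { apply (loc_lip_glob_R (fun t => ln (L (line y e t))) 11).
    intros t Ht. assert (I1 := Hin t Ht). set (w := line y e t) in *.
    assert (I2 : Cmod (w - y) <= s) by lra.
    destruct (HF w I2) as [E1 [E2 [E3 E4]]]. specialize (MB w I2).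
    apply Cmod_gt_0 in E2. apply Cdist_pos in E3.
    assert (LP := Lpos w I2). set (zt := F w) in *. unfold L in LP. fold zt in LP.
    set (Q := Cmod (q1 zt)) in *. set (a := Cmod (zt - kappa)) in *.
    set (l := ln M - ln a) in *.
    destruct (Dq zt) as [B [HB HBd]].
    (* Within [d0] of [zt] the quadratic remainder of [q] is at most half the linear term, and |F -
       kappa| and its logarithmic gap [l] change by at most half of their values. *)
    set (d0 := Rmin (Rmin 1 (Q / (2 * (B + 1)))) (Rmin (a / 2) (a * l / 4))).
    assert (P0 : 0 < d0).
    { unfold d0. repeat apply Rmin_pos; try lra. apply Rdiv_lt_0_compat; lra. 
      assert (0 < a * l) by (apply Rmult_lt_0_compat; auto). lra. }
    assert (Q0 : d0 <= 1 /\ d0 <= Q / (2 * (B + 1)) /\ d0 <= a / 2 /\ d0 <= a * l / 4).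
    { unfold d0. clear. rmin. }
    destruct Q0 as [Q0a [Q0b [Q0c Q0d]]].
    destruct (Fc w I2 d0 P0) as [del [Hdel Hcl]].
    exists (del / (Cmod e + 1)). generalize (Cmod_ge_0 e). intro Ge.
    split. apply Rdiv_lt_0_compat; lra.
    intros u Hu Hut. assert (J1 := Hin u Hu). set (w' := line y e u) in *.
    assert (J2 : Cmod (w' - y) <= s) by lra.
    assert (HH : (w' - w)%C = (RtoC (u - t) * e)%C).
    { unfold w', w, line. rewrite RtoC_minus. ring. }
    assert (HHm : Cmod (w' - w) = Rabs (u - t) * Cmod e) by (rewrite HH, Cmod_mult, Cmod_R; auto).
    destruct (HF w' J2) as [F1 _].
    assert (Hd : Cmod (F w' - zt) < d0).
    { apply Hcl; auto. rewrite HHm. apply Rle_lt_trans with (Rabs (u - t) * (Cmod e + 1)).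
      generalize (Rabs_pos (u - t)). nra.
      apply Rlt_div_r in Hut; [|lra]. auto. }
    set (zu := F w') in *. set (d := Cmod (zu - zt)) in *.
    assert (Gd : 0 <= d) by apply Cmod_ge_0.
    assert (S1 : d * Q <= 2 * (Rabs (u - t) * Cmod e)).
    { specialize (HBd (zu - zt)%C). fold d in HBd.
      replace (zt + (zu - zt))%C with zu in HBd by ring. rewrite F1, E1 in HBd.
      specialize (HBd ltac:(lra)).
      assert (Cmod (q1 zt * (zu - zt)) <= Cmod (w' - w) + B * d ^ 2).
      { replace (q1 zt * (zu - zt))%C with
         (w' - w + - (w' - w - q1 zt * (zu - zt)))%C by ring.
        eapply Rle_trans; [apply Cmod_triangle|]. rewrite Cmod_opp. lra. }
      rewrite Cmod_mult, HHm in H. fold Q d in H.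
      assert (B * d <= Q / 2).
      { apply Rle_trans with ((B + 1) * (Q / (2 * (B + 1)))).
        apply Rmult_le_compat; lra. right; field; lra. }
      nra. }
    assert (S2 : Rabs (Cmod (zu - kappa) - a) <= d).
    { unfold a, d. eapply Rle_trans; [apply Cmod_diff_le|]. right; f_equal; ring. }
    assert (S3 : Rabs (ln (Cmod (zu - kappa)) - ln a) <= 2 * d / a).
    { eapply Rle_trans; [apply ln_diff_le; auto; lra|].
      apply Rmult_le_compat_r. left; now apply Rinv_0_lt_compat. lra. }
    assert (S4 : Rabs (L w' - l) <= 2 * d / a).
    { unfold L, l. fold zu. rewrite Rabs_minus_sym in S3.
      replace (ln M - ln (Cmod (zu - kappa)) - (ln M - ln a)) with (ln a - ln (Cmod (zu - kappa))) by ring. auto. }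
    assert (S5 : 2 * d / a <= l / 2).
    { apply Rle_div_l; [lra|]. lra. }
    assert (S6 : Rabs (ln (L w') - ln l) <= 2 * (2 * d / a) / l).
    { eapply Rle_trans; [apply ln_diff_le; auto; lra|].
      apply Rmult_le_compat_r. left; now apply Rinv_0_lt_compat. lra. }
    change (L w) with l. eapply Rle_trans; [apply S6|].
    assert (NB : 3 * s / 8 <= Q * a * l).
    { assert (s ^ 2 - Cmod (w - y) ^ 2 >= 3 / 4 * s ^ 2).
      { generalize (Cmod_ge_0 (w - y)%C). intro. nra. }
      apply Rmult_le_reg_l with (2 * s). lra. eapply Rle_trans; [|apply MB]. nra. }
    assert (PQ : 0 < Q * a * l) by (repeat apply Rmult_lt_0_compat; auto).
    apply Rmult_le_reg_r with (Q * a * l); auto.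
    replace (2 * (2 * d / a) / l * (Q * a * l)) with (4 * (d * Q)) by (field; lra).
    apply Rle_trans with (8 * (Rabs (u - t) * Cmod e)). lra.
    apply Rle_trans with (8 * (Rabs (u - t) * (s / 2))).
    { apply Rmult_le_compat_l; [lra|]. apply Rmult_le_compat_l; auto. apply Rabs_pos. }
    assert (0 <= Rabs (u - t)) by apply Rabs_pos. 
    replace (11 * Rabs (u - t) * (Q * a * l)) with (Rabs (u - t) * (11 * (Q * a * l))) by ring.
    replace (8 * (Rabs (u - t) * (s / 2))) with (Rabs (u - t) * (4 * s)) by field.
    apply Rmult_le_compat_l; auto. lra. }
  replace (line y e 1) with z in K by (unfold line, e; ring). rewrite line0 in K.
  assert (Py := Lpos y ltac:(rewrite Cdist_refl; lra)).
  assert (Pz := Lpos z ltac:(fold e; lra)).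
  apply Rabs_le_between in K. fold (L y) (L z).
  rewrite <- (exp_ln (L y)) by auto. rewrite <- exp_plus. rewrite <- (exp_ln (L z)) by auto.
  destruct (Req_dec (-11 + ln (L y)) (ln (L z))) as [->|N]. lra.
  left. apply exp_increasing. lra.
Qed.

(* The Schwarz-Pick lemma, by the same second derivative test. *)
Lemma schwarz_pick_lip (q q1 q2 q3 : C -> C) (k : C) (s M : R) :
  der q q1 -> der q1 q2 -> der q2 q3 -> 0 < s -> 0 < M ->
  (forall z, Cmod (z - k) <= s -> Cmod (q z) < M) ->
  forall z, Cmod (z - k) <= s / 2 -> Cmod (q z - q k) <= 2 * M / s * Cmod (z - k).
Proof.
  intros Dq Dq1 Dq2 Hs HM Hq.
  set (Disc := fun z => Cmod (z - k) <= s) in *.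
  (* Up to the factor M / s this is the quotient of the pullback by [q] of the density of the disc
     of radius [M] by the density of the disc of radius [s]; hence the bound [s / M]. *)
  set (P := fun z => (s ^ 2 + -1 * Cmod (z - k) ^ 2) * Cmod (q1 z) * / (M ^ 2 + -1 * Cmod (q z) ^ 2)).
  assert (Dpos : forall z, Disc z -> 0 < M ^ 2 + -1 * Cmod (q z) ^ 2).
  { intros z Dz. generalize (Hq z Dz) (Cmod_ge_0 (q z)). intros. nra. }
  assert (cP : contR_on Disc P).
  { apply contR_on_mult; [apply contR_on_mult|].
    - apply (contR_on_sub_sq _ s (fun z => Cmod (z - k))).
      apply (contR_on_Cmod_der _ (fun z => (z - k)%C) _ _ (der_shift k)), cont_on_id.
    - apply (contR_on_Cmod_der _ q1 q2 (fun z => z)); auto. apply cont_on_id.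
    - apply (contR_on_comp _ (fun z => M ^ 2 + -1 * Cmod (q z) ^ 2) Rinv).
      + apply (contR_on_sub_sq _ M (fun z => Cmod (q z))), (contR_on_Cmod_der _ q q1 (fun z => z)); auto. apply cont_on_id.
      + intros z Dz. apply continuity_pt_inv. apply Rgt_not_eq, Dpos; auto. }
  assert (Dk : Disc k) by (unfold Disc; rewrite Cdist_refl; lra).
  destruct (max_attained Disc P) as [z1 [Dz1 Hmax]]; auto.
  { apply closed_disc_closed_bounded. }
  { exists k; auto. }
  assert (PM : P z1 <= s / M).
  { destruct (Rle_dec (P z1) 0) as [Hle|Hgt].
    { apply Rle_trans with 0; auto. left; now apply Rdiv_lt_0_compat. }
    apply Rnot_le_lt in Hgt.
    assert (D1 := Dpos z1 Dz1).
    assert (G1 : 0 < (s ^ 2 + -1 * Cmod (z1 - k) ^ 2) * Cmod (q1 z1)).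
    { replace ((s ^ 2 + -1 * Cmod (z1 - k) ^ 2) * Cmod (q1 z1)) with
        (P z1 * (M ^ 2 + -1 * Cmod (q z1) ^ 2)) by (unfold P; field; lra).
      apply Rmult_lt_0_compat; auto. }
    assert (Gq : 0 < Cmod (q1 z1)).
    { destruct (Cmod_ge_0 (q1 z1)) as [h|h]; auto. rewrite <- h in G1. lra. }
    assert (Gs : 0 < s ^ 2 + -1 * Cmod (z1 - k) ^ 2).
    { apply Rnot_le_lt. intro. nra. }
    assert (Hlt : Cmod (z1 - k) < s) by (generalize (Cmod_ge_0 (z1 - k)%C); intro; nra).
    set (E := fun z => 2 * ln (s ^ 2 - Cmod (z - k) ^ 2) +
      (ln (Cmod (q1 z) ^ 2) + -2 * ln (M ^ 2 - Cmod (q z) ^ 2))).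
    assert (EP : forall w, Cmod (w - k) < s -> 0 < Cmod (q1 w) -> E w = 2 * ln (P w)).
    { intros w Hw Gw. assert (Dw : Disc w) by (unfold Disc; lra). assert (X := Dpos w Dw).
      assert (Y : 0 < s ^ 2 + -1 * Cmod (w - k) ^ 2) by (generalize (Cmod_ge_0 (w - k)%C); intro; nra).
      unfold E, P. rewrite !ln_mult, ln_Rinv, ln_sqr; auto.
      2: now apply Rmult_lt_0_compat.
      2: now apply Rinv_0_lt_compat.
      replace (s ^ 2 - Cmod (w - k) ^ 2) with (s ^ 2 + -1 * Cmod (w - k) ^ 2) by ring.
      replace (M ^ 2 - Cmod (q w) ^ 2) with (M ^ 2 + -1 * Cmod (q w) ^ 2) by ring. ring. }
    assert (Emax : exists eta, 0 < eta /\ forall w, Cmod (w - z1) < eta -> E w <= E z1).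
    { destruct (der_cont q1 q2 z1 Dq1 _ Gq) as [e1 [He1 K1]].
      exists (Rmin e1 (s - Cmod (z1 - k))). split. apply Rmin_pos; lra. intros w Hw.
      assert (W1 : Cmod (w - k) < s).
      { generalize (Cdist_tri z1 w k) (Rmin_r e1 (s - Cmod (z1 - k))). lra. }
      assert (W2 : 0 < Cmod (q1 w)).
      { generalize (K1 w (Rlt_min_l _ _ _ Hw)) (Cmod_diff_le (q1 w) (q1 z1)). intros X1 X2.
        apply Rabs_le_between in X2. lra. }
      rewrite !EP by auto.
      assert (Pp : 0 < P w).
      { unfold P. apply Rmult_lt_0_compat. apply Rmult_lt_0_compat; auto.
        generalize (Cmod_ge_0 (w - k)%C); intro; nra.
        apply Rinv_0_lt_compat, Dpos. unfold Disc; lra. }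
      apply Rmult_le_compat_l; [lra|].
      destruct (Hmax w) as [lt|eq]; [unfold Disc; lra| |].
      left; apply ln_increasing; auto. rewrite eq; right; auto. }
    destruct (lap_ln_disc _ _ _ z1 s (der_shift k) (der_const (RtoC 1)) Hlt) as [x1 [x2 X]].
    assert (Nz : q1 z1 <> RtoC 0) by (now apply Cmod_gt_0).
    destruct (lap_ln_norm2 q1 q2 q3 z1 Dq1 Dq2 Nz) as [u1 [u2 [U _]]].
    destruct (lap_ln_disc q q1 q2 z1 M Dq Dq1 (Hq z1 Dz1)) as [v1 [v2 V]].
    assert (Sm := lap_plus _ _ _ _ _ _ _ _ _ (lap_scal 2 _ _ _ _ _ X)
       (lap_plus _ _ _ _ _ _ _ _ _ U (lap_scal (-2) _ _ _ _ _ V))).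
    apply lap_max in Sm; [|exact Emax].
    rewrite Cmod_1 in Sm.
    set (N := s ^ 2 - Cmod (z1 - k) ^ 2) in *.
    assert (HN : s ^ 2 + -1 * Cmod (z1 - k) ^ 2 = N) by (unfold N; ring).
    set (T := M ^ 2 - Cmod (q z1) ^ 2) in *.
    assert (HT : M ^ 2 + -1 * Cmod (q z1) ^ 2 = T) by (unfold T; ring).
    rewrite HN in *. rewrite HT in *. set (a := Cmod (q1 z1)) in *.
    assert (Sm' : (M * a / T) ^ 2 <= (s / N) ^ 2).
    { match type of Sm with ?x <= 0 => replace x with (8 * ((M * a / T) ^ 2 - (s / N) ^ 2)) in Sm by (field; lra) end. lra. }
    assert (0 < s / N) by (now apply Rdiv_lt_0_compat).
    assert (Sm2 : M * a / T <= s / N) by (apply Rnot_lt_le; intro; nra).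
    unfold P. rewrite HN, HT. fold a.
    apply Rmult_le_reg_r with (M / N). now apply Rdiv_lt_0_compat.
    match goal with |- ?l <= ?r => replace l with (M * a / T) by (field; lra); replace r with (s / N) by (field; lra) end.
    exact Sm2. }
  (* On the half disc s^2 - |z - k|^2 is at least 3 s^2 / 4, whence the constant 4/3. The slack up
     to 2 in the conclusion absorbs the quadratic remainder when the bound is integrated. *)
  assert (QB : forall z, Cmod (z - k) <= s / 2 -> Cmod (q1 z) <= 4 * M / (3 * s)).
  { intros z Hz. assert (Dz : Disc z) by (unfold Disc; lra). assert (D1 := Dpos z Dz).
    assert (H := Rle_trans _ _ _ (Hmax z Dz) PM). unfold P in H.
    apply (Rmult_le_compat_r (M ^ 2 + -1 * Cmod (q z) ^ 2)) in H; [|lra].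
    rewrite Rmult_assoc, Rinv_l, Rmult_1_r in H by lra.
    assert (X : s / M * (M ^ 2 + -1 * Cmod (q z) ^ 2) <= s / M * M ^ 2).
    { apply Rmult_le_compat_l. left; now apply Rdiv_lt_0_compat. generalize (pow2_ge_0 (Cmod (q z))). lra. }
    replace (s / M * M ^ 2) with (s * M) in X by (field; lra).
    assert (Y : 3 / 4 * s ^ 2 <= s ^ 2 + -1 * Cmod (z - k) ^ 2)
      by (generalize (Cmod_ge_0 (z - k)%C); intro; nra).
    assert (W : 3 / 4 * s ^ 2 * Cmod (q1 z) <= s * M).
    { eapply Rle_trans; [|eapply Rle_trans; [apply H|apply X]]. apply Rmult_le_compat_r; auto. apply Cmod_ge_0. }
    apply Rmult_le_reg_l with (3 / 4 * s ^ 2). nra.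
    replace (3 / 4 * s ^ 2 * (4 * M / (3 * s))) with (s * M) by (field; lra). auto. }
  intros z Hz. set (e := (z - k)%C) in *.
  assert (K : Cmod (q (line k e 1) - q (line k e 0)) <= 2 * M / s * Cmod e).
  { apply (loc_lip_glob (fun t => q (line k e t)) (2 * M / s * Cmod e)).
    intros t Ht. destruct (Dq (line k e t)) as [B [HB HBd]].
    generalize (Cmod_ge_0 e). intro Ge.
    assert (Hin : Cmod (line k e t - k) <= s / 2).
    { replace (line k e t - k)%C with (RtoC t * e)%C by (unfold line; ring).
      rewrite Cmod_mult, Cmod_R, Rabs_right by lra. nra. }
    assert (QB' := QB _ Hin).
    assert (Pms : 0 < M / s) by (now apply Rdiv_lt_0_compat).
    set (d0 := Rmin 1 (M / s / (3 * (B + 1)))).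
    assert (Hd0 : 0 < d0) by (apply Rmin_pos; [lra|]; apply Rdiv_lt_0_compat; lra).
    exists (d0 / (Cmod e + 1)). split. apply Rdiv_lt_0_compat; lra.
    intros u Hu Hut.
    set (h := (RtoC (u - t) * e)%C).
    assert (Eh : Cmod h = Rabs (u - t) * Cmod e) by (unfold h; rewrite Cmod_mult, Cmod_R; auto).
    assert (Hh : Cmod h <= d0).
    { rewrite Eh. apply Rlt_div_r in Hut; [|lra].
      generalize (Rabs_pos (u - t)). nra. }
    specialize (HBd h). assert (d0 <= 1) by apply Rmin_l. specialize (HBd ltac:(lra)).
    replace (line k e t + h)%C with (line k e u) in HBd by (unfold line, h; rewrite RtoC_minus; ring).
    assert (Q : Cmod (q (line k e u) - q (line k e t)) <= Cmod (q1 (line k e t)) * Cmod h + B * Cmod h ^ 2).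
    { rewrite <- Cmod_mult.
      replace (q (line k e u) - q (line k e t))%C with
       (q1 (line k e t) * h + (q (line k e u) - q (line k e t) - q1 (line k e t) * h))%C by ring.
      eapply Rle_trans; [apply Cmod_triangle|]. lra. }
    eapply Rle_trans; [apply Q|].
    assert (B * Cmod h <= M / s / 3).
    { apply Rle_trans with ((B + 1) * (M / s / (3 * (B + 1)))).
      apply Rmult_le_compat; try lra. apply Cmod_ge_0. eapply Rle_trans; [apply Hh|apply Rmin_r].
      right; field; lra. }
    generalize (Cmod_ge_0 h). intro Gh.
    replace (2 * M / s * Cmod e * Rabs (u - t)) with ((4 * M / (3 * s) + 2 / 3 * (M / s)) * (Rabs (u - t) * Cmod e)) by (field; lra).
    rewrite <- Eh. 
    replace (Cmod (q1 (line k e t)) * Cmod h + B * Cmod h ^ 2) with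
      ((Cmod (q1 (line k e t)) + B * Cmod h) * Cmod h) by ring.
    apply Rmult_le_compat_r; auto. lra. }
  replace (line k e 1) with z in K by (unfold line, e; ring). rewrite line0 in K. exact K.
Qed.

(** * Polynomial roots and compact sets *)

Fixpoint peval (l : list C) (z : C) : C :=
  match l with nil => RtoC 0 | c :: l' => (c + z * peval l' z)%C end.

Lemma Pol_list p : Pol p -> exists l, forall z, p z = peval l z.
Proof.
  assert (pl : forall l l', exists l'', forall z, (peval l z + peval l' z)%C = peval l'' z).
  { induction l as [|c l IH]; intros l'.
    - exists l'. intro z. simpl. ring.
    - destruct l' as [|c' l'].
      + exists (c :: l). intro z. simpl. ring.
      + destruct (IH l') as [m Hm]. exists ((c + c')%C :: m). intro z. simpl. rewrite <- Hm. ring. }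
  assert (sc : forall k l, exists l'', forall z, (k * peval l z)%C = peval l'' z).
  { intros k l. exists (map (Cmult k) l). intro z. induction l as [|c l IH]; simpl; [ring|].
    rewrite <- IH. ring. }
  assert (ml : forall l l', exists l'', forall z, (peval l z * peval l' z)%C = peval l'' z).
  { induction l as [|c l IH]; intros l'.
    - exists nil. intro z. simpl. ring.
    - destruct (sc c l') as [m Hm], (IH l') as [n Hn], (pl m (RtoC 0 :: n)) as [r Hr].
      exists r. intro z. rewrite <- Hr. simpl. rewrite <- Hm, <- Hn. ring. }
  induction 1 as [c| |p q Hp [l Hl] Hq [l' Hl']|p q Hp [l Hl] Hq [l' Hl']].
  - exists (c :: nil). intro z. simpl. ring.
  - exists (RtoC 0 :: RtoC 1 :: nil). intro z. simpl. ring.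
  - destruct (pl l l') as [m Hm]. exists m. intro z. now rewrite <- Hm, Hl, Hl'.
  - destruct (ml l l') as [m Hm]. exists m. intro z. now rewrite <- Hm, Hl, Hl'.
Qed.

Lemma peval_factor l a : exists l', (length l' <= pred (length l))%nat /\
  forall z, peval l z = (peval l a + (z - a) * peval l' z)%C.
Proof.
  induction l as [|c l [l' [IH2 IH3]]].
  - exists nil. simpl. split; [lia|]. intro z. ring.
  - destruct l as [|c' l].
    + exists nil. simpl. split; [lia|]. intro z. ring.
    + exists (peval (c' :: l) a :: l'). split; [simpl in *; lia|].
      intro z. change (peval (c :: c' :: l) z) with (c + z * peval (c' :: l) z)%C.
      change (peval (c :: c' :: l) a) with (c + a * peval (c' :: l) a)%C.
      change (peval (peval (c' :: l) a :: l') z) with (peval (c' :: l) a + z * peval l' z)%C.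
      rewrite (IH3 z). ring.
Qed.

Lemma Pol_finite_roots p : Pol p -> (exists z, p z <> RtoC 0) ->
  exists r : list C, forall z, p z = RtoC 0 <-> In z r.
Proof.
  intros Hp [w Hw]. destruct (Pol_list p Hp) as [l Hl].
  assert (K : forall n l, (length l <= n)%nat -> peval l w <> RtoC 0 ->
    exists r : list C, forall z, peval l z = RtoC 0 <-> In z r).
  { induction n as [|n IH]; intros m Hm Hmw.
    - destruct m; [|simpl in Hm; lia]. elim Hmw. reflexivity.
    - destruct (classic (exists a, peval m a = RtoC 0)) as [[a Ha]|N].
      + destruct (peval_factor m a) as [m' [M2 M3]].
        assert (F : forall z, peval m z = ((z - a) * peval m' z)%C).
        { intro z. rewrite M3, Ha. ring. }
        destruct (IH m') as [r Hr].
        * destruct m; [elim Hmw; reflexivity|simpl in *; lia].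
        * intro H. apply Hmw. rewrite F, H. ring.
        * exists (a :: r). intro z. rewrite F. simpl. rewrite <- Hr. split.
          { intro H. destruct (Cmult_eq0 _ _ H); auto. left. symmetry. now apply Cminus_eq0. }
          { intros [->|H]; [|rewrite H]; ring. }
      + exists nil. intro z. simpl. split; [|tauto]. intro H. apply N. exists z; auto. }
  destruct (K (length l) l) as [r Hr]; auto.
  { now rewrite <- Hl. }
  exists r. intro z. now rewrite Hl.
Qed.

Lemma list_separated (r : list C) : exists d, 0 < d /\
  forall a b, In a r -> In b r -> Cmod (a - b) < d -> a = b.
Proof.
  assert (K : forall a (l : list C), exists d, 0 < d /\ forall b, In b l -> Cmod (a - b) < d -> a = b).
  { intros a l. induction l as [|c l [d [Hd IH]]].
    - exists 1. split; [lra|]. intros b [].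
    - destruct (classic (a = c)) as [->|N].
      + exists d. split; auto. intros b [->|Hb] H; auto.
      + exists (Rmin d (Cmod (a - c))). split.
        * apply Rmin_pos; auto. now apply Cdist_pos.
        * intros b [<-|Hb] H.
          { generalize (Rmin_r d (Cmod (a - c))). lra. }
          { apply IH; auto. eapply Rlt_min_l, H. } }
  assert (J : forall l, exists d, 0 < d /\ forall a b, In a l -> In b r -> Cmod (a - b) < d -> a = b).
  { induction l as [|c l [d [Hd IH]]].
    - exists 1. split; [lra|]. intros a b [].
    - destruct (K c r) as [d' [Hd' IH']]. exists (Rmin d d'). split. apply Rmin_pos; auto.
      intros a b [<-|Ha] Hb H.
      + apply IH'; auto. eapply Rlt_min_r, H.
      + apply IH; auto. eapply Rlt_min_l, H. }
  apply J.
Qed.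

Lemma compactC_closed (S : C -> Prop) z : compactC S -> closureC S z -> S z.
Proof.
  intros Hc Hz. apply NNPP. intro N.
  destruct (Hc nat (fun n w => / (INR n + 1) < Cmod (w - z))) as [l Hl].
  - intros n w Hw. exists (Cmod (w - z) - / (INR n + 1)). split; [lra|].
    intros v Hv. generalize (Cdist_tri v w z). rewrite (Cdist_sym w v). lra.
  - intros w Sw. assert (P : 0 < Cmod (w - z)) by (apply Cdist_pos; intros ->; auto).
    destruct (inv_INR_small _ P) as [n Hn]. exists n. apply Hn. lia.
  - assert (M : exists n, forall i, In i l -> (i <= n)%nat).
    { clear. induction l as [|a l [n IH]]. exists 0%nat. intros i [].
      exists (max a n). intros i [<-|Hi]. lia. specialize (IH i Hi). lia. }
    destruct M as [n Hn].
    destruct (Hz (/ (INR n + 1))) as [w [Sw Hw]].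
    { apply inv_INR_pos. }
    destruct (Hl w Sw) as [i [Hi Hi']]. specialize (Hn i Hi). apply le_INR in Hn.
    assert (/ (INR n + 1) <= / (INR i + 1)).
    { apply Rinv_le_contravar. generalize (pos_INR i); lra. lra. }
    lra.
Qed.

Lemma compact_in_open_margin (S U : C -> Prop) : compactC S -> openC U -> subsetC S U ->
  exists d, 0 < d /\ forall z w, S z -> Cmod (w - z) < d -> U w.
Proof.
  intros Hc HU HS.
  (* The cover consists of discs whose doubles lie in [U], so the least radius of a finite subcover
     is a Lebesgue number. *)
  set (I := {p : C * R | 0 < snd p /\ forall w, Cmod (w - fst p) < 2 * snd p -> U w}).
  destruct (Hc I (fun i w => Cmod (w - fst (proj1_sig i)) < snd (proj1_sig i))) as [l Hl].
  - intros [[c r] [H1 H2]] w. simpl in *. intro Hw.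
    exists (r - Cmod (w - c)). split; [lra|].
    intros v Hv. generalize (Cdist_tri w v c). lra.
  - intros z Sz. destruct (HU z (HS z Sz)) as [e [He K]].
    assert (Hi : 0 < snd (z, e / 2) /\ forall w, Cmod (w - fst (z, e / 2)) < 2 * snd (z, e / 2) -> U w).
    { simpl. split; [lra|]. intros w Hw. apply K. lra. }
    exists (exist _ (z, e / 2) Hi). simpl. rewrite Cdist_refl. lra.
  - assert (M : exists d, 0 < d /\ forall i, In i l -> d <= snd (proj1_sig i)).
    { clear. induction l as [|[[c r] [H1 H2]] l [d [Hd IH]]]. exists 1. split; [lra|]. intros i [].
      exists (Rmin d r). split. apply Rmin_pos; auto. intros i [<-|Hi]; simpl. apply Rmin_r.
      eapply Rle_trans; [apply Rmin_l|auto]. }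
    destruct M as [d [Hd M]]. exists d. split; auto. intros z w Sz Hw.
    destruct (Hl z Sz) as [i [Hi Hz]]. specialize (M i Hi).
    destruct i as [[c r] [H1 H2]]. simpl in *. apply H2.
    generalize (Cdist_tri z w c). lra.
Qed.

(** One period of the curve is compact, so a point off the curve has a disc off the curve; the disc
    is connected and by maximality lies in the component. *)
Lemma jordan_domain_open (D : C -> Prop) : jordan_domain D -> openC D.
Proof.
  intros [gam [[Gc [Gp _]] [[Dsub [_ [_ Dmax]]] _]]] z Dz.
  assert (Gpn : forall (n : nat) t, gam (t + INR n) = gam t).
  { induction n; intro t. simpl. now rewrite Rplus_0_r.
    rewrite S_INR, <- Rplus_assoc, Gp. apply IHn. }
  assert (Gz : forall k t, gam (t + IZR k) = gam t).
  { intros k t. destruct k as [|p|p].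
    - now rewrite Rplus_0_r.
    - rewrite <- (Gpn (Pos.to_nat p) t). f_equal. now rewrite INR_IZR_INZ, positive_nat_Z.
    - rewrite <- (Gpn (Pos.to_nat p) (t + IZR (Z.neg p))). f_equal.
      rewrite INR_IZR_INZ, positive_nat_Z. rewrite Rplus_assoc, <- plus_IZR.
      rewrite Pos2Z.add_neg_pos, Z.pos_sub_diag. ring. }
  destruct (continuity_ab_min (fun t => Cmod (gam t - z)) 0 1) as [m [Hm1 Hm2]]; [lra| |].
  { intros c _ eps He. destruct (Gc c eps He) as [d [Hd K]]. exists d. split; auto.
    intros x [_ Hx]. simpl in *. unfold R_dist in *. specialize (K x Hx).
    eapply Rle_lt_trans; [apply Cmod_diff_le|].
    replace (gam x - z - (gam c - z))%C with (gam x - gam c)%C by ring. exact K. }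
  set (e := Cmod (gam m - z)) in *.
  assert (Pe : 0 < e).
  { apply Cdist_pos. intro H. apply (Dsub z Dz m). auto. }
  assert (Ball : forall w, Cmod (w - z) < e -> forall t, w <> gam t).
  { intros w Hw t Ht.
    assert (Hf : gam t = gam (frac_part t)).
    { replace t with (frac_part t + IZR (Int_part t)) at 1 by (unfold frac_part; ring). apply Gz. }
    destruct (base_fp t) as [B1 B2]. specialize (Hm1 (frac_part t) ltac:(lra)).
    rewrite <- Hf, <- Ht in Hm1. lra. }
  exists e. split; auto. intros w Hw.
  set (B := fun w => Cmod (w - z) < e).
  apply (Dmax B); auto.
  - assert (Seg : forall O1 O2 : C -> Prop, openC O1 -> openC O2 -> (forall v, B v -> O1 v \/ O2 v) ->
       (forall v, B v -> O1 v -> O2 v -> False) -> O1 z -> forall v, B v -> O2 v -> False).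
    { intros O1 O2 Op1 Op2 Cov Dis Oz v Bv Ov.
      set (f := fun t => (z + RtoC t * (v - z))%C).
      assert (Bf : forall t, 0 <= t <= 1 -> B (f t)).
      { intros t Ht. unfold B, f. replace (z + RtoC t * (v - z) - z)%C with
         (RtoC t * (v - z))%C by ring. rewrite Cmod_mult, Cmod_R, Rabs_right by lra.
        generalize (Cmod_ge_0 (v - z)%C). unfold B in Bv. nra. }
      assert (Lf : forall t u, Cmod (f u - f t) <= e * Rabs (u - t)).
      { intros t u. unfold f. replace (z + RtoC u * (v - z) - (z + RtoC t * (v - z)))%C
         with (RtoC (u - t) * (v - z))%C by (rewrite RtoC_minus; ring).
        rewrite Cmod_mult, Cmod_R, Rmult_comm. apply Rmult_le_compat_r. apply Rabs_pos. unfold B in Bv. lra. }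
      assert (E0 : f 0 = z) by (unfold f; ring). assert (E1 : f 1 = v) by (unfold f; ring).
      assert (Loc : forall (O : C -> Prop) t, openC O -> O (f t) -> exists eta, 0 < eta /\
        forall u, Rabs (u - t) < eta -> O (f u)).
      { intros O t Op Ot. destruct (Op _ Ot) as [d [Hd K]]. exists (d / e). split. now apply Rdiv_lt_0_compat.
        intros u Hut. apply K. eapply Rle_lt_trans; [apply Lf|]. apply (Rmult_lt_compat_l e) in Hut; auto.
        replace (e * (d / e)) with d in Hut by (field; lra). auto. }
      apply (Dis v); auto. rewrite <- E1. apply (interval_connected (fun t => O1 (f t))); [|now rewrite E0].
      intros t Ht. destruct (Cov (f t) (Bf t Ht)) as [Y|Y].
      - destruct (Loc O1 t Op1 Y) as [eta [He Z]]. exists eta; split; auto. intros u Hu Hut.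
        specialize (Z u Hut). tauto.
      - destruct (Loc O2 t Op2 Y) as [eta [He Z]]. exists eta; split; auto. intros u Hu Hut.
        specialize (Z u Hut). split; intro Y'; exfalso; [apply (Dis (f u))|apply (Dis (f t))]; auto. }
    intros [O1 [O2 [Op1 [Op2 [Cov [[v1 [Bv1 Ov1]] [[v2 [Bv2 Ov2]] Dis]]]]]]].
    assert (Bz : B z) by (unfold B; rewrite Cdist_refl; auto).
    destruct (Cov z Bz) as [Oz|Oz].
    + apply (Seg O1 O2 Op1 Op2 Cov Dis Oz v2); auto.
    + apply (Seg O2 O1 Op2 Op1) with v1; auto. intros v Bv. destruct (Cov v Bv); auto.
      intros v Bv X1 X2. apply (Dis v); auto.
  - exists z. split; auto. unfold B. rewrite Cdist_refl; auto.
Qed.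

(** * External coordinates *)

Lemma Cmod_polar r a : 0 <= r -> Cmod (polar r a) = r.
Proof.
  intro H. unfold polar, Cmod; simpl.
  replace (r * cos (2 * PI * a) * (r * cos (2 * PI * a) * 1) + r * sin (2 * PI * a) * (r * sin (2 * PI * a) * 1))
   with (r * r * (Rsqr (sin (2 * PI * a)) + Rsqr (cos (2 * PI * a)))) by (unfold Rsqr; ring).
  rewrite sin2_cos2, Rmult_1_r. now apply sqrt_square.
Qed.

Lemma polar_mult r s a c : (polar r a * polar s c)%C = polar (r * s) (a + c).
Proof.
  unfold polar, Cmult; simpl. rewrite Rmult_plus_distr_l, cos_plus, sin_plus. f_equal; ring.
Qed.

Lemma polar_cube r a : Cpow (polar r a) 3 = polar (r ^ 3) (3 * a).
Proof.
  simpl. rewrite Cmult_1_r, !polar_mult. f_equal; ring.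
Qed.

Lemma polar_eqmod1 r a c : eqmod1 a c -> polar r a = polar r c.
Proof.
  intros [k Hk].
  assert (K : forall (n : nat) x, polar r (x + INR n) = polar r x).
  { intros n x. unfold polar. replace (2 * PI * (x + INR n)) with (2 * PI * x + 2 * INR n * PI) by ring.
    now rewrite cos_period, sin_period. }
  destruct (Z_le_dec 0 k) as [H|H].
  - rewrite <- (K (Z.to_nat k) c). f_equal. rewrite INR_IZR_INZ, Z2Nat.id by auto. lra.
  - rewrite <- (K (Z.to_nat (- k)) a). f_equal. rewrite INR_IZR_INZ, Z2Nat.id by lia.
    rewrite opp_IZR. lra.
Qed.

Lemma cos_1_int x : cos (2 * PI * x) = 1 -> exists k, x = IZR k.
Proof.
  intro H. replace (2 * PI * x) with (2 * (PI * x)) in H by ring. rewrite cos_2a_sin in H.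
  assert (E : sin (PI * x) = 0) by nra.
  apply sin_eq_0_0 in E. destruct E as [k Hk]. exists k.
  apply Rmult_eq_reg_l with PI. rewrite Hk. ring. apply PI_neq0.
Qed.

Lemma polar_inj r s a c : 0 < r -> 0 < s -> polar r a = polar s c -> r = s /\ eqmod1 a c.
Proof.
  intros Hr Hs H.
  assert (E : r = s). { rewrite <- (Cmod_polar r a), H, Cmod_polar; lra. }
  split; auto. subst s. unfold polar in H. injection H as H1 H2.
  apply Rmult_eq_reg_l in H1; [|lra]. apply Rmult_eq_reg_l in H2; [|lra].
  destruct (cos_1_int (a - c)) as [k Hk].
  { rewrite Rmult_minus_distr_l, cos_minus, H1, H2.
    generalize (sin2_cos2 (2 * PI * c)). unfold Rsqr. lra. }
  exists k. auto.
Qed.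

Lemma polar_surj w : w <> RtoC 0 -> exists a, w = polar (Cmod w) a.
Proof.
  intro H. apply Cmod_gt_0 in H. set (r := Cmod w) in *.
  destruct w as [x y].
  assert (E : x * x + y * y = r * r).
  { unfold r. generalize (Cmod2_alt (x, y)). simpl. lra. }
  assert (P : 0 < PI) by apply PI_RGT_0.
  assert (B : -1 <= x / r <= 1).
  { split; apply Rmult_le_reg_r with r; auto; unfold Rdiv; rewrite Rmult_assoc, Rinv_l by lra; nra. }
  assert (S : sin (acos (x / r)) = Rabs y / r).
  { rewrite sin_acos by auto. rewrite <- (sqrt_square (Rabs y / r)).
    - f_equal. unfold Rsqr. replace (Rabs y / r * (Rabs y / r)) with ((Rabs y * Rabs y) / (r * r)) by (field; lra).
      rewrite <- Rabs_mult, (Rabs_right (y * y)) by nra.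
      replace (y * y) with (r * r - x * x) by lra. field. lra.
    - apply Rmult_le_pos. apply Rabs_pos. left; now apply Rinv_0_lt_compat. }
  destruct (Rle_dec 0 y) as [Hy|Hy].
  - exists (acos (x / r) / (2 * PI)). unfold polar.
    replace (2 * PI * (acos (x / r) / (2 * PI))) with (acos (x / r)) by (field; lra).
    rewrite cos_acos, S, Rabs_right by (auto; lra). f_equal; field; lra.
  - exists (- acos (x / r) / (2 * PI)). unfold polar.
    replace (2 * PI * (- acos (x / r) / (2 * PI))) with (- acos (x / r)) by (field; lra).
    rewrite cos_neg, sin_neg, cos_acos, S, Rabs_left by (auto; lra). f_equal; field; lra.
Qed.

Lemma polar_cont r a eps : 0 < eps -> exists del, 0 < del /\ forall s c,
  Rabs (s - r) < del -> Rabs (c - a) < del -> Cmod (polar s c - polar r a) < eps.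
Proof.
  intro He.
  assert (P : 0 < PI) by apply PI_RGT_0.
  assert (cc : continuity_pt (fun x => cos (2 * PI * x)) a) by reg.
  assert (cs : continuity_pt (fun x => sin (2 * PI * x)) a) by reg.
  set (e := eps / (2 * (Rabs r + 2))).
  assert (Rp := Rabs_pos r).
  assert (Pe : 0 < e) by (apply Rdiv_lt_0_compat; lra).
  assert (U : forall g, continuity_pt g a -> exists d, 0 < d /\ forall c, Rabs (c - a) < d -> Rabs (g c - g a) < e).
  { intros g Hg. destruct (Hg e Pe) as [d [Hd K]]. exists d; split; auto. intros c Hc.
    destruct (Req_dec c a) as [->|N]. rewrite Rminus_diag, Rabs_R0; auto.
    apply (K c). split; [split; auto; exact I|exact Hc]. }
  destruct (U _ cc) as [d1 [Hd1 K1]], (U _ cs) as [d2 [Hd2 K2]]. cbv beta in *.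
  set (d := Rmin (Rmin d1 d2) (Rmin 1 e)).
  assert (D : 0 < d /\ d <= d1 /\ d <= d2 /\ d <= 1 /\ d <= e).
  { unfold d. rmin. }
  exists d. split; [tauto|]. intros s c Hs Hc.
  specialize (K1 c ltac:(lra)). specialize (K2 c ltac:(lra)).
  eapply Rle_lt_trans. apply Cmod_le_ReIm. unfold polar. simpl.
  assert (G : forall x y : R, Rabs x <= 1 -> Rabs (x - y) < e -> Rabs (s * x + - (r * y)) < e * (Rabs r + 1) ).
  { intros x y Hx Hxy. replace (s * x + - (r * y)) with ((s - r) * x + r * (x - y)) by ring.
    eapply Rle_lt_trans; [apply Rabs_triang|]. rewrite !Rabs_mult.
    assert (Rabs (s - r) * Rabs x < e).
    { generalize (Rabs_pos (s - r)) (Rabs_pos x). nra. }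
    generalize (Rabs_pos (x - y)). nra. }
  generalize (G _ _ (Rabs_le _ _ (COS_bound (2 * PI * c))) K1) (G _ _ (Rabs_le _ _ (SIN_bound (2 * PI * c))) K2).
  intros G1 G2.
  assert (2 * (e * (Rabs r + 2)) = eps) by (unfold e; field; lra). lra.
Qed.

Lemma eqmod1_refl x : eqmod1 x x.
Proof. exists 0%Z. ring. Qed.

Lemma eqmod1_sym x y : eqmod1 x y -> eqmod1 y x.
Proof. intros [k H]. exists (- k)%Z. rewrite opp_IZR. lra. Qed.

Lemma eqmod1_trans y x z : eqmod1 x y -> eqmod1 y z -> eqmod1 x z.
Proof. intros [k H] [l H']. exists (k + l)%Z. rewrite plus_IZR. lra. Qed.

Lemma eqmod1_mult (k : Z) x y : eqmod1 x y -> eqmod1 (IZR k * x) (IZR k * y).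
Proof. intros [l H]. exists (k * l)%Z. rewrite mult_IZR, <- H. ring. Qed.

Lemma eqmod1_3 x y : eqmod1 x y -> eqmod1 (3 * x) (3 * y).
Proof. apply (eqmod1_mult 3). Qed.

Lemma eqmod1_pow3 n x y : eqmod1 x y -> eqmod1 (3 ^ n * x) (3 ^ n * y).
Proof. intro H. rewrite pow_IZR. now apply eqmod1_mult. Qed.

Lemma eqmod1_shift (k : Z) x : eqmod1 (x + IZR k) x.
Proof. exists k. ring. Qed.

Lemma eqmod1_norm c x : exists y, eqmod1 x y /\ c <= y < c + 1.
Proof.
  exists (c + frac_part (x - c)). split.
  - exists (Int_part (x - c)). unfold frac_part. ring.
  - generalize (base_fp (x - c)). lra.
Qed.

Lemma eqmod1_small x y : eqmod1 x y -> Rabs (x - y) < 1 -> x = y.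
Proof.
  intros [k H] Hd. rewrite H in Hd. rewrite <- abs_IZR in Hd. apply lt_IZR in Hd.
  assert (k = 0%Z) by lia. subst. lra.
Qed.

(** Compactness of [[r1, r2]] times the circle of angles. The hypothesis gives [P] near each point
    with the radius itself as last argument, so monotonicity transfers it to the smaller values
    along a sequence of counterexamples. *)
Lemma box_unif (r1 r2 : R) (P : R -> R -> R -> Prop) :
  (forall rho th d d', d' <= d -> P rho th d -> P rho th d') ->
  (forall rho th (k : Z) d, P rho th d -> P rho (th + IZR k) d) ->
  (forall rho th, r1 <= rho <= r2 -> exists d, 0 < d /\
     forall rho' th', Rabs (rho' - rho) < d -> Rabs (th' - th) < d -> P rho' th' d) ->
  exists d, 0 < d /\ forall rho th, r1 <= rho <= r2 -> P rho th d.
Proof.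
  intros Hmon Hper Hloc. apply NNPP. intro N.
  assert (E : forall n : nat, exists p : C, r1 <= fst p <= r2 /\ 0 <= snd p < 1 /\ ~ P (fst p) (snd p) (/ (INR n + 1))).
  { intro n. apply NNPP. intro N'. apply N. exists (/ (INR n + 1)). split.
    apply inv_INR_pos.
    intros r t Hr. apply NNPP. intro N''. apply N'.
    destruct (eqmod1_norm 0 t) as [t' [[k Hk] H2]].
    exists (r, t'). simpl. split; [|split]; auto. lra. intro H. apply N''.
    replace t with (t' + IZR k) by lra. now apply Hper. }
  apply functional_choice in E. destruct E as [u Hu].
  destruct (cluster_C u (Rabs r1 + Rabs r2 + 1)) as [[rr tt] Hl].
  { intro n. destruct (Hu n) as [A [B _]]. eapply Rle_trans; [apply Cmod_le_ReIm|].
    unfold Re, Im. assert (Rabs (fst (u n)) <= Rabs r1 + Rabs r2).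
    { generalize (Rle_abs r1) (Rle_abs r2) (Rle_abs (- r1)) (Rle_abs (- r2)). rewrite !Rabs_Ropp. intros.
      apply Rabs_le. lra. }
    assert (Rabs (snd (u n)) <= 1) by (apply Rabs_le; lra). lra. }
  assert (Cl : forall e N, 0 < e -> exists n, (N <= n)%nat /\ Rabs (fst (u n) - rr) < e /\ Rabs (snd (u n) - tt) < e).
  { intros e N0 He. destruct (Hl e N0 He) as [n [H1 H2]]. exists n. split; auto. split.
    - eapply Rle_lt_trans; [|apply H2]. apply (re_le_Cmod (u n - (rr, tt))%C).
    - eapply Rle_lt_trans; [|apply H2]. apply (Im_le_Cmod (u n - (rr, tt))%C). }
  assert (Hrr : r1 <= rr <= r2).
  { split; apply le_epsilon; intros e He; destruct (Cl e 0%nat He) as [n [_ [H1 _]]]; apply Rabs_def2 in H1;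
    destruct (Hu n) as [A _]; lra. }
  destruct (Hloc rr tt Hrr) as [d [Hd X]].
  destruct (inv_INR_small d Hd) as [n0 Hn0].
  destruct (Cl d n0 Hd) as [n [Hn [H1 H2]]].
  destruct (Hu n) as [_ [_ F]]. apply F. apply Hmon with d; auto. left; auto.
Qed.

Lemma three_periodic_pow k t q : eqmod1 (3 ^ k * t) t -> eqmod1 (3 ^ (k * q) * t) t.
Proof.
  intro H. induction q as [|q IH].
  - rewrite Nat.mul_0_r. simpl. rewrite Rmult_1_l. apply eqmod1_refl.
  - rewrite Nat.mul_succ_r, Nat.add_comm, pow_add, Rmult_assoc.
    eapply eqmod1_trans; [|exact H]. now apply eqmod1_pow3.
Qed.

(** * Iterates of the cubic polynomial and the filled Julia set *)

Section CubicDynamics.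
Context (lam b : C).
Notation f := (cubic lam b).
Notation K := (filled_julia lam b).

Lemma cubic_eq z : f z = (lam * z + b * (z * z) + z * (z * z))%C.
Proof. unfold cubic. simpl. ring. Qed.

Lemma cubic'_eq z : cubic' lam b z = (lam + RtoC 2 * (b * z) + RtoC 3 * (z * z))%C.
Proof. unfold cubic'. simpl. ring. Qed.

Lemma Pol_ext_cubic (p : C -> C) : Pol p ->
  exists q, Pol q /\ forall z, q z = f (p z).
Proof.
  intro Hp. exists (fun z => (lam * p z + b * (p z * p z) + p z * (p z * p z))%C).
  split. repeat constructor; auto. intro z. now rewrite cubic_eq.
Qed.

Lemma iterate_S n z : iterate f (S n) z = f (iterate f n z).
Proof. reflexivity. Qed.

Lemma iterate_add m n z : iterate f (m + n) z = iterate f m (iterate f n z).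
Proof. induction m; simpl; auto. unfold iterate in *. simpl. now rewrite IHm. Qed.

Lemma iterate_comm n z : iterate f n (f z) = f (iterate f n z).
Proof. rewrite <- iterate_S. replace (S n) with (n + 1)%nat by lia. now rewrite iterate_add. Qed.

Lemma der_cubic_comp p p1 : der p p1 ->
  der (fun z => f (p z)) (fun z => (cubic' lam b (p z) * p1 z)%C).
Proof.
  intro H. assert (T := der_plus _ _ _ _ (der_plus _ _ _ _ (der_mult _ _ _ _ (der_const lam) H)
    (der_mult _ _ _ _ (der_const b) (der_mult _ _ _ _ H H))) (der_mult _ _ _ _ H (der_mult _ _ _ _ H H))).
  intro z. destruct (T z) as [B [HB X]]. exists B. split; auto. intros h Hh. specialize (X h Hh). cbv beta in X.
  rewrite !cubic_eq, cubic'_eq. eapply Rle_trans; [|apply X]. right; f_equal. ring.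
Qed.

Lemma Pol_iterate n : exists q, Pol q /\ forall z, q z = iterate f n z.
Proof.
  induction n as [|n [q [H1 H2]]].
  - exists (fun z => z). split. constructor. reflexivity.
  - destruct (Pol_ext_cubic q H1) as [q' [H3 H4]]. exists q'. split; auto. intro z.
    now rewrite H4, H2.
Qed.

Lemma iterate_cont n z : forall eps, 0 < eps -> exists del, 0 < del /\
  forall w, Cmod (w - z) < del -> Cmod (iterate f n w - iterate f n z) < eps.
Proof.
  intros eps He. destruct (Pol_iterate n) as [q [H1 H2]].
  destruct (Pol_cont q z H1 eps He) as [d [Hd X]]. exists d; split; auto. intros w Hw. rewrite <- !H2. auto.
Qed.

Lemma cubic_cont z : forall eps, 0 < eps -> exists del, 0 < del /\
  forall w, Cmod (w - z) < del -> Cmod (f w - f z) < eps.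
Proof. apply (iterate_cont 1). Qed.

Lemma cubic_bound B z : 0 <= B -> Cmod z <= B -> Cmod (f z) <= Cmod lam * B + Cmod b * B ^ 2 + B ^ 3.
Proof.
  intros HB Hz. rewrite cubic_eq.
  generalize (Cmod_ge_0 z) (Cmod_ge_0 lam) (Cmod_ge_0 b). intros.
  assert (Cmod z * Cmod z <= B ^ 2) by nra.
  apply Cmod_plus_le; [apply Cmod_plus_le|]; rewrite !Cmod_mult.
  - apply Rmult_le_compat_l; auto.
  - apply Rmult_le_compat_l; auto.
  - simpl. apply Rmult_le_compat; auto. nra.
Qed.

Lemma cubic_escape : exists R0, 1 <= R0 /\ forall z, R0 < Cmod z -> 2 * Cmod z <= Cmod (f z).
Proof.
  exists (Cmod lam + Cmod b + 3). generalize (Cmod_ge_0 lam) (Cmod_ge_0 b). intros Hl Hb. split; [lra|].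
  intros z Hz. rewrite cubic_eq.
  assert (T : Cmod (z * (z * z)) <=
    Cmod (lam * z + b * (z * z) + z * (z * z)) + (Cmod lam * Cmod z + Cmod b * (Cmod z * Cmod z))).
  { replace (z * (z * z))%C with (lam * z + b * (z * z) + z * (z * z) + - (lam * z + b * (z * z)))%C at 1 by ring.
    apply Cmod_plus_le; [lra|]. rewrite Cmod_opp. apply Cmod_plus_le; rewrite !Cmod_mult; lra. }
  rewrite !Cmod_mult in T. set (x := Cmod z) in *.
  assert (2 * x <= x * (x * x) - Cmod lam * x - Cmod b * (x * x)); [|lra].
  replace (x * (x * x) - Cmod lam * x - Cmod b * (x * x)) with (x * (x * (x - Cmod b) - Cmod lam)) by ring.
  rewrite (Rmult_comm 2). apply Rmult_le_compat_l; [lra|].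
  assert (x * (x - Cmod b) >= x * 1) by (apply Rle_ge, Rmult_le_compat_l; lra). lra.
Qed.

Lemma filled_julia_bounded : exists R0, 1 <= R0 /\ forall z, K z -> Cmod z <= R0.
Proof.
  destruct cubic_escape as [R0 [H1 H2]]. exists R0. split; auto. intros z [M HM].
  apply Rnot_lt_le. intro Hz.
  assert (X : forall n, 2 ^ n * Cmod z <= Cmod (iterate f n z)).
  { induction n. simpl. lra. rewrite iterate_S.
    assert (R0 < Cmod (iterate f n z)).
    { assert (1 <= 2 ^ n) by (apply pow_R1_Rle; lra). nra. }
    specialize (H2 _ H). simpl. lra. }
  destruct (pow_unbounded 2 (Cmod z) (M + 1)) as [N HN]; try lra.
  specialize (HN N (le_n N)). specialize (X N). specialize (HM N). lra.
Qed.

Lemma filled_julia_cubic z : K z <-> K (f z).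
Proof.
  split; intros [M HM].
  - exists M. intro n. rewrite iterate_comm, <- iterate_S. apply HM.
  - exists (Rmax (Cmod z) M). intros [|n]. apply Rmax_l.
    rewrite iterate_S, <- iterate_comm. eapply Rle_trans; [apply HM|apply Rmax_r].
Qed.

Lemma filled_julia_iterate n z : K z <-> K (iterate f n z).
Proof. induction n. reflexivity. rewrite iterate_S, <- filled_julia_cubic. auto. Qed.

Lemma filled_julia_compl_open z : ~ K z -> exists del, 0 < del /\
  forall w, Cmod (w - z) < del -> ~ K w.
Proof.
  intro H. destruct filled_julia_bounded as [R0 [_ HR]].
  assert (E : exists n, R0 < Cmod (iterate f n z)).
  { apply NNPP. intro N. apply H. exists R0. intro n. apply Rnot_lt_le. intro. apply N. exists n; auto. }
  destruct E as [n Hn].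
  destruct (iterate_cont n z (Cmod (iterate f n z) - R0) ltac:(lra)) as [d [Hd X]].
  exists d; split; auto. intros w Hw Kw. specialize (X w Hw).
  apply (filled_julia_iterate n) in Kw. apply HR in Kw.
  generalize (Cmod_diff_le (iterate f n w) (iterate f n z)). intro Y.
  apply Rabs_le_between in Y. lra.
Qed.

(** * The inverse of the Böttcher coordinate *)

Context (phi : C -> C) (Hphi : bottcher lam b phi).

(** The potential is ln |phi|, so that [f] triples both coordinates. The value is meaningful for
    [rho > 0]. *)
Definition Psi (rho th : R) : C :=
  epsilon (inhabits (RtoC 0)) (fun z => ~ K z /\ phi z = polar (exp rho) th).

Lemma exp_gt_1 rho : 0 < rho -> 1 < exp rho.
Proof. intro H. rewrite <- exp_0. now apply exp_increasing. Qed.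

Lemma Psi_spec rho th : 0 < rho -> ~ K (Psi rho th) /\ phi (Psi rho th) = polar (exp rho) th.
Proof.
  intro H. unfold Psi.
  apply (epsilon_spec (inhabits (RtoC 0)) (fun z => ~ K z /\ phi z = polar (exp rho) th)).
  destruct Hphi as [_ [_ [_ [Hs _]]]]. apply Hs. rewrite Cmod_polar. now apply exp_gt_1.
  left; apply exp_pos.
Qed.

Lemma Psi_out rho th : 0 < rho -> ~ K (Psi rho th).
Proof. intro H; now apply Psi_spec. Qed.

Lemma phi_Psi rho th : 0 < rho -> phi (Psi rho th) = polar (exp rho) th.
Proof. intro H; now apply Psi_spec. Qed.

Lemma phi_gt_1 z : ~ K z -> 1 < Cmod (phi z).
Proof. destruct Hphi as [_ [_ [H _]]]. apply H. Qed.

Lemma Psi_uniq z rho th : ~ K z -> phi z = polar (exp rho) th -> z = Psi rho th.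
Proof.
  intros Hz E.
  assert (P : 0 < rho).
  { generalize (phi_gt_1 z Hz). rewrite E, Cmod_polar by (left; apply exp_pos). intro H.
    apply exp_lt_inv. now rewrite exp_0. }
  destruct Hphi as [_ [Hi _]]. apply Hi; auto. now apply Psi_out. now rewrite phi_Psi.
Qed.

Lemma Psi_surj z : ~ K z -> exists th, z = Psi (ln (Cmod (phi z))) th /\ 0 < ln (Cmod (phi z)).
Proof.
  intro Hz. assert (H1 := phi_gt_1 z Hz).
  destruct (polar_surj (phi z)) as [a Ha]. { apply Cmod_gt_0. lra. }
  exists a. split.
  - apply Psi_uniq; auto. now rewrite exp_ln by lra.
  - apply ln_pos; lra.
Qed.

Lemma Psi_eqmod1 rho th th' : eqmod1 th th' -> Psi rho th = Psi rho th'.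
Proof. intro H. unfold Psi. now rewrite (polar_eqmod1 _ _ _ H). Qed.

Lemma Psi_inj rho th rho' th' : 0 < rho -> 0 < rho' ->
  Psi rho th = Psi rho' th' -> rho = rho' /\ eqmod1 th th'.
Proof.
  intros H H' E. assert (P : polar (exp rho) th = polar (exp rho') th').
  { rewrite <- !phi_Psi by auto. now rewrite E. }
  apply polar_inj in P; try apply exp_pos. destruct P as [P1 P2]. split; auto. now apply exp_inv.
Qed.

Lemma Psi_cubic rho th : 0 < rho -> f (Psi rho th) = Psi (3 * rho) (3 * th).
Proof.
  intro H. apply Psi_uniq.
  - rewrite <- filled_julia_cubic. now apply Psi_out.
  - destruct Hphi as [_ [_ [_ [_ [Hf _]]]]]. rewrite Hf by (now apply Psi_out).
    rewrite phi_Psi by auto. rewrite polar_cube. f_equal.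
    replace (3 * rho) with (rho + (rho + rho)) by ring. rewrite !exp_plus. ring.
Qed.

Lemma Psi_iterate n rho th : 0 < rho -> iterate f n (Psi rho th) = Psi (3 ^ n * rho) (3 ^ n * th).
Proof.
  intro H. induction n as [|n IH].
  - simpl. unfold iterate; simpl. f_equal; ring.
  - rewrite iterate_S, IH, Psi_cubic. simpl; f_equal; ring.
    apply Rmult_lt_0_compat; auto. apply pow_lt; lra.
Qed.

Lemma phi_cont z : ~ K z -> forall eps, 0 < eps -> exists del, 0 < del /\
  forall w, Cmod (w - z) < del -> ~ K w /\ Cmod (phi w - phi z) < eps.
Proof.
  intros Hz eps He. destruct (filled_julia_compl_open z Hz) as [d0 [Hd0 Hop]].
  destruct Hphi as [Hh _]. destruct (Hh z Hz) as [l Hl]. destruct (Hl 1 Rlt_0_1) as [d1 [Hd1 K1]].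
  set (Lp := Cmod l + 1). assert (PL : 0 < Lp) by (unfold Lp; generalize (Cmod_ge_0 l); lra).
  exists (Rmin d0 (Rmin d1 (eps / Lp))). split.
  { repeat apply Rmin_pos; auto. now apply Rdiv_lt_0_compat. }
  intros w Hw.
  assert (W0 : Cmod (w - z) < d0) by (eapply Rlt_min_l, Hw).
  assert (W' := Rlt_min_r _ _ _ Hw).
  assert (W1 := Rlt_min_l _ _ _ W'). assert (W2 := Rlt_min_r _ _ _ W').
  assert (Kw := Hop w W0). split; auto.
  destruct (Req_dec (Cmod (w - z)) 0) as [E|N].
  - apply Cdist_eq0 in E. subst w. rewrite Cdist_refl. auto.
  - assert (P : 0 < Cmod (w - z)) by (generalize (Cmod_ge_0 (w - z)%C); lra).
    specialize (K1 w Kw (conj P W1)).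
    assert (NZ : (w - z)%C <> RtoC 0) by (now apply Cmod_gt_0).
    assert (Q : Cmod (Cdiv (phi w - phi z)%C (w - z)%C) < Lp).
    { generalize (Cmod_diff_le (Cdiv (phi w - phi z)%C (w - z)%C) l). intro Y.
      apply Rabs_le_between in Y. unfold Lp. lra. }
    rewrite Cmod_div in Q by auto.
    apply (Rmult_lt_compat_r _ _ _ P) in Q. unfold Rdiv in Q. rewrite Rmult_assoc, Rinv_l, Rmult_1_r in Q by lra.
    eapply Rlt_trans; [apply Q|]. apply (Rmult_lt_compat_l Lp) in W2; auto.
    replace (Lp * (eps / Lp)) with eps in W2 by (field; lra). auto.
Qed.

Lemma phi_near_infinity : exists M, 1 <= M /\ forall z, M < Cmod z ->
  Cmod z / 2 <= Cmod (phi z) <= 2 * Cmod z.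
Proof.
  destruct Hphi as [_ [_ [_ [_ [_ H]]]]]. destruct (H (1/2) ltac:(lra)) as [M HM].
  exists (Rmax 1 M). split. apply Rmax_l. intros z Hz.
  assert (M < Cmod z) by (eapply Rle_lt_trans; [apply Rmax_r|apply Hz]).
  assert (1 < Cmod z) by (eapply Rle_lt_trans; [apply Rmax_l|apply Hz]).
  specialize (HM z H0). assert (NZ : z <> RtoC 0) by (apply Cmod_gt_0; lra).
  generalize (Cmod_diff_le (Cdiv (phi z) z) (RtoC 1)). intro Y. apply Rabs_le_between in Y.
  rewrite Cmod_1, Cmod_div in Y by auto.
  assert (E : Cmod (phi z) = Cmod (phi z) / Cmod z * Cmod z) by (field; lra).
  rewrite E. set (q := Cmod (phi z) / Cmod z) in *. nra.
Qed.

Lemma Psi_bounded r : exists B, forall rho th, 0 < rho <= r -> Cmod (Psi rho th) <= B.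
Proof.
  destruct phi_near_infinity as [M [HM1 HM]]. exists (Rmax M (2 * exp r)).
  intros rho th Hr. apply Rnot_lt_le. intro H.
  assert (H1 := Rle_lt_trans _ _ _ (Rmax_l _ _) H). assert (H2 := Rle_lt_trans _ _ _ (Rmax_r _ _) H).
  specialize (HM _ H1). rewrite phi_Psi, Cmod_polar in HM by (try (left; apply exp_pos); lra).
  assert (exp rho <= exp r).
  { destruct (Req_dec rho r) as [->|N]. lra. left; apply exp_increasing; lra. }
  lra.
Qed.

Lemma phi_iterate_mod n z : ~ K z -> Cmod (phi (iterate f n z)) = Cmod (phi z) ^ (3 ^ n).
Proof.
  intro Hz. induction n as [|n IH].
  - simpl. unfold iterate; simpl. ring.
  - rewrite iterate_S. destruct Hphi as [_ [_ [_ [_ [Hf _]]]]]. rewrite Hf.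
    + rewrite Cmod_pow, IH, <- pow_mult. f_equal. simpl. lia.
    + now rewrite <- filled_julia_iterate.
Qed.

(** The first iterate to leave the disc of radius [B1] is the image of a point of that disc, hence
    bounded by [C1]; there |phi| is at most twice the modulus, and |phi| does not decrease under
    iteration. *)
Lemma phi_bounded B : exists C0, 1 < C0 /\ forall z, ~ K z -> Cmod z <= B -> Cmod (phi z) <= C0.
Proof.
  destruct phi_near_infinity as [M [HM1 HM]].
  set (B1 := Rmax B M). assert (HB1 : M <= B1) by apply Rmax_r.
  set (C1 := Cmod lam * B1 + Cmod b * B1 ^ 2 + B1 ^ 3).
  assert (HC1 : 0 <= C1).
  { unfold C1. generalize (Cmod_ge_0 lam) (Cmod_ge_0 b). intros.
    assert (0 <= B1) by lra. assert (0 <= B1 ^ 2) by (apply pow_le; auto). assert (0 <= B1 ^ 3) by (apply pow_le; auto).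
    assert (0 <= Cmod lam * B1) by (now apply Rmult_le_pos). assert (0 <= Cmod b * B1 ^ 2) by (now apply Rmult_le_pos). lra. }
  exists (2 * C1 + 2). split; [lra|]. intros z Hz Hzb.
  assert (E : exists n, B1 < Cmod (iterate f n z)).
  { apply NNPP. intro N. apply Hz. exists B1. intro n. apply Rnot_lt_le. intro. apply N. exists n; auto. }
  destruct (least_nat _ E) as [n [Hn Hmin]].
  destruct n as [|n].
  { unfold iterate in Hn; simpl in Hn. generalize (Rmax_l B M). fold B1. lra. }
  assert (Hle : Cmod (iterate f n z) <= B1).
  { apply Rnot_lt_le. intro H. specialize (Hmin n H). lia. }
  assert (HN : Cmod (iterate f (S n) z) <= C1) by (rewrite iterate_S; apply cubic_bound; auto; lra).
  assert (HP := HM (iterate f (S n) z) ltac:(lra)).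
  rewrite phi_iterate_mod in HP by auto.
  assert (H1 := phi_gt_1 z Hz).
  assert (Cmod (phi z) <= Cmod (phi z) ^ (3 ^ S n)).
  { rewrite <- (pow_1 (Cmod (phi z))) at 1. apply Rle_pow. lra.
    generalize (Nat.pow_nonzero 3 (S n)). lia. }
  lra.
Qed.

(** Near [kappa] the first [m] iterates stay in a bounded set, where |phi| <= C0; so the power |phi
    z|^(3^m) is bounded, which forces |phi z| below [R1] once [m] is large. *)
Lemma phi_near_K kappa R1 : K kappa -> 1 < R1 -> exists del, 0 < del /\
  forall z, ~ K z -> Cmod (z - kappa) < del -> Cmod (phi z) < R1.
Proof.
  intros Hk HR. destruct filled_julia_bounded as [R0 [_ HR0]].
  destruct (phi_bounded (R0 + 1)) as [C0 [HC0 HB]].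
  destruct (pow_unbounded R1 1 (C0 + 1) HR Rlt_0_1) as [m Hm].
  assert (Hm3 : (m <= 3 ^ m)%nat) by (apply Nat.lt_le_incl, Nat.pow_gt_lin_r; lia).
  specialize (Hm (3 ^ m)%nat Hm3). rewrite Rmult_1_r in Hm.
  destruct (iterate_cont m kappa 1 Rlt_0_1) as [d [Hd X]].
  exists d; split; auto. intros z Hz Hzk. specialize (X z Hzk).
  assert (Y := HR0 _ (proj1 (filled_julia_iterate m kappa) Hk)).
  assert (Zb : Cmod (iterate f m z) <= R0 + 1).
  { generalize (Cmod_diff_le (iterate f m z) (iterate f m kappa)). intro D. apply Rabs_le_between in D. lra. }
  apply HB in Zb. 2: now rewrite <- filled_julia_iterate.
  rewrite phi_iterate_mod in Zb by auto.
  apply Rnot_le_lt. intro H.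
  assert (R1 ^ (3 ^ m) <= Cmod (phi z) ^ (3 ^ m)) by (apply pow_incr; lra). lra.
Qed.

(** If continuity fails, the values along converging coordinates have a cluster point. It is not in
    [K] by [phi_near_K], and continuity and injectivity of [phi] then identify it with
    [Psi rho th]. *)
Lemma Psi_cont rho th : 0 < rho -> forall eps, 0 < eps -> exists del, 0 < del /\
  forall rho' th', Rabs (rho' - rho) < del -> Rabs (th' - th) < del ->
    Cmod (Psi rho' th' - Psi rho th) < eps.
Proof.
  intros Hr eps He. apply NNPP. intro N.
  assert (E : forall n : nat, exists p : R * R, Rabs (fst p - rho) < Rmin (rho / 2) (/ (INR n + 1)) /\
     Rabs (snd p - th) < / (INR n + 1) /\ eps <= Cmod (Psi (fst p) (snd p) - Psi rho th)).
  { intro n. apply NNPP. intro N'. apply N.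
    generalize (inv_INR_pos n). intro.
    exists (Rmin (rho / 2) (/ (INR n + 1))). split. apply Rmin_pos; lra.
    intros r t Hr' Ht'. apply Rnot_le_lt. intro H'. apply N'. exists (r, t). simpl. split; [|split]; auto.
    eapply Rlt_min_r, Ht'. }
  apply functional_choice in E. destruct E as [u Hu].
  assert (Up : forall n, 0 < fst (u n) <= 2 * rho).
  { intro n. destruct (Hu n) as [A _]. assert (A' := Rlt_min_l _ _ _ A).
    apply Rabs_def2 in A'. lra. }
  destruct (Psi_bounded (2 * rho)) as [B HB].
  destruct (cluster_C (fun n => Psi (fst (u n)) (snd (u n))) B) as [l Hl].
  { intro n. apply HB, Up. }
  assert (P1 := exp_gt_1 rho Hr).
  assert (Hexp : forall e, 0 < e -> exists d, 0 < d /\ forall r t, Rabs (r - rho) < d -> Rabs (t - th) < d ->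
     Cmod (polar (exp r) t - polar (exp rho) th) < e).
  { intros e Hee. destruct (polar_cont (exp rho) th e Hee) as [d [Hd X]].
    assert (ce : continuity_pt exp rho) by (apply derivable_continuous_pt, derivable_pt_exp).
    destruct (ce d Hd) as [d' [Hd' Y]]. exists (Rmin d d'). split. now apply Rmin_pos.
    intros r t H1 H2. apply X.
    - destruct (Req_dec r rho) as [->|Nr]. rewrite Rminus_diag, Rabs_R0; auto.
      apply (Y r). split. split; [exact I|auto]. eapply Rlt_min_r, H1.
    - eapply Rlt_min_l, H2. }
  assert (Hu' : forall d, 0 < d -> exists n0, forall n, (n0 <= n)%nat -> Rabs (fst (u n) - rho) < d /\ Rabs (snd (u n) - th) < d).
  { intros d Hd. destruct (inv_INR_small d Hd) as [n0 Hn0]. exists n0. intros n Hn. specialize (Hn0 n Hn).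
    destruct (Hu n) as [A1 [A2 _]]. assert (A1' := Rlt_min_r _ _ _ A1). lra. }
  assert (Kl : ~ K l).
  { intro Kl. set (R1 := (1 + exp rho) / 2).
    destruct (phi_near_K l R1 Kl ltac:(unfold R1; lra)) as [d [Hd X]].
    destruct (Hexp ((exp rho - 1) / 2) ltac:(lra)) as [d1 [Hd1 X1]].
    destruct (Hu' d1 Hd1) as [n0 Hn0].
    destruct (Hl d n0 Hd) as [n [Hn Hn']]. destruct (Hn0 n Hn) as [Y1 Y2].
    specialize (X1 _ _ Y1 Y2). specialize (X _ (Psi_out _ _ (proj1 (Up n))) Hn').
    rewrite phi_Psi in X by apply Up.
    generalize (Cmod_diff_le (polar (exp (fst (u n))) (snd (u n))) (polar (exp rho) th)). intro D.
    apply Rabs_le_between in D. rewrite (Cmod_polar (exp rho)) in D by lra. unfold R1 in X. lra. }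
  assert (El : phi l = polar (exp rho) th).
  { apply eq_limC. intros e Hee.
    destruct (phi_cont l Kl (e / 2) ltac:(lra)) as [d [Hd X]].
    destruct (Hexp (e / 2) ltac:(lra)) as [d1 [Hd1 X1]].
    destruct (Hu' d1 Hd1) as [n0 Hn0].
    destruct (Hl d n0 Hd) as [n [Hn Hn']]. destruct (Hn0 n Hn) as [Y1 Y2].
    specialize (X1 _ _ Y1 Y2). destruct (X _ Hn') as [_ X2]. rewrite phi_Psi in X2 by apply Up.
    rewrite Cdist_sym in X2.
    generalize (Cdist_tri (polar (exp (fst (u n))) (snd (u n))) (phi l) (polar (exp rho) th)). lra. }
  apply Psi_uniq in El; auto.
  destruct (Hl eps 0%nat He) as [n [_ Hn]]. destruct (Hu n) as [_ [_ X]]. rewrite <- El in X. lra.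
Qed.

Lemma Psi_near_K eps : 0 < eps -> exists rho0, 0 < rho0 /\ forall rho th, 0 < rho <= rho0 ->
  exists kappa, K kappa /\ Cmod (Psi rho th - kappa) < eps.
Proof.
  intro He. apply NNPP. intro N.
  assert (E : forall n : nat, exists p : R * R, 0 < fst p <= / (INR n + 1) /\
     forall kappa, K kappa -> eps <= Cmod (Psi (fst p) (snd p) - kappa)).
  { intro n. apply NNPP. intro N'. apply N.
    generalize (inv_INR_pos n). intro.
    exists (/ (INR n + 1)). split; auto.
    intros r t Hr'. apply NNPP. intro H'. apply N'. exists (r, t). simpl. split; auto.
    intros kappa Hk. apply Rnot_lt_le. intro. apply H'. exists kappa; auto. }
  apply functional_choice in E. destruct E as [u Hu].
  assert (Up : forall n, 0 < fst (u n) <= 1).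
  { intro n. destruct (Hu n) as [A _]. split. apply A. eapply Rle_trans; [apply A|].
    rewrite <- Rinv_1 at 2. apply Rinv_le_contravar. lra. generalize (pos_INR n); lra. }
  destruct (Psi_bounded 1) as [B HB].
  destruct (cluster_C (fun n => Psi (fst (u n)) (snd (u n))) B) as [l Hl].
  { intro n. apply HB, Up. }
  destruct (classic (K l)) as [Kl|Kl].
  - destruct (Hl eps 0%nat He) as [n [_ Hn]]. destruct (Hu n) as [_ X]. specialize (X l Kl). lra.
  - assert (P1 := phi_gt_1 l Kl). set (c := (Cmod (phi l) - 1) / 2).
    assert (Hc : 0 < c) by (unfold c; lra).
    destruct (phi_cont l Kl c Hc) as [d [Hd X]].
    assert (P2 : 0 < ln (1 + c)) by (apply ln_pos; lra).
    destruct (inv_INR_small _ P2) as [n0 Hn0].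
    destruct (Hl d n0 Hd) as [n [Hn Hn']]. specialize (Hn0 n Hn). destruct (X _ Hn') as [_ X2].
    rewrite phi_Psi in X2 by apply Up.
    generalize (Cmod_diff_le (polar (exp (fst (u n))) (snd (u n))) (phi l)). intro D.
    apply Rabs_le_between in D. rewrite Cmod_polar in D by (left; apply exp_pos).
    assert (exp (fst (u n)) < 1 + c).
    { rewrite <- (exp_ln (1 + c)) by lra. apply exp_increasing. destruct (Hu n) as [A _]. lra. }
    unfold c in *. lra.
Qed.

Lemma Psi_open rho0 th0 : 0 < rho0 -> forall eta, 0 < eta -> exists sig, 0 < sig /\
  forall z, Cmod (z - Psi rho0 th0) < sig -> exists rho th, 0 < rho /\
    Rabs (rho - rho0) < eta /\ Rabs (th - th0) < eta /\ z = Psi rho th.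
Proof.
  intros Hr eta Heta. set (y := Psi rho0 th0). assert (Ky : ~ K y) by (now apply Psi_out).
  apply NNPP. intro N.
  assert (E : forall n : nat, exists z, Cmod (z - y) < / (INR n + 1) /\
     forall rho th, 0 < rho -> Rabs (rho - rho0) < eta -> Rabs (th - th0) < eta -> z <> Psi rho th).
  { intro n. apply NNPP. intro N'. apply N. exists (/ (INR n + 1)). split.
    apply inv_INR_pos.
    intros z Hz. apply NNPP. intro N''. apply N'. exists z. split; auto. intros r t H1 H2 H3 H4.
    apply N''. exists r, t. auto. }
  apply functional_choice in E. destruct E as [u Hu].
  (* Angles are normalized to a window of length one centred at [th0], so a limit angle congruent to
     [th0] equals [th0]. Points in [K] receive the default angle [th0]. *)
  assert (V : forall n, exists t, th0 - / 2 <= t < th0 + / 2 /\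
     (~ K (u n) -> u n = Psi (ln (Cmod (phi (u n)))) t)).
  { intro n. destruct (classic (K (u n))) as [k|k].
    - exists th0. split. lra. tauto.
    - destruct (Psi_surj _ k) as [t [Ht _]]. destruct (eqmod1_norm (th0 - / 2) t) as [t' [H1 H2]].
      exists t'. split. lra. intros _. rewrite <- (Psi_eqmod1 _ _ _ H1). auto. }
  apply functional_choice in V. destruct V as [v Hv].
  destruct (cluster_R v (Rabs th0 + 1)) as [t Ht].
  { intro n. destruct (Hv n) as [A _]. generalize (Rabs_triang_inv (v n) th0).
    assert (Rabs (v n - th0) <= / 2) by (apply Rabs_le; lra). lra. }
  assert (Bt : Rabs (t - th0) <= / 2).
  { apply le_epsilon. intros e He. destruct (Ht e 0%nat He) as [n [_ Hn]]. destruct (Hv n) as [A _].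
    rewrite Rabs_minus_sym in Hn.
    replace (t - th0) with ((t - v n) + (v n - th0)) by ring.
    eapply Rle_trans; [apply Rabs_triang|].
    assert (Rabs (v n - th0) <= / 2) by (apply Rabs_le; lra). lra. }
  assert (Py : phi y = polar (exp rho0) th0) by (now apply phi_Psi).
  assert (Pe := exp_pos rho0).
  assert (Rad : forall e, 0 < e -> exists n0, forall n, (n0 <= n)%nat -> ~ K (u n) /\
     Cmod (phi (u n) - phi y) < e).
  { intros e He. destruct (phi_cont y Ky e He) as [d [Hd X]]. destruct (inv_INR_small d Hd) as [n0 Hn0].
    exists n0. intros n Hn. apply X. eapply Rlt_trans; [apply Hu|auto]. }
  assert (Eq : polar (exp rho0) t = polar (exp rho0) th0).
  { apply eq_limC. intros e He.
    destruct (polar_cont (exp rho0) t (e / 2) ltac:(lra)) as [d [Hd X]].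
    destruct (Rad (Rmin d (e / 2)) ltac:(apply Rmin_pos; lra)) as [n0 Hn0].
    destruct (Ht d n0 Hd) as [n [Hn Hn']]. destruct (Hn0 n Hn) as [Y1 Y2].
    assert (Y3 := Rlt_min_l _ _ _ Y2). assert (Y4 := Rlt_min_r _ _ _ Y2).
    assert (Z : phi (u n) = polar (Cmod (phi (u n))) (v n)).
    { destruct (Hv n) as [_ Q]. specialize (Q Y1). assert (G := phi_gt_1 _ Y1).
      rewrite Q at 1. rewrite phi_Psi. now rewrite exp_ln by lra.
      apply ln_pos; lra. }
    specialize (X (Cmod (phi (u n))) (v n)). rewrite <- Z in X.
    assert (Cmod (phi (u n) - polar (exp rho0) t) < e / 2).
    { apply X; auto. rewrite <- (Cmod_polar (exp rho0) th0) by lra. rewrite <- Py.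
      eapply Rle_lt_trans; [apply Cmod_diff_le|auto]. }
    rewrite <- Py. generalize (Cdist_tri (phi (u n)) (polar (exp rho0) t) (phi y)).
    rewrite (Cdist_sym (polar (exp rho0) t) (phi (u n))). lra. }
  apply polar_inj in Eq; auto. destruct Eq as [_ Eq]. assert (Et : t = th0) by (apply eqmod1_small; [exact Eq|lra]). subst t.
  assert (cl : continuity_pt ln (exp rho0)) by (now apply continuity_pt_ln).
  destruct (cl eta Heta) as [d [Hd X]].
  destruct (Rad d Hd) as [n0 Hn0]. destruct (Ht eta n0 Heta) as [n [Hn Hn']].
  destruct (Hn0 n Hn) as [Y1 Y2]. destruct (Hu n) as [_ Hbad]. destruct (Hv n) as [_ Q].
  assert (G := phi_gt_1 _ Y1).
  apply (Hbad (ln (Cmod (phi (u n)))) (v n)); auto.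
  - apply ln_pos; lra.
  - rewrite <- (ln_exp rho0). destruct (Req_dec (Cmod (phi (u n))) (exp rho0)) as [->|Nr].
    rewrite Rminus_diag, Rabs_R0; auto.
    apply (X (Cmod (phi (u n)))). split. split; [exact I|auto].
    simpl. unfold R_dist. rewrite <- (Cmod_polar (exp rho0) th0) by lra. rewrite <- Py.
    eapply Rle_lt_trans; [apply Cmod_diff_le|auto].
Qed.

Lemma Psi_open_unif r1 r2 eta : 0 < r1 -> 0 < eta -> exists sig, 0 < sig /\
  forall rho0 th0, r1 <= rho0 <= r2 -> forall z, Cmod (z - Psi rho0 th0) < sig ->
    exists rho th, 0 < rho /\
    Rabs (rho - rho0) < eta /\ Rabs (th - th0) < eta /\ z = Psi rho th.
Proof.
  intros Hr1 Heta.
  apply (box_unif r1 r2 (fun rho0 th0 d => forall z, Cmod (z - Psi rho0 th0) < d ->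
    exists rho th, 0 < rho /\
    Rabs (rho - rho0) < eta /\ Rabs (th - th0) < eta /\ z = Psi rho th)).
  - intros rho th d d' Hd H z Hz. apply H. lra.
  - intros rho th k d H z Hz. rewrite (Psi_eqmod1 _ _ _ (eqmod1_shift k th)) in Hz.
    destruct (H z Hz) as [r [t [H1 [H2 [H3 H4]]]]]. exists r, (t + IZR k). split; [|split; [|split]]; auto.
    + replace (t + IZR k - (th + IZR k)) with (t - th) by ring. auto.
    + rewrite H4. apply Psi_eqmod1, eqmod1_sym, eqmod1_shift.
  - intros rr tt Hrr.
    destruct (Psi_open rr tt ltac:(lra) (eta / 2) ltac:(lra)) as [sig [Hsig X]].
    destruct (Psi_cont rr tt ltac:(lra) (sig / 2) ltac:(lra)) as [d [Hd Y]].
    exists (Rmin (Rmin d (eta / 2)) (sig / 2)). split. repeat apply Rmin_pos; lra.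
    generalize (Rmin_l (Rmin d (eta / 2)) (sig / 2)) (Rmin_r (Rmin d (eta / 2)) (sig / 2))
      (Rmin_l d (eta / 2)) (Rmin_r d (eta / 2)). intros.
    specialize (Y rho' th' ltac:(lra) ltac:(lra)).
    destruct (X z) as [rho [th [G1 [G2 [G3 G4]]]]].
    { generalize (Cdist_tri (Psi rho' th') z (Psi rr tt)). lra. }
    assert (Rabs (rho' - rr) < eta / 2) by lra. assert (Rabs (th' - tt) < eta / 2) by lra.
    apply Rabs_def2 in G2. apply Rabs_def2 in G3. apply Rabs_def2 in H6. apply Rabs_def2 in H7.
    exists rho, th. repeat split; auto; apply Rabs_def1; lra.
Qed.

Lemma Psi_unif_cont r1 r2 eps : 0 < r1 -> 0 < eps -> exists del, 0 < del /\
  forall rho th, r1 <= rho <= r2 -> forall rho' th', Rabs (rho' - rho) < del -> Rabs (th' - th) < del ->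
    Cmod (Psi rho' th' - Psi rho th) < eps.
Proof.
  intros Hr1 Heps.
  apply (box_unif r1 r2 (fun rho th d => forall rho' th', Rabs (rho' - rho) < d -> Rabs (th' - th) < d ->
    Cmod (Psi rho' th' - Psi rho th) < eps)).
  - intros rho th d d' Hd H r t H1 H2. apply H; lra.
  - intros rho th k d H r t H1 H2. rewrite (Psi_eqmod1 _ _ _ (eqmod1_shift k th)).
    rewrite <- (Psi_eqmod1 _ _ _ (eqmod1_shift (- k) t)). apply H; auto. rewrite opp_IZR.
    replace (t + - IZR k - th) with (t - (th + IZR k)) by ring. auto.
  - intros rr tt Hrr.
    destruct (Psi_cont rr tt ltac:(lra) (eps / 2) ltac:(lra)) as [d [Hd Y]].
    exists (d / 2). split; [lra|]. intros r t Hr Ht r' t' Hr' Ht'.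
    assert (Y1 := Y r t ltac:(lra) ltac:(lra)).
    assert (Y2 : Cmod (Psi r' t' - Psi rr tt) < eps / 2).
    { apply Rabs_def2 in Hr. apply Rabs_def2 in Ht. apply Rabs_def2 in Hr'. apply Rabs_def2 in Ht'.
      apply Y; apply Rabs_def1; lra. }
    generalize (Cdist_tri (Psi rr tt) (Psi r' t') (Psi r t)). rewrite (Cdist_sym (Psi rr tt) (Psi r t)). lra.
Qed.

(** A critical point [z] outside [K] would count twice as a preimage of [f z]; the angles shifted by
    1/3 and 2/3 give two further preimages, one too many for a cubic. *)
Lemma cubic'_nonzero z : ~ K z -> cubic' lam b z <> RtoC 0.
Proof.
  intros Hz E. destruct (Psi_surj z Hz) as [t [Ht Hr]]. set (r := ln (Cmod (phi z))) in *.
  set (z1 := Psi r (t + 1 / 3)). set (z2 := Psi r (t + 2 / 3)).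
  assert (D : forall x y, Rabs (x - y) < 1 -> x <> y -> Psi r x <> Psi r y).
  { intros x y Hd Hn H. apply Psi_inj in H; auto. destruct H as [_ H]. apply Hn. now apply eqmod1_small. }
  assert (D1 : z <> z1). { rewrite Ht. apply D. rewrite Rabs_left; lra. lra. }
  assert (D2 : z <> z2). { rewrite Ht. apply D. rewrite Rabs_left; lra. lra. }
  assert (D3 : z1 <> z2). { apply D. rewrite Rabs_left; lra. lra. }
  assert (F1 : f z = f z1).
  { rewrite Ht. unfold z1. rewrite !Psi_cubic by auto. apply Psi_eqmod1. exists (-1)%Z. simpl. lra. }
  assert (F2 : f z = f z2).
  { rewrite Ht. unfold z2. rewrite !Psi_cubic by auto. apply Psi_eqmod1. exists (-2)%Z. simpl. lra. }
  rewrite !cubic_eq in F1, F2. rewrite cubic'_eq in E.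
  assert (X : forall w, z <> w -> (lam * z + b * (z * z) + z * (z * z))%C =
     (lam * w + b * (w * w) + w * (w * w))%C ->
     (b + (RtoC 2 * z + w))%C = RtoC 0).
  { intros w Hw H.
    assert (G : ((w - z) * (w - z) * (b + (RtoC 2 * z + w)))%C = RtoC 0).
    { replace ((w - z) * (w - z) * (b + (RtoC 2 * z + w)))%C with
      (lam * w + b * (w * w) + w * (w * w) - (lam * z + b * (z * z) + z * (z * z)) - (w - z) * (lam + RtoC 2 * (b * z) + RtoC 3 * (z * z)))%C.
      rewrite H, E. ring. replace (RtoC 3) with (RtoC 2 + RtoC 1)%C by (rewrite <- RtoC_plus; f_equal; ring).
      replace (RtoC 2) with (RtoC 1 + RtoC 1)%C by (rewrite <- RtoC_plus; f_equal; ring). ring. }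
    assert (Nw : (w - z)%C <> RtoC 0). { intro W. apply Hw. symmetry. now apply Cminus_eq0. }
    destruct (Cmult_eq0 _ _ G) as [G'|G']; auto. destruct (Cmult_eq0 _ _ G'); tauto. }
  assert (X1 := X z1 D1 F1). assert (X2 := X z2 D2 F2). apply D3.
  replace z1 with (b + (RtoC 2 * z + z1) - (b + RtoC 2 * z))%C by ring.
  rewrite X1, <- X2. ring.
Qed.

Lemma iterate_derivatives n : exists q q1 q2 q3, (forall z, q z = iterate f n z) /\
  der q q1 /\ der q1 q2 /\ der q2 q3 /\ forall z, ~ K z -> q1 z <> RtoC 0.
Proof.
  assert (E : exists q1, Pol q1 /\ der (iterate f n) q1 /\ forall z, ~ K z -> q1 z <> RtoC 0).
  { induction n as [|n [q1 [H1 [H2 H3]]]].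
    - exists (fun _ => RtoC 1). split. constructor. split. apply der_id. intros z _ H. injection H. lra.
    - exists (fun z => (cubic' lam b (iterate f n z) * q1 z)%C). split; [|split].
      + destruct (Pol_iterate n) as [q [Q1 Q2]].
        destruct (Pol_der q Q1) as [q' [Q3 Q4]].
        assert (T : Pol (fun z => ((lam + RtoC 2 * (b * q z) + RtoC 3 * (q z * q z)) * q1 z)%C))
          by (repeat constructor; auto).
        match goal with |- Pol ?p => match type of T with Pol ?p' => replace p with p'; auto end end.
        apply FunctionalExtensionality.functional_extensionality. intro z. now rewrite Q2, cubic'_eq.
      + apply (der_cubic_comp _ _ H2).
      + intros z Hz H. destruct (Cmult_eq0 _ _ H) as [H'|H'].
        * revert H'. apply cubic'_nonzero. now rewrite <- filled_julia_iterate.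
        * now apply (H3 z). }
  destruct E as [q1 [H1 [H2 H3]]]. destruct (Pol_der q1 H1) as [q2 [H4 H5]]. destruct (Pol_der q2 H4) as [q3 [H6 H7]].
  exists (iterate f n), q1, q2, q3. auto.
Qed.

(** * Landing of rays *)

(** In external coordinates an inverse branch of the [n]-th iterate divides by [3 ^ n]. The discs
    carrying it have a radius [s] uniform over the range of potentials, so the Harnack bound holds
    with constants that do not depend on [n]. *)
Lemma shrink_disc r1 r2 : 0 < r1 -> exists eta M, 0 < eta /\ 0 < M /\
  forall n rho th rho' th' kappa, r1 <= rho <= r2 -> Rabs (rho' - rho) < eta ->
    Rabs (th' - th) < eta -> K kappa ->
    exp (-11) * (ln M - ln (Cmod (Psi (rho / 3 ^ n) (th / 3 ^ n) - kappa))) <=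
      ln M - ln (Cmod (Psi (rho' / 3 ^ n) (th' / 3 ^ n) - kappa)).
Proof.
  (* [r1 / 2] keeps potentials positive; 1/4 singles out one angle among its integer translates. *)
  intro Hr1. set (eta1 := Rmin (r1 / 2) (1 / 4)).
  assert (He1 : 0 < eta1) by (apply Rmin_pos; lra).
  assert (He1' : eta1 <= r1 / 2 /\ eta1 <= 1 / 4) by (split; [apply Rmin_l|apply Rmin_r]).
  destruct (Psi_open_unif r1 r2 eta1 Hr1 He1) as [sig [Hsig Op]].
  set (s := sig / 2). assert (Hs : 0 < s) by (unfold s; lra).
  destruct (Psi_unif_cont r1 r2 (s / 2) Hr1 ltac:(lra)) as [eta2 [He2 Uc]].
  destruct (Psi_bounded (r2 + 1)) as [B HB].
  destruct filled_julia_bounded as [R0 [HR0 HR]].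
  exists (Rmin eta1 eta2), (Rabs B + R0 + 1). split; [now apply Rmin_pos|].
  assert (HB0 := Rabs_pos B). split; [lra|].
  intros n rho th rho' th' kappa Hr Hr' Ht' Hk.
  assert (Hr'1 := Rlt_min_l _ _ _ Hr'). assert (Hr'2 := Rlt_min_r _ _ _ Hr').
  assert (Ht'1 := Rlt_min_l _ _ _ Ht'). assert (Ht'2 := Rlt_min_r _ _ _ Ht').
  set (y := Psi rho th).
  assert (Ch : forall z, exists p : R * R, Cmod (z - y) <= s -> 0 < fst p /\
     Rabs (fst p - rho) < eta1 /\ Rabs (snd p - th) < eta1 /\ z = Psi (fst p) (snd p)).
  { intro z. destruct (Rle_dec (Cmod (z - y)) s) as [H|H].
    - destruct (Op rho th Hr z) as [r [t X]]. unfold y, s in H. lra. exists (r, t). auto.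
    - exists (0, 0). tauto. }
  apply functional_choice in Ch. destruct Ch as [c Hc].
  set (F := fun z => Psi (fst (c z) / 3 ^ n) (snd (c z) / 3 ^ n)).
  assert (P3 := pow3_pos n).
  assert (uniq : forall z r t, Cmod (z - y) <= s -> 0 < r -> Rabs (t - th) < 1 / 2 -> z = Psi r t -> c z = (r, t)).
  { intros z r t Hz Hr0 Ht E. destruct (Hc z Hz) as [H1 [H2 [H3 H4]]]. rewrite E in H4 at 1.
    apply Psi_inj in H4; auto. destruct H4 as [H4 H5].
    apply eqmod1_small in H5. rewrite H4, H5. now destruct (c z).
    apply Rabs_def2 in H3. apply Rabs_def2 in Ht. apply Rabs_def1; lra. }
  assert (FE : forall z r t, Cmod (z - y) <= s -> 0 < r -> Rabs (t - th) < 1 / 2 -> z = Psi r t ->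
    F z = Psi (r / 3 ^ n) (t / 3 ^ n)).
  { intros z r t H1 H2 H3 H4. unfold F. now rewrite (uniq z r t). }
  assert (pos3 : forall r, 0 < r -> 0 < r / 3 ^ n) by (intros r H; now apply Rdiv_lt_0_compat).
  assert (out : forall z, Cmod (z - y) <= s -> ~ K (F z)).
  { intros z Hz. apply Psi_out. apply pos3. now apply Hc. }
  assert (back : forall r t, 0 < r -> iterate f n (Psi (r / 3 ^ n) (t / 3 ^ n)) = Psi r t).
  { intros r t H. rewrite Psi_iterate by auto. f_equal; field; lra. }
  destruct (iterate_derivatives n) as [q [q1 [q2 [q3 [Q0 [Q1 [Q2 [Q3 Q4]]]]]]]].
  assert (H := inverse_branch_harnack q q1 q2 q3 F y kappa s (Rabs B + R0 + 1) Q1 Q2 Q3 Hs).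
  assert (y0 : Cmod (y - y) <= s) by (rewrite Cdist_refl; lra).
  assert (HFy : F y = Psi (rho / 3 ^ n) (th / 3 ^ n)).
  { apply FE; auto. lra. rewrite Rminus_diag, Rabs_R0; lra. }
  assert (Hz : Cmod (Psi rho' th' - y) <= s / 2) by (left; apply Uc; auto).
  assert (HFz : F (Psi rho' th') = Psi (rho' / 3 ^ n) (th' / 3 ^ n)).
  { apply FE; auto. lra. apply Rabs_def2 in Hr'1. lra. lra. }
  rewrite <- HFy, <- HFz. apply H; auto; clear H.
  (* The values of [F] are bounded by [B] and [K] by [R0], so every |F z - kappa| is less than the
     chosen [M]. *)
  - intros z Hz0. destruct (Hc z Hz0) as [H1 [H2 [H3 H4]]]. split; [|split; [|split]].
    + rewrite Q0. unfold F. rewrite back by auto. auto.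
    + apply Q4. now apply out.
    + intro E. apply (out z Hz0). now rewrite E.
    + generalize (Cmod_triangle (F z) (- kappa)%C). rewrite Cmod_opp. intro T.
      assert (Cmod (F z) <= B).
      { apply HB. split; [now apply pos3|]. eapply Rle_trans; [apply div_pow3_le; lra|].
        apply Rabs_def2 in H2. lra. }
      specialize (HR kappa Hk). generalize (Rle_abs B). unfold Cminus. lra.
  - intros z Hz0 eps Heps. destruct (Hc z Hz0) as [H1 [H2 [H3 H4]]].
    destruct (Psi_cont (fst (c z) / 3 ^ n) (snd (c z) / 3 ^ n) (pos3 _ H1) eps Heps) as [del [Hdel X]].
    destruct (Psi_open (fst (c z)) (snd (c z)) H1 (Rmin del (1 / 4)) ltac:(apply Rmin_pos; lra)) as [sg [Hsg Y]].
    exists sg. split; auto. intros w Hw Hwz. rewrite H4 in Hwz.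
    destruct (Y w Hwz) as [r [t [Z1 [Z2 [Z3 Z4]]]]].
    generalize (Rmin_l del (1 / 4)) (Rmin_r del (1 / 4)). intros m1 m2.
    rewrite (FE w r t); auto.
    + assert (Sc : forall u v, Rabs (u - v) < del -> Rabs (u / 3 ^ n - v / 3 ^ n) < del).
      { intros u v Huv. replace (u / 3 ^ n - v / 3 ^ n) with ((u - v) / 3 ^ n) by (field; lra).
        unfold Rdiv. rewrite Rabs_mult, (Rabs_right (/ 3 ^ n)) by (left; now apply Rinv_0_lt_compat).
        eapply Rle_lt_trans; [apply div_pow3_le; apply Rabs_pos|exact Huv]. }
      apply X; apply Sc; lra.
    + apply Rabs_def2 in H3. assert (Z3' : Rabs (t - snd (c z)) < 1 / 4) by lra. apply Rabs_def2 in Z3'.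
      apply Rabs_def1; lra.
  - intros z Hz0. assert (Hz1 : Cmod (z - y) <= s) by lra. destruct (Hc z Hz1) as [H1 [H2 [H3 H4]]].
    destruct (Psi_open (fst (c z) / 3 ^ n) (snd (c z) / 3 ^ n) (pos3 _ H1) (/ 4 / 3 ^ n)
      ltac:(apply Rdiv_lt_0_compat; lra)) as [sg [Hsg Y]].
    destruct (iterate_cont n (F z) (s - Cmod (z - y)) ltac:(lra)) as [d [Hd X]].
    exists (Rmin sg d). split; [now apply Rmin_pos|]. intros w Hw.
    destruct (Y w (Rlt_min_l _ _ _ Hw)) as [r [t [Z1 [Z2 [Z3 Z4]]]]].
    specialize (X w (Rlt_min_r _ _ _ Hw)). rewrite <- Q0 in X.
    assert (EF : iterate f n (F z) = z) by (unfold F; rewrite back; auto). rewrite EF in X.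
    assert (Hqw : Cmod (q w - y) < s).
    { generalize (Cdist_tri z (q w) y). lra. }
    split; auto. rewrite (FE (q w) (3 ^ n * r) (3 ^ n * t)).
    + rewrite Z4. f_equal; field; lra.
    + lra.
    + now apply Rmult_lt_0_compat.
    + assert (Rabs (3 ^ n * t - snd (c z)) < / 4).
      { replace (3 ^ n * t - snd (c z)) with (3 ^ n * (t - snd (c z) / 3 ^ n)) by (field; lra).
        rewrite Rabs_mult, (Rabs_right (3 ^ n)) by lra.
        apply (Rmult_lt_compat_l (3 ^ n)) in Z3; auto.
        replace (3 ^ n * (/ 4 / 3 ^ n)) with (/ 4) in Z3 by (field; lra). auto. }
      apply Rabs_def2 in H. apply Rabs_def2 in H3. apply Rabs_def1; lra.
    + rewrite Q0, Z4. now rewrite Psi_iterate.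
Qed.

(** One of the two points is extremely close to some [kappa] in [K]; the Harnack bound for this
    [kappa] then keeps the other close to [kappa] as well. *)
Lemma shrink_local r1 r2 : 0 < r1 <= r2 -> exists eta, 0 < eta /\ forall eps, 0 < eps -> exists N, forall n, (N <= n)%nat ->
  forall rho th rho' th', r1 <= rho <= r2 -> r1 <= rho' -> Rabs (rho' - rho) < eta -> Rabs (th' - th) < eta ->
    Cmod (Psi (rho' / 3 ^ n) (th' / 3 ^ n) - Psi (rho / 3 ^ n) (th / 3 ^ n)) < eps.
Proof.
  intros [Hr1 Hr12]. destruct (shrink_disc r1 r2 Hr1) as [eta [M [He [HM H]]]]. exists eta. split; auto.
  (* If |z - kappa| < e1, then ln M - ln |z - kappa| exceeds exp 11 * T. The factor exp (-11) leaves
     more than [T] for [w], that is |w - kappa| < eps / 2. *)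
  intros eps Heps. set (T := Rabs (ln M - ln (eps / 2))).
  set (e1 := Rmin (eps / 2) (M * exp (- (exp 11 * T)))).
  assert (He1 : 0 < e1) by (apply Rmin_pos; [lra|]; apply Rmult_lt_0_compat; auto; apply exp_pos).
  destruct (Psi_near_K e1 He1) as [rho0 [Hrho0 X]].
  destruct (div_pow3_small r2 rho0 ltac:(lra) Hrho0) as [N HN].
  exists N. intros n Hn rho th rho' th' Hr Hrl Hr' Ht'. specialize (HN n Hn).
  assert (P3 := pow3_pos n).
  assert (Hsm : 0 < rho / 3 ^ n <= rho0).
  { split. apply Rdiv_lt_0_compat; lra. apply Rle_trans with (r2 / 3 ^ n); [|lra].
    apply Rmult_le_compat_r; [left; now apply Rinv_0_lt_compat|lra]. }
  destruct (X (rho / 3 ^ n) (th / 3 ^ n) Hsm) as [kappa [Hk Hd]].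
  specialize (H n rho th rho' th' kappa Hr Hr' Ht' Hk).
  set (z := Psi (rho / 3 ^ n) (th / 3 ^ n)) in *. set (w := Psi (rho' / 3 ^ n) (th' / 3 ^ n)) in *.
  assert (Nz : 0 < Cmod (z - kappa)).
  { apply Cdist_pos. intro E. apply (Psi_out (rho / 3 ^ n) (th / 3 ^ n)). lra. fold z. now rewrite E. }
  assert (Nw : 0 < Cmod (w - kappa)).
  { apply Cdist_pos. intro E. apply (Psi_out (rho' / 3 ^ n) (th' / 3 ^ n)).
    apply Rdiv_lt_0_compat; auto; lra. fold w. now rewrite E. }
  assert (L1 : ln (Cmod (z - kappa)) < ln M - exp 11 * T).
  { assert (Y := Rlt_min_r _ _ _ Hd). apply ln_increasing in Y; auto.
    rewrite ln_mult, ln_exp in Y by (auto; apply exp_pos). lra. }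
  assert (L2 : exp (-11) * (exp 11 * T) < exp (-11) * (ln M - ln (Cmod (z - kappa)))).
  { apply Rmult_lt_compat_l. apply exp_pos. lra. }
  rewrite <- Rmult_assoc, <- exp_plus in L2. replace (-11 + 11) with 0 in L2 by ring.
  rewrite exp_0, Rmult_1_l in L2. generalize (Rle_abs (ln M - ln (eps / 2))). fold T. intro L3.
  assert (L4 : ln (Cmod (w - kappa)) < ln (eps / 2)) by lra.
  apply ln_lt_inv in L4; auto; [|lra].
  assert (L5 := Rlt_min_l _ _ _ Hd).
  generalize (Cdist_tri kappa w z). rewrite (Cdist_sym kappa z). lra.
Qed.

Lemma shrink_box r1 r2 A eps : 0 < r1 <= r2 -> 0 <= A -> 0 < eps -> exists N, forall n, (N <= n)%nat ->
  forall rho th rho' th', r1 <= rho <= r2 -> r1 <= rho' <= r2 -> Rabs (th' - th) <= A ->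
    Cmod (Psi (rho' / 3 ^ n) (th' / 3 ^ n) - Psi (rho / 3 ^ n) (th / 3 ^ n)) < eps.
Proof.
  intros Hr HA Heps. destruct (shrink_local r1 r2 Hr) as [eta [He H]].
  (* [m] equal steps along the straight segment of coordinates are each shorter than [eta]; [m]
     depends only on the box. *)
  destruct (INR_archimed eta (r2 - r1 + A + 1) He) as [m Hm].
  assert (Pm : 0 < INR m).
  { destruct m; [simpl in Hm; lra|]. apply lt_0_INR. lia. }
  destruct (H (eps / INR m) ltac:(now apply Rdiv_lt_0_compat)) as [N HN].
  exists N. intros n Hn rho th rho' th' Hrho Hrho' Ht.
  set (rr := fun i : nat => rho + INR i / INR m * (rho' - rho)).
  set (tt := fun i : nat => th + INR i / INR m * (th' - th)).
  assert (St : forall i, (i <= m)%nat -> Cmod (Psi (rr i / 3 ^ n) (tt i / 3 ^ n) - Psi (rho / 3 ^ n) (th / 3 ^ n))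
    <= INR i * (eps / INR m) /\ ((0 < i)%nat -> Cmod (Psi (rr i / 3 ^ n) (tt i / 3 ^ n) - Psi (rho / 3 ^ n) (th / 3 ^ n))
    < INR i * (eps / INR m))).
  { induction i as [|i IH]; intro Hi.
    - split; [|lia]. unfold rr, tt. simpl. unfold Rdiv at 2 4. rewrite !Rmult_0_l, !Rplus_0_r. 
      rewrite Cdist_refl. lra.
    - destruct (IH ltac:(lia)) as [IH1 _].
      assert (Rng : forall j, (j <= m)%nat -> r1 <= rr j <= r2).
      { intros j Hj. apply le_INR in Hj. unfold rr.
        assert (0 <= INR j / INR m <= 1).
        { split. apply Rmult_le_pos. apply pos_INR. left; now apply Rinv_0_lt_compat.
          apply Rle_div_l; [lra|]. lra. }
        split; nra. }
      assert (S1 : Cmod (Psi (rr (S i) / 3 ^ n) (tt (S i) / 3 ^ n) - Psi (rr i / 3 ^ n) (tt i / 3 ^ n)) < eps / INR m).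
      { apply HN; auto. apply Rng; lia. apply Rng; lia.
        - unfold rr. replace (rho + INR (S i) / INR m * (rho' - rho) - (rho + INR i / INR m * (rho' - rho))) with
            ((rho' - rho) / INR m) by (rewrite S_INR; field; lra).
          unfold Rdiv. rewrite Rabs_mult, Rabs_inv, (Rabs_right (INR m)) by lra.
          apply Rmult_lt_reg_r with (INR m); auto. rewrite Rmult_assoc, Rinv_l by lra.
          assert (Rabs (rho' - rho) <= r2 - r1) by (apply Rabs_le; lra). lra.
        - unfold tt. replace (th + INR (S i) / INR m * (th' - th) - (th + INR i / INR m * (th' - th))) with
            ((th' - th) / INR m) by (rewrite S_INR; field; lra).
          unfold Rdiv. rewrite Rabs_mult, Rabs_inv, (Rabs_right (INR m)) by lra.
          apply Rmult_lt_reg_r with (INR m); auto. rewrite Rmult_assoc, Rinv_l by lra. lra. }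
      generalize (Cdist_tri (Psi (rr i / 3 ^ n) (tt i / 3 ^ n)) (Psi (rr (S i) / 3 ^ n) (tt (S i) / 3 ^ n)) (Psi (rho / 3 ^ n) (th / 3 ^ n))).
      rewrite S_INR. intro. split; [|intros _]; lra. }
  destruct (St m (le_n m)) as [_ S2].
  assert (Hm0 : (0 < m)%nat) by (apply INR_lt; simpl; lra). specialize (S2 Hm0).
  replace (INR m * (eps / INR m)) with eps in S2 by (field; lra).
  replace (rr m) with rho' in S2 by (unfold rr; field; lra). replace (tt m) with th' in S2 by (unfold tt; field; lra).
  exact S2.
Qed.

(* Points at bounded hyperbolic distance in the complement of [K] become close as they
   approach [K]. *)
Lemma Psi_shrink A eps : 1 <= A -> 0 < eps -> exists rho0, 0 < rho0 /\
  forall rho th rho' th', 0 < rho <= rho0 -> rho / A <= rho' <= A * rho -> Rabs (th' - th) <= A * rho ->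
    Cmod (Psi rho' th' - Psi rho th) < eps.
Proof.
  intros HA Heps.
  (* Multiplying by the power of 3 that brings [rho] into [1, 3) puts the other potential into
     [1/A, 3A] and the angles at distance at most 3A. *)
  destruct (shrink_box (/ A) (3 * A) (3 * A) eps) as [N HN]; auto; try lra.
  { split. apply Rinv_0_lt_compat; lra. apply Rle_trans with 1; [|lra]. rewrite <- Rinv_1.
    apply Rinv_le_contravar; lra. }
  exists (/ 3 ^ N). assert (P3 := pow3_pos N). split; [now apply Rinv_0_lt_compat|].
  intros rho th rho' th' [H0 H1] H2 H3.
  assert (Hle1 : rho <= 1).
  { eapply Rle_trans; [apply H1|]. rewrite <- Rinv_1. apply Rinv_le_contravar. lra. apply pow3_ge1. }
  destruct (pow3_normalize 1 rho ltac:(lra)) as [n [Hn1 Hn2]].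
  assert (Pn := pow3_pos n).
  assert (Hn : (N <= n)%nat).
  { apply Nat.nlt_ge. intro Hlt.
    assert (3 ^ n * rho <= / 3).
    { apply Rle_trans with (3 ^ n * / 3 ^ N). apply Rmult_le_compat_l; lra.
      replace N with (N - S n + S n)%nat by lia. rewrite pow_add. simpl.
      assert (1 <= 3 ^ (N - S n)) by apply pow3_ge1.
      replace (3 ^ n * / (3 ^ (N - S n) * (3 * 3 ^ n))) with (/ 3 * / 3 ^ (N - S n)) by (field; lra).
      assert (/ 3 ^ (N - S n) <= 1). { rewrite <- Rinv_1. apply Rinv_le_contravar; lra. } lra. }
    lra. }
  specialize (HN n Hn (3 ^ n * rho) (3 ^ n * th) (3 ^ n * rho') (3 ^ n * th')).
  replace (3 ^ n * rho / 3 ^ n) with rho in HN by (field; lra).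
  replace (3 ^ n * th / 3 ^ n) with th in HN by (field; lra).
  replace (3 ^ n * rho' / 3 ^ n) with rho' in HN by (field; lra).
  replace (3 ^ n * th' / 3 ^ n) with th' in HN by (field; lra).
  apply HN.
  - split. apply Rle_trans with 1; [|lra]. rewrite <- Rinv_1. apply Rinv_le_contravar; lra. nra.
  - split.
    + apply Rle_trans with (3 ^ n * (rho / A)).
      * unfold Rdiv. rewrite <- Rmult_assoc. rewrite <- (Rmult_1_l (/ A)) at 1.
        apply Rmult_le_compat_r; auto. left; apply Rinv_0_lt_compat; lra.
      * apply Rmult_le_compat_l; lra.
    + apply Rle_trans with (3 ^ n * (A * rho)). apply Rmult_le_compat_l; lra. nra.
  - rewrite <- Rmult_minus_distr_l, Rabs_mult, Rabs_right by lra.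
    apply Rle_trans with (3 ^ n * (A * rho)). apply Rmult_le_compat_l; lra. nra.
Qed.

Definition Lands (alpha : R) (z : C) : Prop :=
  forall eps, 0 < eps -> exists rho0, 0 < rho0 /\
    forall rho, 0 < rho < rho0 -> Cmod (Psi rho alpha - z) < eps.

Lemma ray_lands_Lands alpha z : ray_lands lam b phi alpha z <-> Lands alpha z.
Proof.
  split; intros H eps He; destruct (H eps He) as [d [Hd X]].
  - exists (ln (1 + d)). split. { apply ln_pos; lra. }
    intros rho Hr. apply (X (exp rho)).
    + split. apply exp_gt_1; lra. rewrite <- (exp_ln (1 + d)) by lra. apply exp_increasing; lra.
    + apply Psi_out; lra.
    + apply phi_Psi; lra.
  - exists (exp d - 1). split. { generalize (exp_gt_1 d Hd). lra. }
    intros r w Hr Hw Ew.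
    assert (E : w = Psi (ln r) alpha).
    { apply Psi_uniq; auto. now rewrite exp_ln by lra. }
    rewrite E. apply X. split. apply ln_pos; lra.
    rewrite <- (ln_exp d). apply ln_increasing; lra.
Qed.

Lemma Lands_eqmod1 alpha alpha' z : eqmod1 alpha alpha' -> Lands alpha z -> Lands alpha' z.
Proof.
  intros E H eps He. destruct (H eps He) as [d [Hd X]]. exists d; split; auto. intros rho Hr.
  rewrite <- (Psi_eqmod1 rho _ _ E). auto.
Qed.

Lemma Lands_cubic alpha z : Lands alpha z -> Lands (3 * alpha) (f z).
Proof.
  intros H eps He. destruct (cubic_cont z eps He) as [e [He' Y]].
  destruct (H e He') as [d [Hd X]]. exists (3 * d). split; [lra|]. intros rho Hr.
  specialize (X (rho / 3) ltac:(lra)). apply Y in X.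
  rewrite Psi_cubic in X by lra. replace (3 * (rho / 3)) with rho in X by field. auto.
Qed.

Lemma Lands_iterate n alpha z : Lands alpha z -> Lands (3 ^ n * alpha) (iterate f n z).
Proof.
  intro H. induction n as [|n IH].
  - simpl. rewrite Rmult_1_l. exact H.
  - simpl. rewrite Rmult_assoc. now apply Lands_cubic.
Qed.

(** All limit points of the ray are among the finitely many roots of [p]. By [Psi_shrink] a step
    from [rho] to at least [rho / 3] is too short to pass from one root to another, so a single root
    attracts the whole ray. *)
Lemma lands_at_root (p : C -> C) alpha : Pol p -> (exists z, p z <> RtoC 0) ->
  (forall eps, 0 < eps -> exists rho0, 0 < rho0 /\ forall rho, 0 < rho < rho0 -> Cmod (p (Psi rho alpha)) < eps) ->
  exists z, p z = RtoC 0 /\ Lands alpha z.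
Proof.
  intros Hp Hnz Hlim. destruct (Pol_finite_roots p Hp Hnz) as [roots Hroots].
  assert (Near : forall eps, 0 < eps -> exists rho0, 0 < rho0 /\ forall rho, 0 < rho <= rho0 ->
    exists a, In a roots /\ Cmod (Psi rho alpha - a) < eps).
  { intros eps He. apply NNPP. intro N.
    assert (E : forall n : nat, exists rho, 0 < rho <= / (INR n + 1) /\
      forall a, In a roots -> eps <= Cmod (Psi rho alpha - a)).
    { intro n. apply NNPP. intro N'. apply N. exists (/ (INR n + 1)). split.
      apply inv_INR_pos.
      intros rho Hr. apply NNPP. intro N''. apply N'. exists rho. split; auto.
      intros a Ha. apply Rnot_lt_le. intro. apply N''. exists a; auto. }
    apply functional_choice in E. destruct E as [u Hu].
    destruct (Psi_bounded 1) as [B HB].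
    destruct (cluster_C (fun n => Psi (u n) alpha) B) as [l Hl].
    { intro n. destruct (Hu n) as [A _]. apply HB. split. apply A. eapply Rle_trans; [apply A|].
      rewrite <- Rinv_1 at 2. apply Rinv_le_contravar. lra. generalize (pos_INR n); lra. }
    assert (Rl : p l = RtoC 0).
    { apply eq_limC. intros e Hee.
      destruct (Pol_cont p l Hp (e / 2) ltac:(lra)) as [d [Hd X]].
      destruct (Hlim (e / 2) ltac:(lra)) as [r0 [Hr0 Y]].
      destruct (inv_INR_small r0 Hr0) as [n0 Hn0].
      destruct (Hl d n0 Hd) as [n [Hn Hn']]. specialize (Hn0 n Hn). destruct (Hu n) as [A _].
      specialize (Y (u n) ltac:(lra)). specialize (X _ Hn'). rewrite Cdist_sym in X.
      replace (p l - RtoC 0)%C with (p l - p (Psi (u n) alpha) + p (Psi (u n) alpha))%C by ring.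
      eapply Rle_trans; [apply Cmod_triangle|]. lra. }
    apply Hroots in Rl. destruct (Hl eps 0%nat He) as [n [_ Hn]]. destruct (Hu n) as [_ X].
    specialize (X l Rl). lra. }
  destruct (list_separated roots) as [d [Hd Hsep]].
  set (e := d / 3). assert (He : 0 < e) by (unfold e; lra).
  destruct (Near e He) as [r1 [Hr1 N1]].
  destruct (Psi_shrink 3 e ltac:(lra) He) as [r2 [Hr2 Sh]].
  set (r := Rmin r1 r2). assert (Hr : 0 < r /\ r <= r1 /\ r <= r2).
  { unfold r. split; [now apply Rmin_pos|]. split; [apply Rmin_l|apply Rmin_r]. }
  destruct (N1 r ltac:(lra)) as [a [Ha Hra]].
  assert (Step : forall rho rho', 0 < rho' <= rho -> rho <= r -> rho <= 3 * rho' ->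
    Cmod (Psi rho alpha - a) < e -> Cmod (Psi rho' alpha - a) < e).
  { intros rho rho' H1 H2 H3 H4. destruct (N1 rho' ltac:(lra)) as [a' [Ha' Hra']].
    assert (a = a').
    { apply Hsep; auto.
      assert (Hs := Sh rho alpha rho' alpha ltac:(lra) ltac:(lra)).
      rewrite Rminus_diag, Rabs_R0 in Hs. specialize (Hs ltac:(lra)).
      generalize (Cdist_tri (Psi rho alpha) a a') (Cdist_tri (Psi rho' alpha) (Psi rho alpha) a').
      rewrite (Cdist_sym a (Psi rho alpha)), (Cdist_sym (Psi rho alpha) (Psi rho' alpha)). unfold e in *. lra. }
    now subst a'. }
  assert (Near_a : forall n rho, r <= 3 ^ n * rho -> 0 < rho <= r -> Cmod (Psi rho alpha - a) < e).
  { induction n as [|n IH]; intros rho H1 H2; simpl in H1.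
    - replace rho with r by lra. auto.
    - destruct (Rle_dec r (3 * rho)).
      + apply Step with r; auto; lra.
      + apply Step with (3 * rho); try lra. apply IH; lra. }
  assert (All : forall rho, 0 < rho <= r -> Cmod (Psi rho alpha - a) < e).
  { intros rho Hrho. destruct (pow_unbounded 3 rho r) as [n Hn]; try lra. apply (Near_a n); auto. }
  exists a. split. now apply Hroots.
  intros eps Heps. destruct (Near (Rmin eps e) ltac:(now apply Rmin_pos)) as [r0 [Hr0 N0]].
  exists (Rmin r0 r). split. apply Rmin_pos; lra. intros rho Hrho.
  assert (Hm : rho < r0 /\ rho < r) by (revert Hrho; rmin).
  generalize (Rmin_l eps e) (Rmin_r eps e). intros.
  destruct (N0 rho ltac:(lra)) as [a' [Ha' Hra']].
  assert (a = a').
  { apply Hsep; auto. specialize (All rho ltac:(lra)).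
    generalize (Cdist_tri (Psi rho alpha) a a'). rewrite (Cdist_sym a (Psi rho alpha)). unfold e in *. lra. }
  subst a'. lra.
Qed.

(** The [n]-th iterate moves a point of this ray along the same ray, multiplying its potential by
    [3 ^ n], so its displacement tends to 0 by [Psi_shrink]; the ray lands at a root of the
    polynomial expressing this displacement. *)
Lemma lands_periodic n t : (1 <= n)%nat -> eqmod1 (3 ^ n * t) t -> exists z, Lands t z.
Proof.
  intros Hn Ht. destruct (Pol_iterate n) as [q [Q1 Q2]].
  destruct (lands_at_root (fun z => (q z + RtoC (-1) * z)%C) t) as [z [_ Hz]].
  - repeat constructor; auto.
  - exists (Psi 1 t). rewrite Q2, Psi_iterate by lra. intro E.
    assert (E' : Psi (3 ^ n * 1) (3 ^ n * t) = Psi 1 t).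
    { apply Cminus_eq0. rewrite <- E. ring. }
    apply Psi_inj in E'; try lra. destruct E' as [E' _].
    assert (1 < 3 ^ n) by (apply Rlt_pow_R1; [lra|lia]). lra.
    apply Rmult_lt_0_compat; [apply pow3_pos|lra].
  - intros eps He. assert (A : 1 <= 3 ^ n) by apply pow3_ge1.
    destruct (Psi_shrink (3 ^ n) eps A He) as [r0 [Hr0 Sh]].
    exists r0. split; auto. intros rho Hrho.
    rewrite Q2, Psi_iterate by lra.
    specialize (Sh rho t (3 ^ n * rho) t ltac:(lra)). rewrite Rminus_diag, Rabs_R0 in Sh.
    rewrite (Psi_eqmod1 _ _ _ Ht).
    replace (Psi (3 ^ n * rho) t + RtoC (-1) * Psi rho t)%C with
      (Psi (3 ^ n * rho) t - Psi rho t)%C by ring.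
    apply Sh. split; [|lra]. apply Rle_trans with rho. apply div_pow3_le; lra. nra.
    apply Rmult_le_pos; lra.
  - exists z. auto.
Qed.

Lemma lands_pullback alpha w : Lands (3 * alpha) w -> exists z, f z = w /\ Lands alpha z.
Proof.
  intro H. destruct (Pol_iterate 1) as [q [Q1 Q2]].
  destruct (lands_at_root (fun z => (q z + - w)%C) alpha) as [z [Ez Hz]].
  - repeat constructor; auto.
  (* The polynomial is not identically 0, because the images of [Psi 1 0] and [Psi 2 0] have
     different potentials. *)
  - destruct (classic (q (Psi 1 0) = w)) as [E1|N].
    + destruct (classic (q (Psi 2 0) = w)) as [E2|N].
      * exfalso. rewrite <- E2, !Q2, !Psi_iterate in E1 by lra.
        apply Psi_inj in E1; simpl; lra.
      * exists (Psi 2 0). intro E. apply N. now apply Cminus_eq0.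
    + exists (Psi 1 0). intro E. apply N. now apply Cminus_eq0.
  - intros eps He. destruct (H eps He) as [d [Hd X]]. exists (d / 3). split; [lra|]. intros rho Hr.
    rewrite Q2. change (iterate f 1 (Psi rho alpha)) with (f (Psi rho alpha)).
    rewrite Psi_cubic by lra. apply X. lra.
  - exists z. split; auto. rewrite Q2 in Ez. now apply Cminus_eq0.
Qed.

(** * The quadratic-like restriction *)

Context (U V : C -> Prop) (HUo : openC U) (HUb : boundedC U) (HUV : compactly_contained U V)
  (HU0 : U (RtoC 0)) (Hprop : proper_degree2 lam b U V).

Notation Kst := (Kstar lam b U).

Lemma U_in_V z : U z -> V z.
Proof.
  intro H. apply HUV. intros e He. exists z. split; auto. rewrite Cdist_refl; auto.
Qed.

(** The preimage in [U] of the closure of [U]: compact because [f : U -> V] is proper, hence at a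
    positive distance from the complement of [U]. *)
Definition core (z : C) : Prop := U z /\ closureC U (f z).

Lemma core_compact : compactC core.
Proof. destruct Hprop as [_ [H _]]. apply H; apply HUV. Qed.

Lemma core_intro z : U z -> U (f z) -> core z.
Proof. intros H H'. split; auto. intros e He. exists (f z). split; auto. rewrite Cdist_refl; auto. Qed.

Lemma core_margin : exists d, 0 < d /\ forall z w, core z -> Cmod (w - z) < d -> U w.
Proof. apply compact_in_open_margin; auto. apply core_compact. intros z [H _]; auto. Qed.

(** The approximating points lie in the compact set [core], so they cannot run to the boundary of
    [U]. This is how membership in [U] survives limits. *)
Lemma U_limit z : (forall eps, 0 < eps -> exists w, U w /\ U (f w) /\ Cmod (w - z) < eps) -> U z.
Proof.
  intro H. assert (Hc : core z).
  { apply compactC_closed. apply core_compact. intros e He. destruct (H e He) as [w [H1 [H2 H3]]].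
    exists w. split; auto. now apply core_intro. }
  apply Hc.
Qed.

(** Along the segment, lying in [U] is an open condition, and a closed one by [U_limit] because the
    image segment lies in [U]. *)
Lemma ray_stays alpha r1 r2 s : 0 < r1 -> r1 <= s <= r2 ->
  (forall rho, r1 <= rho <= r2 -> U (Psi (3 * rho) (3 * alpha))) -> U (Psi s alpha) ->
  forall rho, r1 <= rho <= r2 -> U (Psi rho alpha).
Proof.
  intros Hr1 Hs Hf Hsu rho Hrho.
  set (rr := fun t => s + t * (rho - s)).
  assert (Rg : forall t, 0 <= t <= 1 -> r1 <= rr t <= r2) by (intros t Ht; unfold rr; split; nra).
  assert (Cont : forall t, 0 <= t <= 1 -> forall eps, 0 < eps -> exists eta, 0 < eta /\
     forall u, Rabs (u - t) < eta -> Cmod (Psi (rr u) alpha - Psi (rr t) alpha) < eps).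
  { intros t Ht eps He. specialize (Rg t Ht).
    destruct (Psi_cont (rr t) alpha ltac:(lra) eps He) as [d [Hd X]].
    exists (d / (Rabs (rho - s) + 1)). generalize (Rabs_pos (rho - s)). intro G.
    split. apply Rdiv_lt_0_compat; lra. intros u Hu. apply X; [|rewrite Rminus_diag, Rabs_R0; auto].
    unfold rr. replace (s + u * (rho - s) - (s + t * (rho - s))) with ((u - t) * (rho - s)) by ring.
    rewrite Rabs_mult. apply Rlt_div_r in Hu; [|lra].
    generalize (Rabs_pos (u - t)). nra. }
  assert (E0 : rr 0 = s) by (unfold rr; ring). assert (E1 : rr 1 = rho) by (unfold rr; ring).
  rewrite <- E1. apply (interval_connected (fun t => U (Psi (rr t) alpha))); [|now rewrite E0].
  intros t Ht. destruct (classic (U (Psi (rr t) alpha))) as [Y|Y].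
  - destruct (HUo _ Y) as [e [He Z]]. destruct (Cont t Ht e He) as [eta [Heta W]].
    exists eta. split; auto. intros u Hu Hut. split; auto.
  - apply NNPP. intro N. apply Y. apply U_limit. intros eps He.
    destruct (Cont t Ht eps He) as [eta [Heta W]]. apply NNPP. intro N'. apply N.
    exists eta. split; auto. intros u Hu Hut. split; [|tauto]. intro Uu. elim N'.
    exists (Psi (rr u) alpha). split; auto. split; auto.
    rewrite Psi_cubic. apply Hf; auto. specialize (Rg u Hu). lra.
Qed.

Lemma Kstar_U z : Kst z -> U z.
Proof. intro H. apply (H 0%nat). Qed.

Lemma Kstar_forward z : Kst z -> Kst (f z).
Proof. intros H n. rewrite iterate_comm, <- iterate_S. apply H. Qed.

Lemma Kstar_backward z : U z -> Kst (f z) -> Kst z.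
Proof. intros H H' [|n]. exact H. rewrite iterate_S, <- iterate_comm. apply H'. Qed.

Lemma cubic_0 : f (RtoC 0) = RtoC 0.
Proof. rewrite cubic_eq. ring. Qed.

Lemma Kstar_0 : Kst (RtoC 0).
Proof.
  intro n. replace (iterate f n (RtoC 0)) with (RtoC 0); auto.
  induction n. reflexivity. rewrite iterate_S, <- IHn. symmetry; apply cubic_0.
Qed.

Lemma Kstar_closed z : closureC (Kst) z -> Kst z.
Proof.
  intros H n. apply U_limit. intros eps He.
  destruct (iterate_cont n z eps He) as [d [Hd X]]. destruct (H d Hd) as [w [Kw Hw]].
  exists (iterate f n w). split; [apply Kw|]. split; auto. rewrite <- iterate_S. apply Kw.
Qed.

(** The point is the end of the longest real segment from 0 contained in [K^*]; it is finite since
    [U] is bounded, and belongs to [K^*] since [K^*] is closed. *)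
Lemma Kstar_boundary_point : exists kappa, Kst kappa /\
  forall eps, 0 < eps -> exists z, ~ Kst z /\ Cmod (z - kappa) < eps.
Proof.
  set (T := fun t => 0 <= t /\ forall s, 0 <= s <= t -> Kst (RtoC s)).
  destruct HUb as [M HM].
  destruct (completeness T) as [S [HS1 HS2]].
  { exists M. intros t [H0 H]. specialize (HM _ (Kstar_U _ (H t ltac:(lra)))). rewrite Cmod_R in HM.
    generalize (Rle_abs t). lra. }
  { exists 0. split; [lra|]. intros s Hs. replace s with 0 by lra. apply Kstar_0. }
  assert (S0 : 0 <= S).
  { apply HS1. split; [lra|]. intros s Hs. replace s with 0 by lra. apply Kstar_0. }
  assert (In : forall s, 0 <= s < S -> Kst (RtoC s)).
  { intros s Hs. apply NNPP. intro N. assert (S <= s); [|lra]. apply HS2. intros t [Ht0 Ht].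
    apply Rnot_lt_le. intro Hst. apply N. apply Ht. lra. }
  assert (KS : Kst (RtoC S)).
  { destruct (Req_dec S 0) as [->|N]. apply Kstar_0.
    apply Kstar_closed. intros e He. exists (RtoC (S - Rmin S (e / 2))).
    assert (0 < Rmin S (e / 2)) by (apply Rmin_pos; lra). generalize (Rmin_l S (e / 2)) (Rmin_r S (e / 2)). intros.
    split. apply In. lra. rewrite <- RtoC_minus, Cmod_R, Rabs_left; lra. }
  exists (RtoC S). split; auto. intros eps He. apply NNPP. intro N.
  assert (S + eps / 2 <= S); [|lra]. apply HS1. split; [lra|]. intros s Hs.
  destruct (Rle_dec s S) as [H|H].
  - destruct (Req_dec s S) as [->|Hn]; auto. apply In. lra.
  - apply NNPP. intro H'. apply N. exists (RtoC s). split; auto. rewrite <- RtoC_minus, Cmod_R, Rabs_right; lra.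
Qed.

(* If [U] were contained in [K], the iterates would be equicontinuous near a boundary point of
   [K^*], so that no nearby point could escape from [U]. *)
Lemma U_meets_complement : exists z, U z /\ ~ K z.
Proof.
  apply NNPP. intro N. assert (UK : forall z, U z -> K z).
  { intros z Hz. apply NNPP. intro H. apply N. exists z; auto. }
  destruct Kstar_boundary_point as [kappa [Kk Hk]].
  destruct (HUo kappa (Kstar_U _ Kk)) as [e [He Ball]].
  destruct filled_julia_bounded as [R0 [HR0 HR]].
  set (s := e / 2). assert (Hs : 0 < s) by (unfold s; lra).
  destruct core_margin as [d [Hd Hm]].
  set (M := R0 + 1).
  (* All iterates map the disc into [K], which is bounded by [R0]; the Lipschitz constant is
     therefore the same for every [n]. *)
  assert (Lip : forall n z, Cmod (z - kappa) <= s / 2 ->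
    Cmod (iterate f n z - iterate f n kappa) <= 2 * M / s * Cmod (z - kappa)).
  { intros n z Hz. destruct (iterate_derivatives n) as [q [q1 [q2 [q3 [Q0 [Q1 [Q2 [Q3 _]]]]]]]].
    rewrite <- !Q0. apply (schwarz_pick_lip q q1 q2 q3 kappa s M); auto. unfold M; lra.
    intros w Hw. rewrite Q0. apply Rle_lt_trans with R0; [|unfold M; lra]. apply HR.
    apply filled_julia_iterate. apply UK, Ball. unfold s in Hw. lra. }
  assert (PM : 0 < 2 * M / s) by (apply Rdiv_lt_0_compat; unfold M; lra).
  destruct (Hk (Rmin (s / 2) (d / (2 * M / s)))) as [z [Kz Hz]].
  { apply Rmin_pos. lra. now apply Rdiv_lt_0_compat. }
  apply Kz. intro n. apply (Hm (iterate f n kappa)).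
  - apply core_intro. apply Kk. rewrite <- iterate_S. apply Kk.
  - eapply Rle_lt_trans. apply Lip. left; eapply Rlt_min_l, Hz.
    assert (Y := Rlt_min_r _ _ _ Hz). apply (Rmult_lt_compat_l (2 * M / s)) in Y; auto.
    replace (2 * M / s * (d / (2 * M / s))) with d in Y; auto. field. unfold M. split; lra.
Qed.

Lemma preimage_in_U w : V w -> exists z, U z /\ f z = w.
Proof.
  intro Vw. destruct Hprop as [_ [_ H]]. destruct (H w Vw) as [[|z l] [_ [Hl Hs]]].
  - simpl in Hs. lia.
  - exists z. apply Hl. left; auto.
Qed.

Lemma iterated_preimage_in_U n x : U x -> exists z, U z /\ iterate f n z = x.
Proof.
  intro Hx. induction n as [|n [z [H1 H2]]].
  - exists x. auto.
  - destruct (preimage_in_U z (U_in_V z H1)) as [w [W1 W2]]. exists w. split; auto.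
    rewrite iterate_S, <- iterate_comm, W2. auto.
Qed.

Lemma lands_in_Kstar t z R0 : 0 < R0 -> (forall j rho, 0 < rho <= R0 -> U (Psi rho (3 ^ j * t))) ->
  Lands t z -> Kst z.
Proof.
  intros HR H Hz n. apply U_limit. intros eps He.
  destruct (Lands_iterate n t z Hz eps He) as [d [Hd X]].
  destruct (exists_below d (R0 / 3) Hd ltac:(lra)) as [r Hr].
  exists (Psi r (3 ^ n * t)). split; [apply H; lra|]. split; [|apply X; lra].
  rewrite Psi_cubic by lra. replace (3 * (3 ^ n * t)) with (3 ^ S n * t) by (simpl; ring).
  apply H. lra.
Qed.

(* Pulling back along [f : U -> V] at a fixed small potential gives an infinite backward orbit of
   angles whose ray segments lie in [U]; a close return of this orbit is shadowed by a periodic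
   angle. *)
Lemma exists_periodic_ray : exists t z, periodic_angle t /\ Lands t z /\ Kst z.
Proof.
  destruct U_meets_complement as [x0 [Ux0 Kx0]].
  destruct (Psi_surj x0 Kx0) as [th0 [E0 Hr]]. set (r := ln (Cmod (phi x0))) in *.
  destruct core_margin as [d [Hd Hm]].
  destruct (Psi_shrink 3 d ltac:(lra) Hd) as [rho0 [Hrho0 Sh]].
  destruct (div_pow3_small r rho0 Hr Hrho0) as [N HN].
  assert (P3 := pow3_pos N). set (R0 := r / 3 ^ N). assert (HR0 := HN N (le_n N)). fold R0 in HR0.
  (* A preimage [y] in [U] of a point of [U] at potential [R0] has potential [R0 / 3] and lies in
     [core], and [Psi_shrink] puts the whole box described by [G] within [d] of [y]. In particular
     the point of the new angle at potential [R0] is again in [U], and pulling back continues from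
     there. *)
  set (G := fun th => forall rho x, R0 / 3 <= rho <= R0 -> Rabs (x - th) <= R0 -> U (Psi rho x)).
  assert (Step : forall th, exists th', U (Psi R0 th) -> eqmod1 (3 * th') th /\ G th').
  { intro th. destruct (classic (U (Psi R0 th))) as [H|H]; [|exists 0; tauto].
    destruct (preimage_in_U _ (U_in_V _ H)) as [y [Uy Ey]].
    assert (Ky : ~ K y).
    { rewrite filled_julia_cubic, Ey. apply Psi_out. lra. }
    destruct (Psi_surj y Ky) as [th' [E1 Hr1]]. set (r1 := ln (Cmod (phi y))) in *.
    rewrite E1, Psi_cubic in Ey by auto.
    apply Psi_inj in Ey; try lra. destruct Ey as [Er Et].
    exists th'. intros _. split; auto. intros rho x Hrho Hx.
    apply (Hm y).
    - apply core_intro; auto. rewrite E1, Psi_cubic, Er by auto.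
      rewrite (Psi_eqmod1 _ _ _ Et). auto.
    - rewrite E1. apply Sh; lra. }
  apply functional_choice in Step. destruct Step as [st Hst].
  destruct (iterated_preimage_in_U N x0 Ux0) as [xN [UxN ExN]].
  assert (KxN : ~ K xN). { rewrite (filled_julia_iterate N), ExN. auto. }
  destruct (Psi_surj xN KxN) as [thN [EN HrN]]. set (rN := ln (Cmod (phi xN))) in *.
  assert (ErN : rN = R0).
  { rewrite EN, Psi_iterate, E0 in ExN by auto. apply Psi_inj in ExN; auto.
    unfold R0. destruct ExN as [X _]. rewrite <- X. field; lra.
    now apply Rmult_lt_0_compat. }
  rewrite ErN in EN. rewrite EN in UxN.
  set (th := fun n => Nat.iter n st thN).
  assert (Uth : forall n, U (Psi R0 (th n)) /\ eqmod1 (3 * th (S n)) (th n) /\ G (th (S n))).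
  { induction n as [|n [IH1 [IH2 IH3]]].
    - destruct (Hst thN UxN). auto.
    - assert (H : U (Psi R0 (th (S n)))).
      { apply IH3. lra. rewrite Rminus_diag, Rabs_R0; lra. }
      destruct (Hst _ H). auto. }
  destruct (cluster_R (fun n => frac_part (th (S n))) 1) as [l Hl].
  { intro n. generalize (base_fp (th (S n))). intro. apply Rabs_le. lra. }
  destruct (Hl (R0 / 4) 0%nat ltac:(lra)) as [a [_ Ha]].
  destruct (Hl (R0 / 4) (S a) ltac:(lra)) as [c [Hc Hc']].
  set (A := th (S a)) in *. set (B := th (S c)) in *.
  set (e := frac_part B - frac_part A).
  assert (He : Rabs e <= R0 / 2).
  { unfold e. apply Rabs_def2 in Ha. apply Rabs_def2 in Hc'. apply Rabs_le; lra. }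
  set (k := (c - a)%nat). assert (Hk : (1 <= k)%nat) by (unfold k; lia).
  assert (Back : forall j, (j <= c)%nat -> eqmod1 (3 ^ j * B) (th (S c - j)%nat)).
  { induction j as [|j IH]; intro Hj.
    - simpl. rewrite Rmult_1_l. apply eqmod1_refl.
    - simpl pow. rewrite Rmult_assoc. eapply eqmod1_trans. apply eqmod1_3, IH. lia.
      replace (S c - j)%nat with (S (S c - S j)) by lia. apply Uth. }
  assert (Pk : 3 <= 3 ^ k).
  { rewrite <- (pow_1 3) at 1. apply Rle_pow; [lra|auto]. }
  (* Modulo 1, tripling [k] times sends [B] to [A = B - e], so a correction x making [B + x]
     periodic must satisfy 3^k x = x + e. Since 3^k >= 3, its multiples by 3^j with j < k are at
     most 3/2 |e|, hence within the box size [R0]. *)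
  set (t := B + e / (3 ^ k - 1)).
  assert (Per : eqmod1 (3 ^ k * t) t).
  { assert (X := Back k ltac:(unfold k; lia)). replace (S c - k)%nat with (S a) in X by (unfold k; lia). fold A in X.
    destruct X as [m Hm'].
    exists (m + Int_part A - Int_part B)%Z. rewrite minus_IZR, plus_IZR, <- Hm'.
    unfold t. rewrite Rmult_plus_distr_l.
    replace (3 ^ k * (e / (3 ^ k - 1))) with (e / (3 ^ k - 1) + e) by (field; lra).
    unfold e at 2, frac_part. ring. }
  assert (Orb : forall j, (j < k)%nat -> forall rho, R0 / 3 <= rho <= R0 -> U (Psi rho (3 ^ j * t))).
  { intros j Hj rho Hrho. assert (X := Back j ltac:(unfold k in Hj; lia)).
    assert (GG : G (th (S c - j)%nat)).
    { replace (S c - j)%nat with (S (c - j)) by (unfold k in Hj; lia). apply Uth. }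
    set (g := 3 ^ j * (e / (3 ^ k - 1))).
    assert (Hg : Rabs g <= R0).
    { unfold g. rewrite Rabs_mult. unfold Rdiv. rewrite Rabs_mult, Rabs_inv.
      rewrite (Rabs_right (3 ^ j)) by (left; apply pow3_pos). rewrite (Rabs_right (3 ^ k - 1)) by lra.
      assert (3 ^ j <= 3 ^ k) by (apply Rle_pow; [lra|lia]).
      assert (Q : 3 ^ j * / (3 ^ k - 1) <= 3 / 2).
      { apply Rmult_le_reg_r with (3 ^ k - 1); [lra|]. rewrite Rmult_assoc, Rinv_l by lra. lra. }
      replace (3 ^ j * (Rabs e * / (3 ^ k - 1))) with (3 ^ j * / (3 ^ k - 1) * Rabs e) by ring.
      generalize (Rabs_pos e). nra. }
    replace (3 ^ j * t) with (3 ^ j * B + g) by (unfold t, g; ring).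
    rewrite (Psi_eqmod1 rho _ (th (S c - j)%nat + g)).
    - apply GG; auto. replace (th (S c - j)%nat + g - th (S c - j)%nat) with g by ring. auto.
    - destruct X as [m Hm']. exists m. rewrite <- Hm'. ring. }
  assert (Orb2 : forall j rho, R0 / 3 <= rho <= R0 -> U (Psi rho (3 ^ j * t))).
  { intros j rho Hrho. rewrite (Nat.div_mod_eq j k).
    rewrite (Psi_eqmod1 rho _ (3 ^ (j mod k) * t)).
    - apply Orb; auto. apply Nat.mod_upper_bound. lia.
    - rewrite Nat.add_comm, pow_add, Rmult_assoc. apply eqmod1_pow3. now apply three_periodic_pow. }
  (* The segment of potentials [[R0 / 3, R0]] is a fundamental segment. Below it, the image of a
     segment lies on the ray of the next orbit angle at potentials already treated, so [ray_stays]
     applies. *)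
  assert (Orb3 : forall n j rho, R0 <= 3 ^ n * (3 * rho) -> 0 < rho <= R0 -> U (Psi rho (3 ^ j * t))).
  { induction n as [|n IH]; intros j rho H1 H2; simpl in H1.
    - apply Orb2. lra.
    - destruct (Rle_dec (R0 / 3) rho); [apply Orb2; lra|].
      apply (ray_stays (3 ^ j * t) rho (R0 / 3) (R0 / 3)); try lra.
      + intros rho' Hrho'. replace (3 * (3 ^ j * t)) with (3 ^ S j * t) by (simpl; ring). apply IH; [|lra].
        generalize (pow3_pos n). nra.
      + apply Orb2. lra. }
  destruct (lands_periodic k t Hk Per) as [z Hz].
  exists t, z. split; [|split; auto].
  - exists k. split; auto.
  - apply (lands_in_Kstar t z R0); try lra; auto. intros j rho Hrho.
    destruct (pow_unbounded 3 (3 * rho) R0) as [n Hn]; try lra. apply (Orb3 n); auto.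
Qed.

(** The component is the union of all connected subsets through [z]; a separation of a union of
    connected sets with a common point would separate one of them. *)
Lemma component_exists (S : C -> Prop) z : S z -> exists W, componentC S W /\ W z.
Proof.
  intro Sz. exists (fun x => exists D, connectedC D /\ subsetC D S /\ D z /\ D x).
  assert (Un : forall (D1 : C -> Prop), (forall x, D1 x -> exists D, connectedC D /\ subsetC D D1 /\ D z /\ D x) -> connectedC D1).
  { intros D1 H [O1 [O2 [Op1 [Op2 [Cov [[v1 [B1 o1]] [[v2 [B2 o2]] Dis]]]]]]].
    assert (Q : forall v, D1 v -> ((O1 v /\ O2 z) \/ (O2 v /\ O1 z)) -> False).
    { intros v Dv Hv. destruct (H v Dv) as [D [Dc [Ds [Dz Dv']]]]. apply Dc. exists O1, O2.
      split; auto. split; auto. split. intros x Dx. apply Cov, Ds, Dx.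
      split. destruct Hv as [[]|[]]; eauto. split. destruct Hv as [[]|[]]; eauto.
      intros x Dx. apply Dis, Ds, Dx. }
    destruct (H v1 B1) as [D [Dc [Ds [Dz _]]]]. destruct (Cov z (Ds z Dz)).
    - apply (Q v2 B2); auto.
    - apply (Q v1 B1); auto. }
  assert (Sing : connectedC (fun x => x = z)).
  { intros [O1 [O2 [_ [_ [_ [[v1 [E1 o1]] [[v2 [E2 o2]] Dis]]]]]]]. subst. apply (Dis z); auto. }
  assert (Wz : exists D, connectedC D /\ subsetC D S /\ D z /\ D z).
  { exists (fun x => x = z). split; auto. split; auto. intros x ->; auto. }
  split; auto. split; [|split; [|split]].
  - intros x [D [_ [Ds [_ Dx]]]]. auto.
  - exists z; auto.
  - apply Un. intros x [D [Dc [Ds [Dz Dx]]]]. exists D. split; auto. split; [|auto].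
    intros y Dy. exists D. auto.
  - intros E Es Ec [w [Ew [D [Dc [Ds [Dz Dw]]]]]] x Ex.
    exists (fun y => D y \/ E y). split; [|split; [|auto]].
    + intros [O1 [O2 [Op1 [Op2 [Cov [[v1 [B1 o1]] [[v2 [B2 o2]] Dis]]]]]]].
      assert (QD : forall v, D v -> ((O1 v /\ O2 w) \/ (O2 v /\ O1 w)) -> False).
      { intros v Dv Hv. apply Dc. exists O1, O2. split; auto. split; auto. split; auto.
        split. destruct Hv as [[]|[]]; eauto. split. destruct Hv as [[]|[]]; eauto. intros y Dy; apply Dis; auto. }
      assert (QE : forall v, E v -> ((O1 v /\ O2 w) \/ (O2 v /\ O1 w)) -> False).
      { intros v Dv Hv. apply Ec. exists O1, O2. split; auto. split; auto. split; auto.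
        split. destruct Hv as [[]|[]]; eauto. split. destruct Hv as [[]|[]]; eauto. intros y Dy; apply Dis; auto. }
      destruct (Cov w (or_introl Dw)).
      * destruct B2; [apply (QD v2)|apply (QE v2)]; auto.
      * destruct B1; [apply (QD v1)|apply (QE v1)]; auto.
    + intros y [Dy|Ey]; auto.
Qed.

Lemma cubic_factor p p' : (lam + b * (p + p') + (p * p + p * p' + p' * p'))%C = RtoC 0 ->
  forall z, (f z - f p)%C = ((z - p) * (z - p') * (z + (b + (p + p'))))%C.
Proof.
  intros H z. rewrite !cubic_eq.
  match goal with |- ?x = ?y => replace x with (y + (z - p) * (lam + b * (p + p') + (p * p + p * p' + p' * p')))%C by ring end.
  rewrite H. ring.
Qed.

(* [f : U -> V] has degree 2, so at most one (simple) preimage lies outside [U]. *)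
Lemma U_preimages w : V w -> exists p p' q, U p /\ U p' /\
  forall z, (f z - w)%C = ((z - p) * (z - p') * (z - q))%C.
Proof.
  intro Vw. destruct Hprop as [_ [_ H]]. destruct (H w Vw) as [l [Hnd [Hl Hs]]].
  assert (M1 : forall z, (1 <= cubic_mult lam b z)%nat).
  { intro z. unfold cubic_mult. destruct (Req_EM_T _ _); [destruct (Req_EM_T _ _)|]; lia. }
  assert (Fin : forall p p', U p -> U p' -> f p = w ->
     (lam + b * (p + p') + (p * p + p * p' + p' * p'))%C = RtoC 0 ->
     exists p p' q, U p /\ U p' /\ forall z, (f z - w)%C = ((z - p) * (z - p') * (z - q))%C).
  { intros p p' H1 H2 H3 H4. exists p, p', (- (b + (p + p')))%C. split; auto. split; auto.
    intro z. rewrite <- H3, (cubic_factor p p' H4). ring. }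
  destruct l as [|p [|p' [|p'' l]]].
  - simpl in Hs. lia.
  - simpl in Hs. destruct (proj1 (Hl p) (or_introl eq_refl)) as [Up Ep].
    apply (Fin p p); auto. unfold cubic_mult in Hs. destruct (Req_EM_T _ _) as [Z|Z]; [|lia].
    apply Cmod_eq_0 in Z. rewrite cubic'_eq in Z. rewrite <- Z.
    replace (RtoC 3) with (RtoC 2 + RtoC 1)%C by (rewrite <- RtoC_plus; f_equal; ring).
    replace (RtoC 2) with (RtoC 1 + RtoC 1)%C by (rewrite <- RtoC_plus; f_equal; ring). ring.
  - destruct (proj1 (Hl p) (or_introl eq_refl)) as [Up Ep].
    destruct (proj1 (Hl p') (or_intror (or_introl eq_refl))) as [Up' Ep'].
    apply (Fin p p'); auto.
    assert (Np : p <> p'). { inversion Hnd as [|x l' Hx _]. intro E. apply Hx. left; auto. }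
    assert (E : ((p - p') * (lam + b * (p + p') + (p * p + p * p' + p' * p')))%C = RtoC 0).
    { replace (RtoC 0) with (f p - f p')%C by (rewrite Ep, Ep'; ring). rewrite !cubic_eq. ring. }
    destruct (Cmult_eq0 _ _ E) as [E'|E']; auto. elim Np. now apply Cminus_eq0.
  - simpl in Hs. generalize (M1 p) (M1 p') (M1 p''). lia.
Qed.

(** * Preperiodic angles whose rays land in [K^*] *)

(** Preperiodicity is built in because the assumptions relating landing points to the gap and to its
    major hole concern such angles. *)
Definition KstarAngle (x : R) : Prop := preperiodic_angle x /\ exists z, Lands x z /\ Kst z.

Lemma preperiodic_eqmod1 x y : eqmod1 x y -> preperiodic_angle x -> preperiodic_angle y.
Proof.
  intros E [m [n [Hn H]]]. exists m, n. split; auto. unfold sig3n in *.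
  apply (eqmod1_trans (3 ^ (m + n) * x)). apply eqmod1_sym, eqmod1_pow3, E.
  eapply eqmod1_trans; [apply H|]. now apply eqmod1_pow3.
Qed.

Lemma preperiodic_triple x : preperiodic_angle x <-> preperiodic_angle (3 * x).
Proof.
  split; intros [m [n [Hn H]]]; unfold sig3n in *.
  - exists m, n. split; auto. unfold sig3n. apply eqmod1_3 in H.
    replace (3 ^ (m + n) * (3 * x)) with (3 * (3 ^ (m + n) * x)) by ring.
    replace (3 ^ m * (3 * x)) with (3 * (3 ^ m * x)) by ring. auto.
  - exists (S m), n. split; auto. unfold sig3n. simpl.
    replace (3 * 3 ^ (m + n) * x) with (3 ^ (m + n) * (3 * x)) by ring.
    replace (3 * 3 ^ m * x) with (3 ^ m * (3 * x)) by ring. auto.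
Qed.

Lemma KstarAngle_eqmod1 x y : eqmod1 x y -> KstarAngle x -> KstarAngle y.
Proof.
  intros E [H1 [z [H2 H3]]]. split. now apply (preperiodic_eqmod1 x). exists z. split; auto.
  now apply (Lands_eqmod1 x).
Qed.

Lemma KstarAngle_triple x : KstarAngle x -> KstarAngle (3 * x).
Proof.
  intros [H1 [z [H2 H3]]]. split. now apply (proj1 (preperiodic_triple x)). exists (f z). split.
  now apply Lands_cubic. now apply Kstar_forward.
Qed.

(** The ray of [x] lands at a preimage of a point of [K^*]. If that preimage is outside [U], it lies
    in a component of the preimage of [V] other than [U], and then [x] lies in the closed major hole
    mod 1. *)
Lemma KstarAngle_preimage (a0 b0 : R) :
  (forall W, componentC (fun z => V (f z)) W -> ~ (forall z, W z <-> U z) ->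
     forall beta z, preperiodic_angle beta -> ray_lands lam b phi beta z ->
       W z -> Kst (f z) -> exists t, a0 <= t <= b0 /\ eqmod1 beta t) ->
  forall x, KstarAngle (3 * x) -> (forall t, a0 <= t <= b0 -> ~ eqmod1 x t) -> KstarAngle x.
Proof.
  intros HW x [H1 [w [H2 H3]]] Hx. apply preperiodic_triple in H1.
  destruct (lands_pullback x w H2) as [z [Ez Hz]]. subst w.
  split; auto. exists z. split; auto. apply Kstar_backward; auto.
  apply NNPP. intro N.
  destruct (component_exists (fun z => V (f z)) z) as [W [Wc Wz]].
  { apply U_in_V. now apply Kstar_U. }
  destruct (HW W Wc) with (beta := x) (z := z) as [t [Ht Et]]; auto.
  - intro H. apply N. now apply H.
  - now apply ray_lands_Lands.
  - now apply (Hx t).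
Qed.

(** Applied to all integer translates of [s], this says that at most one of the three preimages
    fails. Two failing rays would both land at the root [q] outside [U], which is simple because the
    other two roots lie in [U]; but [f] is injective near a simple root. *)
Lemma KstarAngle_two_preimages s : KstarAngle s -> KstarAngle (s / 3) \/ KstarAngle ((s - 1) / 3).
Proof.
  intros [H1 [w [H2 H3]]].
  assert (A1 : Lands (3 * (s / 3)) w) by (replace (3 * (s / 3)) with s by field; auto).
  assert (A2 : Lands (3 * ((s - 1) / 3)) w).
  { apply (Lands_eqmod1 s); auto. exists 1%Z. simpl. field. }
  assert (Pp1 : preperiodic_angle (s / 3)).
  { apply preperiodic_triple. replace (3 * (s / 3)) with s by field. auto. }
  assert (Pp2 : preperiodic_angle ((s - 1) / 3)).
  { apply preperiodic_triple. apply (preperiodic_eqmod1 s); auto. exists 1%Z. simpl. field. }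
  destruct (lands_pullback _ _ A1) as [z1 [E1 L1]].
  destruct (lands_pullback _ _ A2) as [z2 [E2 L2]].
  destruct (classic (U z1)) as [U1|N1].
  { left. split; auto. exists z1. split; auto. apply Kstar_backward; auto. now rewrite E1. }
  destruct (classic (U z2)) as [U2|N2].
  { right. split; auto. exists z2. split; auto. apply Kstar_backward; auto. now rewrite E2. }
  exfalso.
  destruct (U_preimages w) as [p [p' [q [Up [Up' Fac]]]]].
  { apply U_in_V. now apply Kstar_U. }
  assert (Eq : forall z, f z = w -> ~ U z -> z = q).
  { intros z Ez Nz. assert (X : ((z - p) * (z - p') * (z - q))%C = RtoC 0).
    { rewrite <- Fac, Ez. ring. }
    destruct (Cmult_eq0 _ _ X) as [Y|Y]; [destruct (Cmult_eq0 _ _ Y) as [Z|Z]|];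
      apply Cminus_eq0 in Y || apply Cminus_eq0 in Z; subst; tauto. }
  assert (Z1 := Eq z1 E1 N1). assert (Z2 := Eq z2 E2 N2). subst z1 z2.
  set (g := fun z => ((z - p) * (z - p'))%C).
  assert (gq : 0 < Cmod (g q)).
  { apply Cmod_gt_0. intro H. destruct (Cmult_eq0 _ _ H) as [Z|Z]; apply Cminus_eq0 in Z; congruence. }
  set (m := Cmod (g q)) in *.
  assert (Pg : Pol (fun z => ((z + - p) * (z + - p'))%C)) by repeat constructor.
  destruct (Pol_cont _ q Pg (m / 2) ltac:(lra)) as [d [Hd Cg]]. cbv beta in Cg.
  set (Cst := 2 * Cmod q + 2 + Cmod p + Cmod p').
  assert (HC : 0 < Cst). { unfold Cst. generalize (Cmod_ge_0 q) (Cmod_ge_0 p) (Cmod_ge_0 p'). lra. }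
  set (e := Rmin (Rmin d 1) (m / 2 / Cst)).
  assert (He : 0 < e /\ e <= d /\ e <= 1 /\ e <= m / 2 / Cst).
  { assert (0 < m / 2 / Cst) by (apply Rdiv_lt_0_compat; lra). unfold e. rmin. }
  destruct (L1 e ltac:(lra)) as [r1 [Hr1 X1]]. destruct (L2 e ltac:(lra)) as [r2 [Hr2 X2]].
  destruct (exists_below r1 r2 Hr1 Hr2) as [r Hr].
  specialize (X1 r ltac:(lra)). specialize (X2 r ltac:(lra)).
  set (x := Psi r (s / 3)) in *. set (y := Psi r ((s - 1) / 3)) in *.
  assert (Nxy : x <> y).
  { unfold x, y. intro E. apply Psi_inj in E; try lra. destruct E as [_ E].
    apply eqmod1_small in E. lra. rewrite Rabs_right; lra. }
  assert (Fxy : f x = f y).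
  { unfold x, y. rewrite !Psi_cubic by lra. apply Psi_eqmod1. exists 1%Z. simpl. field. }
  (* Dividing f x = f y by x - y gives this identity. Its right side tends to 0 as [x] and [y]
     approach [q], whereas [g q] is not 0. *)
  assert (E : g x = (- ((x + y - (p + p')) * (y - q)))%C).
  { assert (X : ((x - y) * (g x + (x + y - (p + p')) * (y - q)))%C = RtoC 0).
    { replace (RtoC 0) with (f x - w - (f y - w))%C by (rewrite Fxy; ring).
      rewrite !Fac. unfold g. ring. }
    destruct (Cmult_eq0 _ _ X) as [Y|Y]. elim Nxy. now apply Cminus_eq0.
    apply Cminus_eq0. rewrite <- Y. ring. }
  assert (G1 : m / 2 < Cmod (g x)).
  { assert (X := Cg x ltac:(lra)). generalize (Cmod_diff_le (g x) (g q)). intro Y.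
    assert (Cmod (g x - g q) < m / 2) by exact X. apply Rabs_le_between in Y. fold m in Y. lra. }
  rewrite E, Cmod_opp, Cmod_mult in G1.
  assert (B1 : Cmod (x + y - (p + p')) <= Cst).
  { assert (Bx : Cmod x <= Cmod q + 1). { generalize (Cmod_diff_le x q). intro Y. apply Rabs_le_between in Y. lra. }
    assert (By : Cmod y <= Cmod q + 1). { generalize (Cmod_diff_le y q). intro Y. apply Rabs_le_between in Y. lra. }
    unfold Cst. unfold Cminus. eapply Rle_trans; [apply Cmod_triangle|]. rewrite Cmod_opp.
    generalize (Cmod_triangle x y) (Cmod_triangle p p'). lra. }
  assert (B2 : Cmod (y - q) <= m / 2 / Cst) by lra.
  assert (Cmod (x + y - (p + p')) * Cmod (y - q) <= Cst * (m / 2 / Cst)).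
  { apply Rmult_le_compat; auto; apply Cmod_ge_0. }
  replace (Cst * (m / 2 / Cst)) with (m / 2) in H by (field; lra). lra.
Qed.

(* The pullbacks of the ray of [gamma] along the orbit of [alpha] stay in [U] and, by
   [Psi_shrink], drag the ray of [alpha] along. *)
Lemma KstarAngle_attracts (a0 b0 : R) :
  (forall x, KstarAngle (3 * x) -> (forall t, a0 <= t <= b0 -> ~ eqmod1 x t) -> KstarAngle x) ->
  forall alpha gamma k d, (1 <= k)%nat -> eqmod1 (3 ^ k * alpha) alpha ->
  (forall j x, Rabs (x - 3 ^ j * alpha) < d -> forall t, a0 <= t <= b0 -> ~ eqmod1 x t) ->
  KstarAngle gamma -> Rabs (gamma - alpha) < d -> KstarAngle alpha.
Proof.
  intros HP alpha gamma k d Hk Per Hd Hg Hga.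
  assert (P3 := pow3_pos). set (D := gamma - alpha) in *.
  assert (Tail : forall x z, Lands x z -> U z -> exists r, 0 < r /\ forall rho, 0 < rho <= r -> U (Psi rho x)).
  { intros x z Hl Uz. destruct (HUo z Uz) as [e [He B]]. destruct (Hl e He) as [r [Hr X]].
    exists (r / 2). split; [lra|]. intros rho Hrho. apply B, X. lra. }
  assert (Hg' := Hg). destruct Hg' as [_ [w [Lw Kw]]].
  destruct (Tail gamma w Lw (Kstar_U _ Kw)) as [rg [Hrg Trg]].
  (* [x + D / 3 ^ i] is the [i]-fold preimage of [gamma] that follows the orbit of [alpha]. It stays
     within [d] of that orbit, so [HP] makes its ray land in [K^*]; the tail of the ray is then in
     [U], and [ray_stays] extends this up to potential [rg / 3 ^ i]. *)
  assert (Claim : forall i x j, eqmod1 (3 ^ i * x) alpha -> eqmod1 x (3 ^ j * alpha) ->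
    KstarAngle (x + D / 3 ^ i) /\ forall rho, 0 < rho <= rg / 3 ^ i -> U (Psi rho (x + D / 3 ^ i))).
  { induction i as [|i IH]; intros x j H1 H2.
    - simpl in *. rewrite Rmult_1_l in H1.
      assert (E : eqmod1 gamma (x + D / 1)).
      { apply eqmod1_sym. destruct H1 as [m Hm]. exists m. unfold D. rewrite <- Hm. field. }
      split. now apply (KstarAngle_eqmod1 gamma). intros rho Hrho. rewrite <- (Psi_eqmod1 rho _ _ E).
      apply Trg. lra.
    - assert (Pi := P3 i).
      assert (E3 : 3 * (x + D / 3 ^ S i) = 3 * x + D / 3 ^ i) by (simpl; field; lra).
      destruct (IH (3 * x) (S j)) as [I1 I2].
      { simpl in H1. replace (3 ^ i * (3 * x)) with (3 * 3 ^ i * x) by ring. auto. }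
      { simpl. rewrite Rmult_assoc. now apply eqmod1_3. }
      rewrite <- E3 in I1, I2.
      assert (KA : KstarAngle (x + D / 3 ^ S i)).
      { apply HP; auto. intros t Ht E. destruct H2 as [m Hm].
        apply (Hd j (x + D / 3 ^ S i - IZR m)) with (t := t); auto.
        - replace (x + D / 3 ^ S i - IZR m - 3 ^ j * alpha) with (D / 3 ^ S i) by (rewrite <- Hm; ring).
          unfold Rdiv. rewrite Rabs_mult, (Rabs_right (/ 3 ^ S i)).
          eapply Rle_lt_trans; [apply div_pow3_le; apply Rabs_pos|auto].
          left. apply Rinv_0_lt_compat, P3.
        - apply (eqmod1_trans (x + D / 3 ^ S i)); auto. exists (- m)%Z. rewrite opp_IZR. ring. }
      split; auto. intros rho Hrho. assert (KA' := KA). destruct KA' as [_ [z [Lz Kz]]].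
      destruct (Tail _ _ Lz (Kstar_U _ Kz)) as [r [Hr Tr]].
      set (s := Rmin r rho). assert (Hs : 0 < s /\ s <= r /\ s <= rho) by (unfold s; rmin).
      apply (ray_stays (x + D / 3 ^ S i) s rho s); try lra.
      + intros rho' Hrho'. apply I2. split; [lra|].
        assert (rg / 3 ^ S i * 3 = rg / 3 ^ i) by (simpl; field; lra). lra.
      + apply Tr. lra. }
  destruct (lands_periodic k alpha Hk Per) as [z Lz].
  split.
  { exists 0%nat, k. split; auto. unfold sig3n. simpl. rewrite Rmult_1_l. auto. }
  exists z. split; auto.
  assert (App : forall eps, 0 < eps -> exists n0, forall n, (n0 <= n)%nat ->
     Cmod (Psi (rg / 3 ^ n) (alpha + D / 3 ^ n) - z) < eps).
  (* Angular displacement and potential shrink at the same rate; their ratio |D| / rg is constant,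
     which is what [Psi_shrink] requires. *)
  { intros eps He. set (A := 1 + Rabs D / rg).
    assert (HA : 1 <= A).
    { unfold A. assert (0 <= Rabs D / rg) by (apply Rmult_le_pos; [apply Rabs_pos|left; now apply Rinv_0_lt_compat]). lra. }
    destruct (Psi_shrink A (eps / 2) HA ltac:(lra)) as [r1 [Hr1 Sh]].
    destruct (Lz (eps / 2) ltac:(lra)) as [r2 [Hr2 X2]].
    destruct (exists_below r1 r2 Hr1 Hr2) as [r3 Hr3].
    destruct (div_pow3_small rg r3 Hrg ltac:(lra)) as [n0 Hn0].
    exists n0. intros n Hn. assert (Sm := Hn0 n Hn). assert (Pn := P3 n).
    assert (S1 := X2 (rg / 3 ^ n) ltac:(lra)).
    assert (S2 : Cmod (Psi (rg / 3 ^ n) (alpha + D / 3 ^ n) - Psi (rg / 3 ^ n) alpha) < eps / 2).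
    { apply Sh. lra.
      - split. apply Rle_div_l; [lra|]. nra. nra.
      - replace (alpha + D / 3 ^ n - alpha) with (D / 3 ^ n) by ring.
        unfold Rdiv. rewrite Rabs_mult, (Rabs_right (/ 3 ^ n)) by (left; now apply Rinv_0_lt_compat).
        replace (A * (rg * / 3 ^ n)) with ((rg + Rabs D) * / 3 ^ n) by (unfold A; field; lra).
        apply Rmult_le_compat_r. left; now apply Rinv_0_lt_compat. lra. }
    generalize (Cdist_tri (Psi (rg / 3 ^ n) alpha) (Psi (rg / 3 ^ n) (alpha + D / 3 ^ n)) z). lra. }
  intro m. apply U_limit. intros eps He.
  destruct (iterate_cont m z eps He) as [dl [Hdl Y]].
  destruct (App dl Hdl) as [n0 Hn0].
  (* A multiple of the period, so that the [n]-fold pullback along the orbit starts at [alpha]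
     itself; at least [m + 1], since [U_limit] needs both the [m]-th iterate and its image in
     [U]. *)
  set (n := (k * (n0 + S m))%nat).
  assert (Hn : (n0 <= n /\ S m <= n)%nat) by (unfold n; nia).
  specialize (Hn0 n ltac:(lia)). apply Y in Hn0.
  assert (Pn := P3 n).
  assert (It : forall l, (l <= n)%nat -> U (iterate f l (Psi (rg / 3 ^ n) (alpha + D / 3 ^ n)))).
  { intros l Hl. rewrite Psi_iterate by (now apply Rdiv_lt_0_compat).
    destruct (Claim (n - l)%nat (3 ^ l * alpha) l) as [_ C2].
    - rewrite <- Rmult_assoc, <- pow_add. replace (n - l + l)%nat with n by lia.
      unfold n. now apply three_periodic_pow.
    - apply eqmod1_refl.
    - assert (E : 3 ^ n = 3 ^ (n - l) * 3 ^ l) by (rewrite <- pow_add; f_equal; lia).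
      assert (Q1 := P3 l). assert (Q2 := P3 (n - l)%nat).
      replace (3 ^ l * (alpha + D / 3 ^ n)) with (3 ^ l * alpha + D / 3 ^ (n - l)) by (rewrite E; field; lra).
      apply C2. replace (3 ^ l * (rg / 3 ^ n)) with (rg / 3 ^ (n - l)) by (rewrite E; field; lra).
      split; [|lra]. now apply Rdiv_lt_0_compat. }
  exists (iterate f m (Psi (rg / 3 ^ n) (alpha + D / 3 ^ n))). split; [apply It; lia|]. split; auto.
  rewrite <- iterate_S. apply It. lia.
Qed.

End CubicDynamics.

(** * The gap *)

Lemma gap_set_eqmod1 A x y : gap_set A -> eqmod1 x y -> A x -> A y.
Proof.
  intros [Hp _] [k Hk] Hx.
  assert (P : forall (n : nat) z, A z <-> A (z + INR n)).
  { induction n; intro z. simpl. now rewrite Rplus_0_r. rewrite IHn, S_INR, <- Rplus_assoc. apply Hp. }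
  destruct (Z_le_dec 0 k) as [H|H].
  - apply (P (Z.to_nat k)). rewrite INR_IZR_INZ, Z2Nat.id by auto.
    replace (y + IZR k) with x by lra. auto.
  - replace y with (x + INR (Z.to_nat (- k))). now apply P.
    rewrite INR_IZR_INZ, Z2Nat.id by lia. rewrite opp_IZR. lra.
Qed.

Lemma last_point (A : R -> Prop) x y :
  (forall t, (forall eps, 0 < eps -> exists s, A s /\ Rabs (s - t) < eps) -> A t) -> A x -> x <= y ->
  exists s, x <= s <= y /\ A s /\ forall t, s < t <= y -> ~ A t.
Proof.
  intros Acl Ax Hxy. destruct (completeness (fun t => x <= t <= y /\ A t)) as [s [S1 S2]].
  { exists y. intros t Ht. lra. }
  { exists x. split; [lra|auto]. }
  assert (B1 : x <= s) by (apply S1; split; [lra|auto]).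
  assert (B2 : s <= y) by (apply S2; intros t Ht; lra).
  exists s. split; [lra|]. split.
  - apply Acl. intros eps Heps. apply NNPP. intro N'.
    assert (s <= s - eps / 2); [|lra]. apply S2. intros t [Ht At]. apply Rnot_lt_le. intro Hlt. apply N'.
    exists t. split; auto. assert (t <= s) by (apply S1; auto). apply Rabs_def1; lra.
  - intros t Ht At. assert (t <= s); [|lra]. apply S1. split; [lra|auto].
Qed.

(* Near a point of [A] the collapsing map is not constant, so a point of [A] cannot be mapped
   into a hole. *)
Lemma quadratic_gap_triple A x : gap_set A -> quadratic_gap A -> A x -> A (3 * x).
Proof.
  intros HA [psi [g [Cpsi [Mpsi [Ppsi [Hpsi [Cg [Mg [_ Hg]]]]]]]]] Ax.
  destruct HA as [Aper [Acl _]].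
  apply NNPP. intro N.
  assert (E : exists e, 0 < e /\ forall y, Rabs (y - 3 * x) < e -> ~ A y).
  { apply NNPP. intro N'. apply N, Acl. intros e He. apply NNPP. intro N''. apply N'.
    exists e. split; auto. intros y Hy Ay. apply N''. exists y; auto. }
  destruct E as [e [He Hfree]].
  assert (Const : forall y, Rabs (y - 3 * x) < Rmin e 1 -> psi y = psi (3 * x)).
  { intros y Hy. generalize (Rmin_l e 1) (Rmin_r e 1). intros m1 m2. apply Rabs_def2 in Hy.
    destruct (Rtotal_order y (3 * x)) as [L|[->|L]]; auto.
    - apply Hpsi. lra. intros t Ht. apply Hfree. apply Rabs_def1; lra.
    - symmetry. apply Hpsi. lra. intros t Ht. apply Hfree. apply Rabs_def1; lra. }
  assert (Cc : continuity_pt (fun y => g (psi y)) x).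
  { apply (continuity_pt_comp psi g). apply Cpsi. apply Cg. }
  destruct (Cc 1 Rlt_0_1) as [d [Hd Hc]].
  set (d' := Rmin (Rmin d (Rmin e 1 / 3)) (1 / 3)).
  assert (Hd' : 0 < d' /\ d' <= d /\ d' <= Rmin e 1 / 3 /\ d' <= 1 / 3).
  { unfold d'. rmin. }
  (* The values of [g] at [psi y] and [psi x] agree mod 1, and by continuity they differ by less
     than 1; so they agree, and [g] is strictly increasing. *)
  assert (Eq : forall y, A y -> Rabs (y - x) < d' -> psi y = psi x).
  { intros y Ay Hy.
    assert (E1 : psi (3 * y) = psi (3 * x)).
    { apply Const. rewrite <- Rmult_minus_distr_l, Rabs_mult, Rabs_right by lra. lra. }
    destruct (Hg y Ay) as [k Hk]. destruct (Hg x Ax) as [l Hl].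
    assert (E2 : eqmod1 (g (psi y)) (g (psi x))).
    { exists (l - k)%Z. rewrite minus_IZR. lra. }
    apply eqmod1_small in E2.
    - destruct (Rtotal_order (psi y) (psi x)) as [L|[L|L]]; auto; apply Mg in L; lra.
    - destruct (Req_dec y x) as [->|Ny]. rewrite Rminus_diag, Rabs_R0. lra.
      apply (Hc y). split. split; [exact I|auto]. simpl. unfold R_dist. lra. }
  (* Between [x] and [y] there is a point of [A] nearest to [y], and [psi] is constant from that
     point to [y]. So [psi] is constant around [x], and an interval where it is constant misses
     [A]. *)
  assert (All : forall y, Rabs (y - x) < d' -> psi y = psi x).
  { intros y Hy. apply Rabs_def2 in Hy. destruct (Rle_dec x y) as [L|L].
    - destruct (last_point A x y Acl Ax L) as [s [Hs [As Fs]]].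
      rewrite <- (Eq s); auto; [|apply Rabs_def1; lra].
      destruct (Req_dec y s) as [->|Ny]; auto. symmetry. apply Hpsi. lra. intros t Ht. apply Fs. lra.
    - destruct (last_point (fun t => A (- t)) (- x) (- y)) as [s [Hs [As Fs]]]; [|now rewrite Ropp_involutive|lra|].
      { intros t Ht. apply Acl. intros eps Heps. destruct (Ht eps Heps) as [w [Aw Hw]]. exists (- w). split; auto.
        replace (- w - - t) with (- (w - t)) by ring. now rewrite Rabs_Ropp. }
      rewrite <- (Eq (- s)); auto; [|apply Rabs_def1; lra].
      destruct (Req_dec y (- s)) as [->|Ny]; auto. apply Hpsi. lra.
      intros t Ht At. apply (Fs (- t)). lra. now rewrite Ropp_involutive. }
  assert (Fr : forall t, x - d' / 2 < t < x + d' / 2 -> ~ A t).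
  { apply Hpsi. lra. rewrite (All (x - d' / 2)), (All (x + d' / 2)); auto; apply Rabs_def1; lra. }
  apply (Fr x); auto. lra.
Qed.

Lemma avoid_margin a b p : a < b -> (forall t, a <= t <= b -> ~ eqmod1 p t) ->
  exists d, 0 < d /\ forall x, Rabs (x - p) < d -> forall t, a <= t <= b -> ~ eqmod1 x t.
Proof.
  intros Hab Hp. destruct (eqmod1_norm a p) as [p' [[k Hk] Hp']].
  assert (Hb : b < p').
  { apply Rnot_le_lt. intro H. apply (Hp p'); [lra|]. exists k; auto. }
  exists (Rmin (p' - b) (a + 1 - p')). split. apply Rmin_pos; lra.
  intros x Hx t Ht [l Hl]. generalize (Rmin_l (p' - b) (a + 1 - p')) (Rmin_r (p' - b) (a + 1 - p')). intros.
  apply Rabs_def2 in Hx.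
  assert (E : IZR (l - k) = x - IZR k - t) by (rewrite minus_IZR; lra).
  assert (0 < IZR (l - k) < 1) by (rewrite E; lra).
  destruct H1 as [L1 L2]. apply lt_IZR in L1. apply lt_IZR in L2. lia.
Qed.

(** * Angle tripling and intervals free of a backward invariant set *)

Section Combinatorics.
Context (S : R -> Prop) (a b : R).
Context (Hab : 1 / 3 <= b - a) (Sper : forall x y, eqmod1 x y -> S x -> S y) (Sne : exists s, S s)
  (Sgap : forall s, a < s < b -> ~ S s)
  (Sback : forall x, S (3 * x) -> (forall t, a <= t <= b -> ~ eqmod1 x t) -> S x).

Definition free (y z : R) : Prop := forall s, y < s < z -> ~ S s.

Lemma free_length y z : free y z -> z - y <= 1.
Proof.
  intro H. apply Rnot_lt_le. intro L. destruct Sne as [s Hs].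
  destruct (eqmod1_norm (y + (z - y - 1) / 2) s) as [s' [E Hs']].
  apply (H s'). lra. now apply (Sper s).
Qed.

(** While the images of a free interval miss [[a, b]] mod 1, [Sback] makes the tripled interval free
    as well; this must stop, because a free interval has length at most 1. *)
Lemma free_grow y z : y < z -> free y z -> exists i (m : Z) t, free (3 ^ i * y) (3 ^ i * z) /\
  a <= t <= b /\ 3 ^ i * y < t + IZR m < 3 ^ i * z.
Proof.
  intros Hyz Hf. apply NNPP. intro N.
  assert (G : forall i, free (3 ^ i * y) (3 ^ i * z)).
  { induction i as [|i IH]. simpl. now rewrite !Rmult_1_l.
    intros s Hs Ss. simpl in Hs. apply (IH (s / 3)). lra. apply Sback.
    replace (3 * (s / 3)) with s by field. auto.
    intros t Ht [m Hm]. apply N. exists i, m, t. split; auto. split; auto.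
    replace (t + IZR m) with (s / 3) by lra. lra. }
  destruct (pow_unbounded 3 (z - y) 2) as [n Hn]; try lra.
  specialize (Hn n (le_n n)). assert (L := free_length _ _ (G n)). lra.
Qed.

(** The free interval to the right of [alpha] grows until it meets [[a, b]]. Its left end, an orbit
    point, then lies left of [a], and the hole [(a, b)] continues the free interval up to [b]. *)
Lemma free_left alpha d : 0 < d -> free alpha (alpha + d) ->
  (forall j t, a <= t <= b -> ~ eqmod1 (3 ^ j * alpha) t) ->
  exists j x, eqmod1 x (3 ^ j * alpha) /\ x < a /\ free x b.
Proof.
  intros Hd Hf Hav. destruct (free_grow alpha (alpha + d) ltac:(lra) Hf) as [i [m [t [F [Ht Htm]]]]].
  exists i, (3 ^ i * alpha - IZR m).
  assert (E : eqmod1 (3 ^ i * alpha - IZR m) (3 ^ i * alpha)) by (exists (- m)%Z; rewrite opp_IZR; ring).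
  split; auto. split.
  - apply Rnot_le_lt. intro H. apply (Hav i (3 ^ i * alpha - IZR m)). lra. now apply eqmod1_sym.
  - intros s Hs Ss. destruct (Rle_dec s t) as [L|L].
    + apply (F (s + IZR m)). lra. apply (Sper s); auto. apply eqmod1_sym, eqmod1_shift.
    + apply (Sgap s); auto. lra.
Qed.

End Combinatorics.

(** The dilation by [q] about [u] eventually carries [x] past [a]; [y] is the last iterate before
    that. *)
Lemma expanding_exit (O : R -> Prop) q u a x : 1 < q -> u < x < a -> O x ->
  (forall y, O y -> O (u + q * (y - u))) -> exists y, y < a <= u + q * (y - u) /\ O (u + q * (y - u)).
Proof.
  intros Hq Hx Ox HO.
  assert (Ow : forall n, O (u + q ^ n * (x - u))).
  { induction n. simpl. now replace (u + 1 * (x - u)) with x by ring.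
    apply HO in IHn. simpl. now replace (u + q * q ^ n * (x - u)) with (u + q * (u + q ^ n * (x - u) - u)) by ring. }
  destruct (pow_unbounded q (x - u) (a - u)) as [n0 Hn0]; try lra.
  destruct (least_nat (fun n => a - u <= q ^ n * (x - u)) (ex_intro _ n0 (Hn0 n0 (le_n n0)))) as [n [Hn Hmin]].
  destruct n as [|n]. simpl in Hn. lra.
  exists (u + q ^ n * (x - u)).
  replace (u + q * (u + q ^ n * (x - u) - u)) with (u + q ^ Datatypes.S n * (x - u)) by (simpl; ring).
  split; [split; [|lra]|auto]. apply Rnot_le_lt. intro H.
  assert (Datatypes.S n <= n)%nat by (apply Hmin; lra). lia.
Qed.

(* A periodic orbit that avoids [[a,b]] cannot stay away from [S]: otherwise the component
   [(u,v)] of the complement of [S] containing [(a,b)] returns to itself; the return map expands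
   from [u] to the left of [a] and from [v] to the right of [b], so it moves some orbit point
   left of [a] beyond [b] and some orbit point right of [b] below [a], although the two
   branches preserve the order. *)
Lemma periodic_orbit_approached (S : R -> Prop) (a b alpha d : R) :
  1 / 3 <= b - a -> (forall x y, eqmod1 x y -> S x -> S y) -> (exists s, S s) ->
  (forall x, S x -> S (3 * x)) ->
  (forall s, a < s < b -> ~ S s) ->
  (forall x, S (3 * x) -> (forall t, a <= t <= b -> ~ eqmod1 x t) -> S x) ->
  (forall s, S s -> S (s / 3) \/ S ((s - 1) / 3)) ->
  (forall j t, a <= t <= b -> ~ eqmod1 (3 ^ j * alpha) t) -> 0 < d ->
  exists j s, S s /\ Rabs (s - 3 ^ j * alpha) < d.
Proof.
  intros Hab Sper Sne Sfw Sgap Sback Stwo Hav Hd. apply NNPP. intro N.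
  set (O := fun x => exists j, eqmod1 x (3 ^ j * alpha)).
  assert (Far : forall x s, O x -> S s -> d <= Rabs (s - x)).
  { intros x s [j [m Hm]] Ss. apply Rnot_lt_le. intro H. apply N. exists j, (s - IZR m). split.
    - apply (Sper s); auto. exists m. ring.
    - replace (s - IZR m - 3 ^ j * alpha) with (s - x) by lra. auto. }
  assert (Oav : forall x, O x -> ~ (a <= x <= b)).
  { intros x [j Hj] Hx. apply (Hav j x Hx). now apply eqmod1_sym. }
  assert (O3 : forall i x (m : Z), O x -> O (3 ^ i * x + IZR m)).
  { intros i x m [j Hj]. exists (i + j)%nat. rewrite pow_add, Rmult_assoc.
    eapply eqmod1_trans. apply eqmod1_shift. now apply eqmod1_pow3. }
  destruct (free_left S a b Sper Sne Sgap Sback alpha d Hd) as [j1 [x1 [E1 [L1 F1]]]]; auto.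
  { intros s Hs Ss. assert (X := Far alpha s). rewrite Rabs_right in X by lra.
    assert (d <= s - alpha); [|lra]. apply X; auto. exists 0%nat. simpl. rewrite Rmult_1_l. apply eqmod1_refl. }
  (* The reflected set and arc give the mirror statement, an orbit point to the right of [b]. *)
  destruct (free_left (fun x => S (- x)) (- b) (- a)) with (alpha := - alpha) (d := d) as [j2 [x2' [E2 [L2 F2]]]]; auto.
  { intros x y [k Hk]. apply Sper. exists (- k)%Z. rewrite opp_IZR. lra. }
  { destruct Sne as [s Hs]. exists (- s). now rewrite Ropp_involutive. }
  { intros s Hs. apply Sgap. lra. }
  { intros x Hx Ht. apply Sback. now replace (3 * - x) with (- (3 * x)) by ring.
    intros t Htt [k Hk]. apply (Ht (- t)). lra. exists (- k)%Z. rewrite opp_IZR. lra. }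
  { intros s Hs Ss. assert (X := Far alpha (- s)). rewrite Rabs_left in X by lra.
    assert (d <= - (- s - alpha)); [|lra]. apply X; auto. exists 0%nat. simpl. rewrite Rmult_1_l. apply eqmod1_refl. }
  { intros j t Ht [k Hk]. apply (Hav j (- t)). lra. exists (- k)%Z. rewrite opp_IZR. lra. }
  set (x2 := - x2').
  assert (O1 : O x1) by (exists j1; auto).
  assert (O2 : O x2). { exists j2. destruct E2 as [k Hk]. exists (- k)%Z. unfold x2. rewrite opp_IZR. lra. }
  assert (Hx2 : b < x2) by (unfold x2; lra).
  assert (F3 : forall s, x1 < s < x2 -> ~ S s).
  { intros s Hs Ss. destruct (Rlt_dec s b) as [H|H].
    - apply (F1 s); auto. lra.
    - apply (F2 (- s)). unfold x2 in Hs. lra. now rewrite Ropp_involutive. }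
  destruct Sne as [s0 Hs0].
  (* [(u, v)] with [v = - v'] is the maximal free interval containing [(x1, x2)]. Its ends are only
     limits of points of [S], which is what [Lu] and [Lv] record. *)
  destruct (completeness (fun s => S s /\ s <= x1)) as [u [U1 U2]].
  { exists x1. intros s Hs. lra. }
  { destruct (eqmod1_norm (x1 - 1) s0) as [s [E Hs]]. exists s. split; [|lra]. now apply (Sper s0). }
  destruct (completeness (fun s => S (- s) /\ s <= - x2)) as [v' [V1 V2]].
  { exists (- x2). intros s Hs. lra. }
  { destruct (eqmod1_norm x2 s0) as [s [E Hs]]. exists (- s). rewrite Ropp_involutive. split; [|lra]. now apply (Sper s0). }
  set (v := - v').
  assert (Hu : u <= x1 - d).
  { apply U2. intros s [Ss Hs]. generalize (Far x1 s O1 Ss). rewrite Rabs_left1 by lra. lra. }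
  assert (Hv : x2 + d <= v).
  { assert (v' <= - x2 - d); [|unfold v; lra]. apply V2. intros s [Ss Hs].
    generalize (Far x2 (- s) O2 Ss). rewrite Rabs_right by lra. lra. }
  assert (Fuv : free S u v).
  { intros s Hs Ss. destruct (Rle_dec s x1) as [H|H].
    - assert (s <= u) by (apply U1; auto). lra.
    - destruct (Rle_dec x2 s) as [H'|H'].
      + assert (- s <= v'). { apply V1. rewrite Ropp_involutive. split; auto. lra. } unfold v in Hs. lra.
      + apply (F3 s); auto. lra. }
  assert (Lu : forall e, 0 < e -> exists s, S s /\ u - e < s <= u).
  { intros e He. apply NNPP. intro N'. assert (u <= u - e); [|lra]. apply U2. intros s Hs.
    apply Rnot_lt_le. intro H. apply N'. exists s. split. apply Hs. split; auto. }
  assert (Lv : forall e, 0 < e -> exists s, S s /\ v <= s < v + e).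
  { intros e He. apply NNPP. intro N'. assert (v' <= v' - e); [|lra]. apply V2. intros s Hs.
    apply Rnot_lt_le. intro H. apply N'. exists (- s). split. apply Hs. unfold v.
    assert (s <= v') by (apply V1; auto). lra. }
  (* For [s] in this interval both s / 3 and (s - 1) / 3 lie in [(u, v)], so [Stwo] excludes [S s].
     The interval is nonempty because [(u, v)] is longer than 1/3. *)
  assert (F0 : free S (3 * u + 1) (3 * v)).
  { intros s Hs Ss. destruct (Stwo s Ss) as [H|H].
    - apply (Fuv (s / 3)); auto. lra.
    - apply (Fuv ((s - 1) / 3)); auto. lra. }
  destruct (free_grow S a b Sper (ex_intro _ s0 Hs0) Sback (3 * u + 1) (3 * v) ltac:(lra) F0) as [i [m [t [Fi [Ht Htm]]]]].
  set (y := 3 ^ i * (3 * u + 1) - IZR m). set (z := 3 ^ i * (3 * v) - IZR m).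
  assert (P3 := pow3_pos i).
  assert (Fyz : free S y z).
  { intros s Hs Ss. apply (Fi (s + IZR m)). unfold y, z in Hs. lra.
    apply (Sper s); auto. apply eqmod1_sym, eqmod1_shift. }
  assert (Spow : forall n x, S x -> S (3 ^ n * x)).
  { induction n; intros x Hx; simpl. now rewrite Rmult_1_l. rewrite Rmult_assoc. now apply Sfw, IHn. }
  assert (Pi3 : 3 ^ Datatypes.S i = 3 * 3 ^ i) by reflexivity.
  assert (Ly : forall e, 0 < e -> exists s, S s /\ y - e < s <= y).
  { intros e He. destruct (Lu (e / (3 * 3 ^ i))) as [s [Ss Hs]]. apply Rdiv_lt_0_compat; lra.
    exists (3 ^ i * (3 * s + 1) - IZR m). split.
    - apply (Sper (3 ^ Datatypes.S i * s)). 2: now apply Spow.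
      exists (m - 3 ^ Z.of_nat i)%Z. rewrite minus_IZR, <- pow_IZR, Pi3. ring.
    - unfold y. destruct Hs as [Hs1 Hs2]. split.
      + apply (Rmult_lt_compat_l (3 * 3 ^ i)) in Hs1; [|lra].
        rewrite Rmult_minus_distr_l in Hs1. replace (3 * 3 ^ i * (e / (3 * 3 ^ i))) with e in Hs1 by (field; lra). lra.
      + nra. }
  assert (Lz : forall e, 0 < e -> exists s, S s /\ z <= s < z + e).
  { intros e He. destruct (Lv (e / (3 * 3 ^ i))) as [s [Ss Hs]]. apply Rdiv_lt_0_compat; lra.
    exists (3 ^ i * (3 * s) - IZR m). split.
    - apply (Sper (3 ^ Datatypes.S i * s)). 2: now apply Spow.
      exists m. rewrite Pi3. ring.
    - unfold z. destruct Hs as [Hs1 Hs2]. split.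
      + nra.
      + apply (Rmult_lt_compat_l (3 * 3 ^ i)) in Hs2; [|lra].
        rewrite Rmult_plus_distr_l in Hs2. replace (3 * 3 ^ i * (e / (3 * 3 ^ i))) with e in Hs2 by (field; lra). lra. }
  assert (Hyt : y < t < z) by (unfold y, z; lra).
  (* [(u, v)] and [(y, z)] are free, both contain [t], and their ends are limits of [S] from
     outside; such intervals coincide. *)
  assert (Eyu : y = u).
  { destruct (Rtotal_order y u) as [H|[H|H]]; auto; exfalso.
    - destruct (Lu (u - y) ltac:(lra)) as [s [Ss Hs]]. apply (Fyz s); auto. lra.
    - destruct (Ly (y - u) ltac:(lra)) as [s [Ss Hs]]. apply (Fuv s); auto. lra. }
  assert (Ezv : z = v).
  { destruct (Rtotal_order z v) as [H|[H|H]]; auto; exfalso.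
    - destruct (Lz (v - z) ltac:(lra)) as [s [Ss Hs]]. apply (Fuv s); auto. lra.
    - destruct (Lv (z - v) ltac:(lra)) as [s [Ss Hs]]. apply (Fyz s); auto. lra. }
  unfold y in Eyu. unfold z in Ezv.
  (* The branch w -> 3^i (3 w + 1) - m fixes [u], the branch w -> 3^i (3 w) - m fixes [v], and both
     are dilations by [q] preserving the orbit [O]. *)
  set (q := 3 * 3 ^ i) in *.
  assert (Hq : 3 <= q) by (unfold q; generalize (pow3_ge1 i); lra).
  assert (Ru : forall w, u + q * (w - u) = 3 ^ i * (3 * w + 1) - IZR m) by (intro; unfold q; lra).
  assert (Rv : forall w, - (- v + q * (w - - v)) = 3 ^ i * (3 * - w) - IZR m) by (intro; unfold q; lra).
  destruct (expanding_exit O q u a x1) as [X1 [[G1 G2] OX1]]; try lra; auto.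
  { intros w Ow. rewrite Ru. replace (3 ^ i * (3 * w + 1) - IZR m) with (3 ^ Datatypes.S i * w + IZR (3 ^ Z.of_nat i - m)).
    now apply O3. rewrite minus_IZR, <- pow_IZR, Pi3. unfold q. ring. }
  destruct (expanding_exit (fun w => O (- w)) q (- v) (- b) (- x2)) as [X2 [[G3 G4] OX2]]; try lra.
  { now rewrite Ropp_involutive. }
  { intros w Ow. rewrite Rv. replace (3 ^ i * (3 * - w) - IZR m) with (3 ^ Datatypes.S i * - w + IZR (- m)).
    now apply O3. rewrite opp_IZR, Pi3. unfold q. ring. }
  apply Oav in OX1. apply Oav in OX2. rewrite Ru in *. assert (R2 := Rv X2). rewrite R2 in OX2.
  (* From X1 < a, -X2 > b and b - a >= 1/3 follows 3 X1 + 1 <= -3 X2. Yet the first branch sends X1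
     beyond [b] and the second sends -X2 below [a], since orbit points avoid [[a, b]]. *)
  assert (3 ^ i * (3 * X1 + 1) <= 3 ^ i * (3 * - X2)) by (apply Rmult_le_compat_l; lra). lra.
Qed.

(** A periodic orbit has finitely many points mod 1, each with its own margin; the least of them
    serves the whole orbit. *)
Lemma orbit_margin a b beta n : a < b -> (1 <= n)%nat -> eqmod1 (3 ^ n * beta) beta ->
  (forall j t, a <= t <= b -> ~ eqmod1 (3 ^ j * beta) t) ->
  exists d, 0 < d /\ forall j x, Rabs (x - 3 ^ j * beta) < d -> forall t, a <= t <= b -> ~ eqmod1 x t.
Proof.
  intros Hab Hn Hper Hav.
  assert (Fin : forall N, exists d, 0 < d /\ forall j, (j < N)%nat -> forall x, Rabs (x - 3 ^ j * beta) < d ->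
    forall t, a <= t <= b -> ~ eqmod1 x t).
  { induction N as [|N [d [Hd IH]]]. exists 1. split; [lra|]. intros; lia.
    destruct (avoid_margin a b (3 ^ N * beta) Hab (Hav N)) as [d' [Hd' X]].
    exists (Rmin d d'). split. now apply Rmin_pos. intros j Hj x Hx.
    destruct (Nat.eq_dec j N) as [->|Nj].
    - apply X. eapply Rlt_min_r, Hx.
    - apply (IH j ltac:(lia)). eapply Rlt_min_l, Hx. }
  destruct (Fin n) as [d [Hd X]]. exists d. split; auto. intros j x Hx t Ht Ex.
  assert (E : eqmod1 (3 ^ j * beta) (3 ^ (j mod n) * beta)).
  { rewrite (Nat.div_mod_eq j n) at 1. rewrite Nat.add_comm, pow_add, Rmult_assoc.
    apply eqmod1_pow3. now apply three_periodic_pow. }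
  destruct E as [m Hm].
  apply (X (j mod n)%nat) with (x := x - IZR m) (t := t); auto.
  - apply Nat.mod_upper_bound. lia.
  - replace (x - IZR m - 3 ^ (j mod n) * beta) with (x - 3 ^ j * beta) by lra. auto.
  - apply (eqmod1_trans x); auto. exists (- m)%Z. rewrite opp_IZR. ring.
Qed.

(** * Landing in [K^*] of the rays with angles in the gap *)

Theorem theorem5p3
  (lam b : C) (U V : C -> Prop) (phi : C -> C)
  (A : R -> Prop) (a0 b0 : R) (alpha : R) :
  Cmod lam <= 1 ->
  connectedC (filled_julia lam b) ->
  jordan_domain U -> jordan_domain V -> compactly_contained U V ->
  U (RtoC 0) ->
  proper_degree2 lam b U V ->
  bottcher lam b phi ->
  (* the gap 𝔘 (lift A of 𝔘 ∩ S^1) and its major hole (a0, b0) *)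
  gap_set A -> s3_invariant A -> quadratic_gap A ->
  hole A a0 b0 -> 1 / 3 <= b0 - a0 ->
  (eqmod1 (3 * a0) (3 * b0) \/ (periodic_angle a0 /\ periodic_angle b0)) ->
  (forall beta z, preperiodic_angle beta -> ray_lands lam b phi beta z ->
     Kstar lam b U z -> A beta) ->
  (forall W, componentC (fun z => V (cubic lam b z)) W ->
     ~ (forall z, W z <-> U z) ->
     forall beta z, preperiodic_angle beta -> ray_lands lam b phi beta z ->
       W z -> Kstar lam b U (cubic lam b z) ->
       exists t, a0 <= t <= b0 /\ eqmod1 beta t) ->
  A alpha -> preperiodic_angle alpha ->
  (forall n, ~ eqmod1 (sig3n n alpha) a0 /\ ~ eqmod1 (sig3n n alpha) b0) ->
  exists z, Kstar lam b U z /\ ray_lands lam b phi alpha z.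
Proof.
  intros _ _ JU _ HUV HU0 Hprop Hphi HA _ HQ Hhole Hlen _ HinA Hmajor Aalpha Palpha Halpha.
  assert (HUo := jordan_domain_open U JU).
  assert (HUb : boundedC U) by (destruct JU as [g [_ [_ H]]]; exact H).
  destruct Hhole as [[Hab _] [_ [_ Hfree]]].
  set (S := KstarAngle lam b phi U).
  assert (SA : forall s, S s -> A s).
  { intros s [H1 [z [H2 H3]]]. apply (HinA s z); auto. now apply (ray_lands_Lands lam b phi Hphi). }
  assert (Sback := KstarAngle_preimage lam b phi Hphi U V HUV a0 b0 Hmajor). fold S in Sback.
  assert (Aorb : forall j, A (3 ^ j * alpha)).
  { induction j. simpl. now rewrite Rmult_1_l. simpl. rewrite Rmult_assoc. now apply quadratic_gap_triple. }
  (* The orbit stays in [A], so it misses the open hole; the ends of the hole are excluded by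
     assumption. *)
  assert (Hav : forall j t, a0 <= t <= b0 -> ~ eqmod1 (3 ^ j * alpha) t).
  { intros j t Ht E. destruct (Halpha j) as [N1 N2]. unfold sig3n in *.
    destruct (Req_dec t a0) as [->|Na]; [auto|]. destruct (Req_dec t b0) as [->|Nb]; [auto|].
    apply (Hfree t). lra. apply (gap_set_eqmod1 A _ _ HA E). apply Aorb. }
  destruct Palpha as [m [n [Hn Hper]]]. unfold sig3n in Hper.
  set (beta := 3 ^ m * alpha).
  assert (Hbeta : eqmod1 (3 ^ n * beta) beta).
  { unfold beta. rewrite <- Rmult_assoc, <- pow_add, Nat.add_comm. exact Hper. }
  assert (Hsh : forall j, 3 ^ j * beta = 3 ^ (j + m) * alpha) by (intro j; unfold beta; rewrite pow_add; ring).
  assert (Hbav : forall j t, a0 <= t <= b0 -> ~ eqmod1 (3 ^ j * beta) t).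
  { intros j t Ht. rewrite Hsh. now apply Hav. }
  destruct (orbit_margin a0 b0 beta n Hab Hn Hbeta Hbav) as [d [Hd Hmargin]].
  destruct (periodic_orbit_approached S a0 b0 beta d) as [j [s [Ss Hs]]]; auto.
  { apply KstarAngle_eqmod1. }
  { destruct (exists_periodic_ray lam b phi Hphi U V HUo HUb HUV HU0 Hprop) as [t [z [[k [Hk Hp]] [Hz Kz]]]].
    exists t. split; [|exists z; auto]. exists 0%nat, k. split; auto. unfold sig3n in *. simpl. rewrite Rmult_1_l. auto. }
  { apply (KstarAngle_triple lam b phi Hphi U). }
  { intros s Hs Ss. apply (Hfree s); auto. }
  { apply (KstarAngle_two_preimages lam b phi Hphi U V HUV Hprop). }
  assert (Sj : S (3 ^ j * beta)).
  { apply (KstarAngle_attracts lam b phi Hphi U V HUo HUV Hprop a0 b0 Sback (3 ^ j * beta) s n d); auto.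
    - replace (3 ^ n * (3 ^ j * beta)) with (3 ^ j * (3 ^ n * beta)) by ring. now apply eqmod1_pow3.
    - intros i x Hx. apply (Hmargin (i + j)%nat). rewrite pow_add, Rmult_assoc. auto. }
  assert (Spow : forall i x, S x -> S (3 ^ i * x)).
  { induction i; intros x Hx; simpl. now rewrite Rmult_1_l. rewrite Rmult_assoc.
    now apply (KstarAngle_triple lam b phi Hphi U), IHi. }
  (* Membership is known at [3 ^ j * beta]. Going on to [3 ^ (n * j) * beta], where n * j >= j
     because n >= 1, returns to [beta] mod 1. *)
  assert (Sbeta : S beta).
  { apply (KstarAngle_eqmod1 lam b phi U (3 ^ (n * j) * beta)). now apply three_periodic_pow.
    replace (n * j)%nat with (n * j - j + j)%nat by nia.
    rewrite pow_add, Rmult_assoc. now apply Spow. }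
  (* From the periodic angle [beta] back to [alpha] each preimage lies on the orbit of [alpha],
     hence off the closed hole, so [Sback] applies. *)
  assert (Sdown : forall i, (i <= m)%nat -> S (3 ^ (m - i) * alpha)).
  { induction i as [|i IH]; intro Hi. now rewrite Nat.sub_0_r.
    apply Sback. 2: now apply Hav.
    rewrite <- Rmult_assoc. change (3 * 3 ^ (m - Datatypes.S i)) with (3 ^ (Datatypes.S (m - Datatypes.S i))).
    replace (Datatypes.S (m - Datatypes.S i)) with (m - i)%nat by lia. apply IH. lia. }
  assert (Salpha := Sdown m (le_n m)). rewrite Nat.sub_diag in Salpha. simpl in Salpha. rewrite Rmult_1_l in Salpha.
  destruct Salpha as [_ [z [Hz Kz]]]. exists z. split; auto. now apply (ray_lands_Lands lam b phi Hphi).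
Qed.
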